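(* Let $\mathcal H$ be a normalized irreducible complete Nevanlinna-Pick space on a set $X$ with kernel $K$. The following assertions are equivalent: (i) $\mathcal H$ is algebraically consistent. (ii) There exists an embedding $j: X\to\mathbb B_m$ for $\mathcal H$ (for some $m\in\mathbb N\cup\{\infty\}$) such that $j(X)$ is a variety. (iii) For every embedding $j:X\to\mathbb B_m$ for $\mathcal H$ (with any $m\in\mathbb N\cup\{\infty\}$), the set $j(X)$ is a variety. (iv) Every weak* continuous character on $\operatorname{Mult}(\mathcal H)$ is given by evaluation at a point in $X$.
   Context: Reproducing kernel Hilbert spaces are separable complex Hilbert spaces of functions on a set. For such a space $\mathcal H$ on $X$ with kernel $K$, $\operatorname{Mult}(\mathcal H)$ is the algebra of all $\varphi : X \to \mathbb C$ with $\varphi\mathcal H \subset \mathcal H$, with norm $\|\varphi\|=\|M_\varphi\|$, $M_\varphi f=\varphi f$. It is identified with a weak* closed subalgebra of $\mathcal B(\mathcal H)$ via $\varphi \mapsto M_\varphi$, and carries the corresponding weak* topology. A character is a non-zero multiplicative linear functional. $\mathcal H$ is normalized if there is $x_0\in X$ with $K(x,x_0)=1$ for all $x\in X$. $\mathcal H$ is irreducible if $K(x,y) \ne 0$ for all $x,y\in X$ and $K(\cdot,x),K(\cdot,y)$ are linearly independent for $x\neq y$. $\mathcal H$ is a complete Nevanlinna-Pick space if for all $n,r \ge 1$, $z_1,\dots,z_n\in X$ and $\Lambda_1,\dots,\Lambda_n \in M_r(\mathbb C)$ such that the block matrix $\big(K(z_i,z_j)(1-\Lambda_i\Lambda_j^*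 )\big)_{i,j}$ is positive semidefinite, there is $\Phi \in M_r(\operatorname{Mult}(\mathcal H))$ of norm at most $1$ (as an operator on $\mathcal H\otimes\mathbb C^r$) with $\Phi(z_i)=\Lambda_i$ for all $i$. If $1\in\mathcal H$ (which holds for normalized spaces), a non-zero bounded linear functional $\rho$ on $\mathcal H$ is partially multiplicative if $\rho(\varphi f)=\rho(\varphi)\rho(f)$ for all $\varphi\in\operatorname{Mult}(\mathcal H)$, $f\in\mathcal H$; $\mathcal H$ is algebraically consistent if for every such $\rho$ there is $x\in X$ with $\rho(f)=f(x)$ for all $f\in\mathcal H$. For $m\in\mathbb N\cup\{\infty\}$, $\mathbb B_m$ is the open unit ball of $\mathbb C^m$ ($\mathbb C^\infty=\ell^2$), and the Drury-Arveson space $H^2_m$ is the reproducing kernel Hilbert space on $\mathbb B_m$ with kernel $k_m(z,w)=1/(1-\langle z,w\rangle)$. A variety in $\mathbb B_m$ is the common zero set (in $\mathbb B_m$) of a family of functions in $H^2_m$. An embedding for $\mathcal H$ is an injective function $j:X\to\mathbb B_m$ with $K(z,w)=k_m(j(z),j(w))$ for all $z,w\in X$. *)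

(* Defs.v *)
From HB Require Import structures.
From mathcomp Require Import all_boot all_order all_algebra.
From mathcomp Require Import complex.
From mathcomp Require Import all_classical all_reals all_analysis.

Set Implicit Arguments.
Unset Strict Implicit.
Unset Printing Implicit Defensive.

Import Order.TTheory GRing.Theory Num.Theory.
Import numFieldNormedType.Exports.
Local Open Scope classical_set_scope.
Local Open Scope complex_scope.
Local Open Scope ring_scope.

(* MathComp-Analysis topologizes a numFieldType F through its copy F^o; this
   transports the structure to R[i] itself. *)
#[non_forgetful_inheritance]
HB.instance Definition _ (R : realType) := NormedModule.copy R[i] R[i]^o.

(* The elements of a space f : H are abstract vectors; rk_fun identifies them
   with functions on X, and rk_kernel y is the function K(., y). The form is
   linear in its first argument and conjugate-linear in its second. *)
Record rkhs (R : realType) (X : Type) := RKHS {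
  rk_space :> completeNormedModType R[i];
  rk_dot : {dot rk_space for Num.conj};
  rk_normE : forall f, `|f| ^+ 2 = rk_dot f f;
  rk_separable : exists A : set rk_space, countable A /\ dense A;
  rk_fun : {linear rk_space -> (X -> R[i])};
  rk_fun_inj : injective rk_fun;
  rk_kernel : X -> rk_space;
  rk_reproducing : forall f x, rk_dot f (rk_kernel x) = rk_fun f x }.

Section Spaces.
Variables (R : realType) (X : Type) (H : rkhs R X).
Local Notation C := (R[i]).

Definition repkernel (x y : X) : C := rk_fun H (rk_kernel H y) x.

(* The element of H whose underlying function is u; junk value 0 if u is not
   in H. *)
Definition elt (u : X -> C) : H := xget 0 [set f : H | rk_fun H f = u].

Lemma rk_funK (f : H) : elt (rk_fun H f) = f.
Proof.
rewrite /elt; case: xgetP => [g _ /rk_fun_inj //|/(_ f) /=]; by case.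
Qed.

Lemma eltK (u : X -> C) : (exists f : H, rk_fun H f = u) -> rk_fun H (elt u) = u.
Proof. by case=> f <-; rewrite rk_funK. Qed.

Definition multiplier : {pred X -> C} :=
  [pred u | `[< forall f : H, exists g : H, rk_fun H g = u * rk_fun H f >]].

Lemma multiplierP (u : X -> C) :
  reflect (forall f : H, exists g : H, rk_fun H g = u * rk_fun H f)
          (u \in multiplier).
Proof. exact: asboolP. Qed.

Fact multiplier_subring : subring_closed multiplier.
Proof.
split.
- by apply/multiplierP => f; exists f; rewrite mul1r.
- move=> u v /multiplierP hu /multiplierP hv; apply/multiplierP => f.
  have [g gE] := hu f; have [h hE] := hv f.
  by exists (g - h); rewrite linearB /= gE hE mulrBl.
- move=> u v /multiplierP hu /multiplierP hv; apply/multiplierP => f.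
  have [g gE] := hv f; have [h hE] := hu g.
  by exists h; rewrite hE gE mulrA.
Qed.

HB.instance Definition _ := GRing.isSubringClosed.Build _ multiplier
  multiplier_subring.

Fact multiplier_scaler : GRing.scaler_closed multiplier.
Proof.
move=> a u /multiplierP hu; apply/multiplierP => f; have [g gE] := hu f.
exists (a *: g); rewrite linearZ /= gE.
by apply/funext => x; exact: (mulrA a).
Qed.

HB.instance Definition _ := GRing.isScaleClosed.Build C (X -> C) multiplier
  multiplier_scaler.

Record mult := Mult {
  mult_val :> X -> C;
  mult_valP : mult_val \in multiplier }.

HB.instance Definition _ := [isSub for mult_val].
HB.instance Definition _ := [Choice of mult by <:].
HB.instance Definition _ :=
  GRing.SubChoice_isSubComPzRing.Build _ _ mult (GRing.subringClosedP multiplier).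
HB.instance Definition _ := [SubZmodule_isSubLmodule of mult by <:].

Definition mulop (phi : mult) (f : H) : H := elt (mult_val phi * rk_fun H f).

Lemma mulopE (phi : mult) (f : H) x :
  rk_fun H (mulop phi f) x = phi x * rk_fun H f x.
Proof.
rewrite /mulop eltK //; exact/multiplierP/mult_valP.
Qed.

Definition square_summable (f : nat -> H) :=
  cvgn (series (fun n => `|f n| ^+ 2 : C)).

(* The pairs below parametrize the trace class operators
   S = \sum_n <., g_n> f_n, and trace_pairing p T = tr (T S). The weak*
   topology of B(H), dual of the trace class, is the initial topology for the
   functionals trace_pairing p. *)
Definition trace_index : Type :=
  {p : (nat -> H) * (nat -> H) | square_summable p.1 /\ square_summable p.2}.

Definition trace_pairing (p : trace_index) (T : H -> H) : C :=
  limn (series (fun n => rk_dot H (T ((sval p).1 n)) ((sval p).2 n))).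

Definition mult_weakstar : topologicalType :=
  initial_topology (fun (phi : mult) =>
    (fun p => trace_pairing p (mulop phi))
      : prod_topology (fun _ : trace_index => C)).

Definition character (chi : mult -> C) :=
  [/\ exists phi, chi phi != 0, linear chi & {morph chi : phi psi / phi * psi}].

Definition weakstar_continuous (chi : mult -> C) :=
  continuous (chi : mult_weakstar -> C).

Definition normalized := exists x0, forall x, repkernel x x0 = 1.

Definition irreducible_space :=
  (forall x y, repkernel x y != 0) /\
  (forall x y, x <> y -> forall a b : C,
    (forall z, a * repkernel z x + b * repkernel z y = 0) -> a = 0 /\ b = 0).

Definition psdmx n (A : 'M[C]_n) :=
  forall v : 'cV[C]_n, 0 <= (v ^t* *m A *m v)%sesqui 0 0.

(* The operator on the direct sum of r copies of H given by Phi has norm at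
   most 1. *)
Definition contractive r (Phi : 'M[mult]_r) :=
  forall f : 'I_r -> H,
    \sum_i `|\sum_j mulop (Phi i j) (f j)| ^+ 2 <= \sum_j `|f j| ^+ 2.

Definition complete_pick :=
  forall n r : nat, (0 < n)%N -> (0 < r)%N ->
  forall (z : 'I_n -> X) (L : 'I_n -> 'M[C]_r),
    psdmx (\mxblock_(i < n, j < n)
      (repkernel (z i) (z j) *: (1%:M - L i *m ((L j) ^t*)%sesqui) : 'M[C]_(r, r))) ->
  exists Phi : 'M[mult]_r, contractive Phi /\
    forall i, map_mx (fun phi : mult => phi (z i)) Phi = L i.

(* phi in Mult(H) is seen as the element elt phi = phi . 1 of H, which is
   meaningful as soon as 1 is in H. *)
Definition partially_multiplicative (rho : H -> C) :=
  forall (phi : mult) (f : H), rho (mulop phi f) = rho (elt phi) * rho f.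

Definition algebraically_consistent :=
  forall rho : H -> C, linear rho ->
    (exists M : C, forall f, `|rho f| <= M * `|f|) ->
    (exists f, rho f != 0) ->
    partially_multiplicative rho ->
  exists x, forall f, rho f = rk_fun H f x.

End Spaces.

Section DruryArveson.
Variables (R : realType) (m : option nat).
Local Notation C := (R[i]).

(* m = Some n is the integer n, m = None is infinity. *)
Definition coord : Type := if m is Some n then 'I_n else nat.

Definition coord_sum : (coord -> C) -> C :=
  match m return ((if m is Some n then 'I_n else nat) -> C) -> C with
  | Some n => fun u => \sum_(i < n) u i
  | None => fun u => limn (series u)
  end.

Definition coord_summable : (coord -> C) -> Prop :=
  match m return ((if m is Some n then 'I_n else nat) -> C) -> Prop with
  | Some n => fun=> True
  | None => fun u => cvgn (series u)
  end.

Definition coord_dot (z w : coord -> C) : C :=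
  coord_sum (fun i => z i * Num.conj (w i)).

Definition ball_of : Type :=
  {z : coord -> C | coord_summable (fun i => `|z i| ^+ 2) /\
                    coord_sum (fun i => `|z i| ^+ 2) < 1}.

Definition drury_arveson_kernel (z w : ball_of) : C :=
  (1 - coord_dot (sval z) (sval w))^-1.

(* D is the (unique) reproducing kernel Hilbert space with this kernel. *)
Definition is_drury_arveson (D : rkhs R ball_of) :=
  forall z w, repkernel D z w = drury_arveson_kernel z w.

Definition variety (V : set ball_of) :=
  exists2 D : rkhs R ball_of, is_drury_arveson D &
  exists S : set D, V = [set z | forall f, S f -> rk_fun D f z = 0].

Definition embedding (X : Type) (H : rkhs R X) (j : X -> ball_of) :=
  injective j /\
  forall z w, repkernel H z w = drury_arveson_kernel (j z) (j w).

End DruryArveson.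

(* Main.v *)
From HB Require Import structures.
Require Import Defs.
From mathcomp Require Import all_boot all_order all_algebra.
From mathcomp Require Import complex.
From mathcomp Require Import all_classical all_reals all_analysis.
From mathcomp Require Import ring lra.

(** The kernel of a space with an embedding [j] is K = 1 / (1 - F), where
    F(x, y) = <j x, j y>.  The coordinates b_i of [j] are then multipliers, and
    their multiplication operators satisfy
      sum_i M_(b_i) M_(b_i)^* = 1 - <., 1> 1                                ($)
    ([row_defect], [kernel_expansion]).  Apply ($) to a vector g with
    M_(b_i)^* g = conj(l_i) g for all i: the result is
    (1 - <b, l>) g = conj(<1, g>) 1.  So a joint eigenspace is at most a line
    ([eigen_one_dim]), and if <1, g> = 1 then l is in the open ball and
    g = k_l o j.

    Partially multiplicative functionals are the <., g> of this form, with
    l_i = rho(b_i) ([pm_riesz], [pm_point]).  Since |g| is as large as |k_l|, the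
    vector k_l lies in the closed span of the k_(j x); every function that
    vanishes on j(X) vanishes at l, and l is in j(X) as soon as j(X) is a
    variety ([consistent_of_variety]).  Conversely, suppose that z is a common
    zero of all functions that vanish on j(X).  Then k_z is in the closed span
    of the k_(j x), and g = k_z o j is a joint eigenvector of the M_(b_i)^*.
    Multipliers commute, so each M_phi^* preserves the eigenline of g; this says
    that <., g> is partially multiplicative ([eigen_pm]), and consistency puts z
    in j(X) ([variety_of_consistent]).  Both arguments are about an arbitrary
    embedding, which settles the first three assertions once one embedding is
    known to exist.

    An embedding comes from the theorem of McCullough and Quiggin: 1 - 1/K is
    positive semidefinite ([psd_base_kernel]), hence a Gram kernel of vectors
    in l^2.  The only factorization used is Cholesky elimination of a positive
    semidefinite kernel along a sequence of points.  On finitely many points it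
    is exact, which gives the Schur product theorem ([psd_mul]); along a dense
    sequence it gives coordinates in l^2 ([psd_feature]) and the existence of
    a reproducing kernel Hilbert space for the kernel ([moore_aronszajn]), in
    particular of the Drury-Arveson spaces ([drury_arveson_exists]).

    A partially multiplicative functional restricts to a character of Mult(H)
    that is a rank-one trace pairing, hence weak* continuous; if this character
    is evaluation at x then l = j x and g is the kernel at x
    ([consistent_of_characters]).  Conversely, a weak* continuous character chi
    satisfies |chi(phi)| <= c |phi Phi| for some Phi in a Hilbert sum of copies
    of H ([weakstar_bounded]).  Let E be the closed submodule generated by Phi,
    and k_E its (matrix-valued) kernel.  The b_i still act on E as a row
    contraction, so (1 - F) k_E is positive semidefinite.  By the Schur product
    theorem the column v = (1 - F(., y)) k_E(., q), q a point over y, then gives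
    a bounded module map phi |-> phi v from H to E.  The Riesz vector of chi in E
    pulls back along it, so chi is bounded in the norm of H ([character_bound]).
    It therefore extends to a partially multiplicative functional
    ([character_pm_vector]), which is evaluation at a point when H is
    consistent ([characters_of_consistent]). *)

Set Implicit Arguments.
Unset Strict Implicit.
Unset Printing Implicit Defensive.

Import Order.TTheory GRing.Theory Num.Theory.
Import numFieldNormedType.Exports.
Local Open Scope classical_set_scope.
Local Open Scope ring_scope.

(** * Real parts and moduli of complex numbers *)

Section ComplexModulus.
Variable R : realType.
Local Notation C := (R[i]).
Implicit Types x y : C.

Definition re x : R := complex.Re x.
Definition modc x : R := re `|x|.
Definition rc (a : R) : C := real_complex R a.

Lemma normc_modc x : `|x| = rc (modc x).
Proof. by rewrite /modc /re normc_def. Qed.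

Lemma rcD a b : rc (a + b) = rc a + rc b. Proof. exact: rmorphD. Qed.
Lemma rcB a b : rc (a - b) = rc a - rc b. Proof. exact: rmorphB. Qed.
Lemma rcM a b : rc (a * b) = rc a * rc b. Proof. exact: rmorphM. Qed.
Lemma rcX a n : rc (a ^+ n) = rc a ^+ n. Proof. exact: rmorphXn. Qed.
Lemma rcV a : rc a^-1 = (rc a)^-1. Proof. exact: fmorphV. Qed.
Lemma rcN a : rc (- a) = - rc a. Proof. exact: rmorphN. Qed.
Lemma rc0 : rc 0 = 0. Proof. by []. Qed.
Lemma rc1 : rc 1 = 1. Proof. by []. Qed.
Lemma rc_le a b : (rc a <= rc b) = (a <= b). Proof. exact: lecR. Qed.
Lemma rc_lt a b : (rc a < rc b) = (a < b). Proof. exact: ltcR. Qed.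
Lemma re_rc a : re (rc a) = a. Proof. by []. Qed.
Lemma rc_inj : injective rc. Proof. exact: complexI. Qed.
Lemma conj_rc a : (rc a)^* = rc a.
Proof. by apply: conj_Creal; rewrite /rc complex_real. Qed.

Lemma reD x y : re (x + y) = re x + re y. Proof. by case: x y => [? ?] [? ?]. Qed.
Lemma reN x : re (- x) = - re x. Proof. by case: x. Qed.
Lemma reB x y : re (x - y) = re x - re y. Proof. by rewrite reD reN. Qed.
Lemma re0 : re 0 = 0. Proof. by []. Qed.
Lemma re1 : re 1 = 1. Proof. by []. Qed.
Lemma reMr a x : re (rc a * x) = a * re x.
Proof. by case: x => b c; rewrite /re /rc /= mul0r subr0. Qed.
Lemma re_sum (I : Type) (r : seq I) (P : pred I) (F : I -> C) :
  re (\sum_(i <- r | P i) F i) = \sum_(i <- r | P i) re (F i).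
Proof. by apply: (big_morph re reD re0). Qed.
Lemma re_conj x : re x^* = re x.
Proof.
have h : rc (re x^*) = rc (re x) by rewrite /rc /re !complexRe Re_conj.
exact: rc_inj.
Qed.

Lemma ge0_re x : 0 <= x -> x = rc (re x).
Proof. by case: x => a b; rewrite lecE /= => /andP[/eqP-> _]. Qed.
Lemma re_ge0 x : 0 <= x -> 0 <= re x.
Proof. by case: x => a b; rewrite lecE /= => /andP[]. Qed.
Lemma real_re x : x^* = x -> x = rc (re x).
Proof.
move=> h; rewrite /rc /re complexRe ReE h -[x + x]mulr2n -[x *+ 2]mulr_natr.
by rewrite mulfK ?pnatr_eq0.
Qed.

Lemma modc_ge0 x : 0 <= modc x.
Proof. by rewrite -rc_le -normc_modc rc0 normr_ge0. Qed.
Lemma modcM x y : modc (x * y) = modc x * modc y.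
Proof. by apply: rc_inj; rewrite rcM -!normc_modc normrM. Qed.
Lemma modcX x n : modc (x ^+ n) = modc x ^+ n.
Proof. by apply: rc_inj; rewrite rcX -!normc_modc normrX. Qed.
Lemma modcV x : modc x^-1 = (modc x)^-1.
Proof. by apply: rc_inj; rewrite rcV -!normc_modc normfV. Qed.
Lemma modcD x y : modc (x + y) <= modc x + modc y.
Proof. by rewrite -rc_le rcD -!normc_modc ler_normD. Qed.
Lemma modcN x : modc (- x) = modc x.
Proof. by apply: rc_inj; rewrite -!normc_modc normrN. Qed.
Lemma modc_distC x y : modc (x - y) = modc (y - x).
Proof. by rewrite -modcN opprB. Qed.
Lemma modc0 : modc 0 = 0.
Proof. by apply: rc_inj; rewrite -normc_modc normr0. Qed.
Lemma modc1 : modc 1 = 1.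
Proof. by apply: rc_inj; rewrite -normc_modc normr1. Qed.
Lemma modc_conj x : modc x^* = modc x.
Proof. by apply: rc_inj; rewrite -!normc_modc norm_conjC. Qed.
Lemma modc_rc a : modc (rc a) = `|a|.
Proof.
by rewrite /modc /rc normc_def /re /= expr0n /= addr0 sqrtr_sqr.
Qed.
Lemma modc_eq0 x : modc x = 0 -> x = 0.
Proof. by move=> h; apply/eqP; rewrite -normr_eq0 normc_modc h. Qed.
Lemma modc_gt0 x : x != 0 -> 0 < modc x.
Proof. by move=> h; rewrite -rc_lt -normc_modc rc0 normr_gt0. Qed.
Lemma mulcJ x : x * x^* = rc (modc x ^+ 2).
Proof. by rewrite rcX -normc_modc normCK. Qed.
Lemma re_le_modc x : re x <= modc x.
Proof.
have := normc_ge_Re x; rewrite normc_modc /rc lecR => h.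
exact: le_trans (ler_norm _) h.
Qed.
Lemma modc_sum (I : Type) (r : seq I) (P : pred I) (F : I -> C) :
  modc (\sum_(i <- r | P i) F i) <= \sum_(i <- r | P i) modc (F i).
Proof.
apply: (big_ind2 (fun (x : C) (a : R) => modc x <= a)) => //.
- by rewrite modc0.
- by move=> x a y b ha hb; apply: le_trans (modcD _ _) _; rewrite lerD.
Qed.

Lemma eps_eq x y : (forall e : R, 0 < e -> modc (x - y) < e) -> x = y.
Proof.
move=> h; apply/eqP; rewrite -subr_eq0; apply/eqP/modc_eq0/eqP.
rewrite eq_le modc_ge0 andbT leNgt; apply/negP => /h; by rewrite ltxx.
Qed.

(** Rotates a complex number onto its modulus; this turns bounds on real parts into
    bounds on moduli. *)
Lemma phase x : exists2 t : C, modc t <= 1 & t * x = rc (modc x).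
Proof.
have [->|x0] := eqVneq x 0; first by exists 0; rewrite ?modc0 ?ler01 // mul0r.
exists (x^* / rc (modc x)).
  rewrite modcM modcV modc_conj modc_rc (ger0_norm (modc_ge0 _)) divff //.
  by rewrite gt_eqF ?modc_gt0.
have m0 : rc (modc x) != 0 by rewrite -normc_modc normr_eq0.
by rewrite mulrAC [x^* * x]mulrC mulcJ rcX expr2 mulfK.
Qed.

End ComplexModulus.

(** * Hilbert spaces: Riesz representation and uniform boundedness *)

(** The part of [rkhs] that does not mention functions, so that l^2 spaces and
    reproducing kernel spaces share one theory. *)
Record hilbert (R : realType) := Hilbert {
  hil_space :> completeNormedModType R[i];
  hil_dot : {dot hil_space for Num.conj};
  hil_normE : forall f, `|f| ^+ 2 = hil_dot f f }.

Definition dotp (R : realType) (V : hilbert R) (u v : V) : R[i] := hil_dot V u v.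
Definition nm (R : realType) (V : hilbert R) (u : V) : R := re `|u|.

Canonical rkhs_hilbert (R : realType) (X : Type) (H : rkhs R X) : hilbert R :=
  Hilbert (@rk_normE _ _ H).

Section HilbertBasics.
Variables (R : realType) (V : hilbert R).
Local Notation C := (R[i]).
Implicit Types (u v w : V) (a : C).

Lemma dotDl u v w : dotp (u + v) w = dotp u w + dotp v w.
Proof. exact: linearDl. Qed.
Lemma dotZl a u v : dotp (a *: u) v = a * dotp u v.
Proof. exact: linearZl_LR. Qed.
Lemma dotNl u v : dotp (- u) v = - dotp u v.
Proof. by rewrite -scaleN1r dotZl mulN1r. Qed.
Lemma dotBl u v w : dotp (u - v) w = dotp u w - dotp v w.
Proof. by rewrite dotDl dotNl. Qed.
Lemma dot0l v : dotp 0 v = 0.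
Proof. by rewrite -[0](scale0r (0 : V)) dotZl mul0r. Qed.
Lemma dotC u v : dotp u v = (dotp v u)^*.
Proof. by rewrite /dotp hermC /= expr0 mul1r. Qed.
Lemma dotDr u v w : dotp u (v + w) = dotp u v + dotp u w.
Proof. by rewrite dotC dotDl rmorphD /= -!dotC. Qed.
Lemma dotZr a u v : dotp u (a *: v) = a^* * dotp u v.
Proof. by rewrite dotC dotZl rmorphM /= -dotC. Qed.
Lemma dotNr u v : dotp u (- v) = - dotp u v.
Proof. by rewrite dotC dotNl rmorphN /= -dotC. Qed.
Lemma dotBr u v w : dotp u (v - w) = dotp u v - dotp u w.
Proof. by rewrite dotDr dotNr. Qed.
Lemma dot0r u : dotp u 0 = 0.
Proof. by rewrite dotC dot0l rmorph0. Qed.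
Lemma dot_suml (I : Type) (r : seq I) (P : pred I) (F : I -> V) v :
  dotp (\sum_(i <- r | P i) F i) v = \sum_(i <- r | P i) dotp (F i) v.
Proof.
by apply: (big_morph (fun x => dotp x v) (fun x y => dotDl x y v) (dot0l v)).
Qed.
Lemma dot_sumr (I : Type) (r : seq I) (P : pred I) (F : I -> V) v :
  dotp v (\sum_(i <- r | P i) F i) = \sum_(i <- r | P i) dotp v (F i).
Proof. by apply: (big_morph (dotp v) (dotDr v) (dot0r v)). Qed.

Lemma norm_nm u : `|u| = rc (nm u).
Proof. by rewrite /nm; apply: ge0_re; rewrite normr_ge0. Qed.
Lemma dotvv u : dotp u u = rc (nm u ^+ 2).
Proof. by rewrite /dotp -hil_normE norm_nm rcX. Qed.
Lemma nm_sqr u : nm u ^+ 2 = re (dotp u u).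
Proof. by rewrite dotvv. Qed.
Lemma nm_ge0 u : 0 <= nm u.
Proof. by apply: re_ge0; rewrite normr_ge0. Qed.
Lemma nmD u v : nm (u + v) <= nm u + nm v.
Proof. by rewrite -rc_le rcD -!norm_nm ler_normD. Qed.
Lemma nmZ a u : nm (a *: u) = modc a * nm u.
Proof. by apply: rc_inj; rewrite rcM -!norm_nm -normc_modc normrZ. Qed.
Lemma nmN u : nm (- u) = nm u.
Proof. by rewrite /nm normrN. Qed.
Lemma nm_distC u v : nm (u - v) = nm (v - u).
Proof. by rewrite -nmN opprB. Qed.
Lemma nm0 : nm (0 : V) = 0.
Proof. by rewrite /nm normr0. Qed.
Lemma nm_eq0 u : nm u = 0 -> u = 0.
Proof. by move=> h; apply/eqP; rewrite -normr_eq0 norm_nm h. Qed.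
Lemma nm_triangle u v w : nm (u - w) <= nm (u - v) + nm (v - w).
Proof. by rewrite -[u - w](subrKA v) nmD. Qed.
Lemma nmD_sqr u v : nm (u + v) ^+ 2 = nm u ^+ 2 + nm v ^+ 2 + 2 * re (dotp u v).
Proof.
rewrite !nm_sqr dotDl !dotDr !reD [dotp v u]dotC re_conj; ring.
Qed.
Lemma nmB_sqr u v : nm (u - v) ^+ 2 = nm u ^+ 2 + nm v ^+ 2 - 2 * re (dotp u v).
Proof. rewrite nmD_sqr nmN dotNr reN; ring. Qed.

Lemma eps_eqV u v : (forall e : R, 0 < e -> nm (u - v) < e) -> u = v.
Proof.
move=> h; apply/eqP; rewrite -subr_eq0; apply/eqP/nm_eq0/eqP.
rewrite eq_le nm_ge0 andbT leNgt; apply/negP => /h; by rewrite ltxx.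
Qed.

(** Expand |a u - b v|^2 >= 0 with a = |v| and b = |u|. *)
Lemma re_dot_le u v : re (dotp u v) <= nm u * nm v.
Proof.
have [u0|] := eqVneq (nm u) 0; first by rewrite (nm_eq0 u0) dot0l nm0 mul0r.
have [v0|] := eqVneq (nm v) 0; first by rewrite (nm_eq0 v0) dot0r nm0 mulr0.
move=> v0 u0; have hu : 0 < nm u by rewrite lt_def u0 nm_ge0.
have hv : 0 < nm v by rewrite lt_def v0 nm_ge0.
have := sqr_ge0 (nm (rc (nm v) *: u - rc (nm u) *: v)).
rewrite nmB_sqr !nmZ !modc_rc !ger0_norm ?nm_ge0 // dotZl dotZr conj_rc !reMr.
have -> : (nm v * nm u) ^+ 2 + (nm u * nm v) ^+ 2
  - 2 * (nm v * (nm u * re (dotp u v)))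
  = (2 * (nm u * nm v)) * (nm u * nm v - re (dotp u v)) by ring.
by rewrite pmulr_rge0 ?subr_ge0 // mulr_gt0 // mulr_gt0.
Qed.

Lemma dot_CS u v : modc (dotp u v) <= nm u * nm v.
Proof.
have [t t1 ht] := phase (dotp u v).
have -> : modc (dotp u v) = re (dotp (t *: u) v) by rewrite dotZl ht.
apply: le_trans (re_dot_le _ _) _; rewrite nmZ -mulrA ler_piMl //.
by rewrite mulr_ge0 ?nm_ge0.
Qed.

Lemma nm_parallelogram u v :
  nm (u + v) ^+ 2 + nm (u - v) ^+ 2 = 2 * nm u ^+ 2 + 2 * nm v ^+ 2.
Proof. rewrite nmD_sqr nmB_sqr; ring. Qed.

(** Completeness stated with real radii, for sequences: the form in which all limits
    below are taken. *)
Lemma hcomplete (s : nat -> V) :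
  (forall e : R, 0 < e -> exists N, forall m n, (N <= m)%N -> (N <= n)%N ->
     nm (s m - s n) < e) ->
  exists l : V, forall e : R, 0 < e -> exists N, forall n, (N <= n)%N ->
     nm (s n - l) < e.
Proof.
move=> cs.
have : cvgn s.
  apply/cauchy_cvgP/cauchy_ballP => e; rewrite ltcE /= => /andP[/eqP ei er].
  have [N hN] := cs _ er.
  exists (s @` [set n | (N <= n)%N], s @` [set n | (N <= n)%N]).
    by split; exists N => // n hn; exists n.
  move=> [_ _] [/= [m hm <-] [n hn <-]]; rewrite -ball_normE /= norm_nm.
  have -> : e = rc (re e) by case: e ei {er hN} => a b /= ->.
  by rewrite rc_lt hN.
move=> /cvg_ex[l /cvgrPdist_lt hl]; exists l => e e0.
have /hl[N _ hN] : 0 < rc e by rewrite -rc0 rc_lt.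
exists N => n /hN /=; by rewrite norm_nm rc_lt nm_distC.
Qed.

Lemma nm_limit_le (s : nat -> V) (l v : V) (c : R) (N : nat) :
  (forall e : R, 0 < e -> exists N, forall n, (N <= n)%N -> nm (s n - l) < e) ->
  (forall n, (N <= n)%N -> nm (s n - v) <= c) -> nm (l - v) <= c.
Proof.
move=> hl hc; apply/ler_addgt0Pr => e e0; have [M hM] := hl e e0.
have h1 := hM (maxn M N) (leq_maxl _ _); have h2 := hc (maxn M N) (leq_maxr _ _).
rewrite nm_distC in h1.
have := nm_triangle l (s (maxn M N)) v; lra.
Qed.

End HilbertBasics.

Lemma sqr_le_norm (R : realType) (a b : R) : 0 <= b -> a ^+ 2 <= b ^+ 2 -> `|a| <= b.
Proof. by move=> b0 h; rewrite -(@ler_pXn2r _ 2) ?nnegrE // real_normK ?num_real. Qed.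

Section Riesz.
Variables (R : realType) (V : hilbert R).
Local Notation C := (R[i]).

Lemma inv_nat_small (e : R) : 0 < e ->
  exists N, forall n, (N <= n)%N -> n.+1%:R^-1 < e.
Proof.
move=> e0; exists (Num.truncn e^-1) => n hn.
rewrite invf_plt ?posrE ?ltr0Sn //.
apply: lt_le_trans (truncnS_gt _) _.
by rewrite ler_nat ltnS.
Qed.

(** Riesz representation for a functional on a subspace that need not be closed.  The
    functional is a linear relation [P] between vectors and scalars, so that it can be
    given on spanning combinations without first proving it well defined: the bound
    does that.  Minimize |u|^2 - 2 Re x over the pairs (u, x) of the relation.  The
    parallelogram identity makes a minimizing sequence Cauchy, and its limit lies in
    the closure of the subspace, which also makes this the projection theorem. *)
Theorem riesz_rel (P : V -> C -> Prop) (c : R) : 0 <= c -> P 0 0 ->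
  (forall a u v x y, P u x -> P v y -> P (a *: u + v) (a * x + y)) ->
  (forall u x, P u x -> modc x <= c * nm u) ->
  exists g : V, [/\ forall u x, P u x -> dotp u g = x, nm g <= c &
    forall e : R, 0 < e -> exists u x, P u x /\ nm (u - g) < e].
Proof.
move=> c0 P0 Plin Pbd.
pose J (u : V) (x : C) := nm u ^+ 2 - 2 * re x.
pose E := [set r | exists u x, P u x /\ r = J u x].
have lbJ u x : P u x -> - c ^+ 2 <= J u x.
  move=> /Pbd h; have h2 := le_trans (re_le_modc x) h.
  rewrite /J; have := sqr_ge0 (nm u - c); rewrite sqrrB; nra.
have hE : has_inf E.
  split; first by exists (J 0 0), 0, 0.
  by exists (- c ^+ 2) => _ [u [x [/lbJ h ->]]].
pose I := inf E.
have leI u x : P u x -> I <= J u x.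
  by move=> h; apply: ge_inf; [case: hE | exists u, x].
have ex n : exists p : V * C, P p.1 p.2 /\ J p.1 p.2 < I + n.+1%:R^-1.
  have /(inf_adherent)/(_ hE)[_ [u [x [h ->]]] h2] : 0 < n.+1%:R^-1 :> R.
    by rewrite invr_gt0 ltr0Sn.
  by exists (u, x).
have [p hp] := choice ex; clear ex.
have cau m n : nm ((p m).1 - (p n).1) ^+ 2 <= 2 * (m.+1%:R^-1 + n.+1%:R^-1).
  have [hm Jm] := hp m; have [hn Jn] := hp n.
  move: (p m) (p n) hm hn Jm Jn => [u x] [v y] /= hm hn Jm Jn.
  have /leI : P (rc 2^-1 *: u + (rc 2^-1 *: v + 0)) (rc 2^-1 * x + (rc 2^-1 * y + 0)).
    by apply: (Plin) => //; apply: (Plin).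
  rewrite !addr0 -scalerDr -mulrDr /J nmZ reMr reD modc_rc ger0_norm ?invr_ge0 //.
  have := nm_parallelogram u v; move: Jm Jn; rewrite /J exprMn.
  set a := nm (u + v) ^+ 2; set b := nm (u - v) ^+ 2.
  have -> : (2^-1 : R) ^+ 2 = 4^-1 by field.
  move: (m.+1%:R^-1) (n.+1%:R^-1) => d1 d2; lra.
have [g hg] : exists g : V, forall e : R, 0 < e -> exists N, forall n, (N <= n)%N ->
     nm ((p n).1 - g) < e.
  apply: hcomplete => e e0.
  have [N hN] : exists N, forall n, (N <= n)%N -> n.+1%:R^-1 < e ^+ 2 / 4.
    by apply: inv_nat_small; rewrite divr_gt0 // exprn_gt0.
  exists N => m n /hN hm /hN hn.
  rewrite -(@ltr_pXn2r _ 2) // ?nnegrE ?nm_ge0 // ?ltW //.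
  apply: le_lt_trans (cau m n) _; move: hm hn; move: (m.+1%:R^-1) (n.+1%:R^-1) => d1 d2; lra.
have appr (e : R) : 0 < e -> exists u x, P u x /\ nm (u - g) < e.
  by move=> /hg[N /(_ N (leqnn _)) h]; exists (p N).1, (p N).2; case: (hp N).
have hre w y : P w y -> re (dotp w g) = re y.
  move=> hw; pose W := nm w ^+ 2.
  have W0 : 0 <= W by rewrite sqr_ge0.
  (* minimality tested in the direction w, with the optimal step t *)
  have small n : (re (dotp w (p n).1) - re y) ^+ 2 <= n.+1%:R^-1 * (W + 1).
    have [hm Jm] := hp n; move: (p n) hm Jm => [u x] /= hm Jm.
    pose a := re (dotp w u) - re y; rewrite -/a.
    pose t := - a / (W + 1).
    have /leI : P (rc t *: w + u) (rc t * y + x) by apply: Plin.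
    rewrite /J nmD_sqr nmZ exprMn modc_rc real_normK ?num_real // dotZl reMr reD reMr.
    rewrite -/W; move: Jm; rewrite /J; set d := n.+1%:R^-1 => Jm JJ.
    have h : - d <= t ^+ 2 * W + 2 * t * a by rewrite /a; nra.
    have e1 : t * (W + 1) = - a by rewrite /t divfK // gt_eqF // ltr_wpDl.
    have h3 : a ^+ 2 = (t * (W + 1)) ^+ 2 by rewrite e1 sqrrN.
    have h4 : t * a = - (t ^+ 2 * (W + 1)).
      by rewrite -[a]opprK -e1; ring.
    have h5 : t ^+ 2 * (W + 2) <= d by nra.
    rewrite h3 exprMn.
    have t20 : 0 <= t ^+ 2 by rewrite sqr_ge0.
    have : t ^+ 2 * (W + 1) <= d by nra.
    move=> h6; rewrite expr2 mulrA; apply: ler_wpM2r => //; lra.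
  apply/eqP; rewrite -subr_eq0 -normr_le0; apply/ler_addgt0Pr => e e0; rewrite add0r.
  have [N1 h1] : exists N, forall n, (N <= n)%N -> nm ((p n).1 - g) < e / (2 * (nm w + 1)).
    by apply: hg; rewrite divr_gt0 // mulr_gt0 // ltr_wpDl ?nm_ge0.
  have [N2 h2] : exists N, forall n, (N <= n)%N -> n.+1%:R^-1 < (e / 2) ^+ 2 / (W + 1).
    by apply: inv_nat_small; rewrite divr_gt0 ?exprn_gt0 ?divr_gt0 // ltr_wpDl.
  pose n := maxn N1 N2.
  have {}h1 := h1 n (leq_maxl _ _); have {}h2 := h2 n (leq_maxr _ _).
  have b1 : `|re (dotp w (p n).1) - re y| <= e / 2.
    apply: sqr_le_norm; first by rewrite divr_ge0 // ltW.
    apply: le_trans (small n) _; rewrite -ler_pdivlMr ?ltr_wpDl // ltW //.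
  have b2 : `|re (dotp w (p n).1) - re (dotp w g)| <= e / 2.
    rewrite -reB -dotBr.
    have nw := nm_ge0 w.
    have b3 : modc (dotp w ((p n).1 - g)) <= e / 2.
      apply: le_trans (dot_CS _ _) _.
      move: h1; rewrite ltr_pdivlMr; last by rewrite mulr_gt0 // ltr_wpDl.
      have := nm_ge0 ((p n).1 - g); nra.
    apply: (le_trans _ b3); rewrite ler_norml; apply/andP; split; last exact: re_le_modc.
    by rewrite lerNl -reN -modcN re_le_modc.
  move: b1 b2; rewrite !ler_norml; lra.
have hdot w y : P w y -> dotp w g = y.
  move=> hw; have h1 := hre _ _ hw.
  have /hre : P ('i *: w + 0) ('i * y + 0) by apply: Plin.
  rewrite !addr0 dotZl => h2.
  have aux (z : C) : re ('i * z) = - complex.Im z.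
    by case: z => a b; rewrite /re -complexiE /=; ring.
  move: h1 h2; rewrite !aux.
  case: (dotp w g) y {hw} => [a b] [d e]; rewrite /re /= => -> /oppr_inj -> //.
exists g; split => //.
rewrite leNgt; apply/negP => cg.
pose G := nm g; have G0 : 0 < G by apply: le_lt_trans cg.
have [u [x [hu hug]]] : exists u x, P u x /\ nm (u - g) < G * (G - c) / (2 * (G + c)).
  apply: appr; rewrite divr_gt0 // mulr_gt0 ?subr_gt0 // ltr_wpDr //.
have nu : nm u <= G + nm (u - g).
  by have := nmD (u - g) g; rewrite subrK /G; lra.
move: hug; rewrite ltr_pdivlMr; last by rewrite mulr_gt0 // ltr_wpDr.
set d := nm (u - g) in nu *; move=> hd.
have d0 : 0 <= d by exact: nm_ge0.
have : G ^+ 2 <= d * G + c * nm u.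
  rewrite /G nm_sqr -[g in dotp g _](subKr u) dotBl (hdot _ _ hu) reB.
  have h1 := le_trans (re_le_modc _) (Pbd _ _ hu).
  have h2 := re_dot_le (g - u) g; rewrite -opprB dotNl reN nmN in h2.
  by rewrite -/d -/G in h2 *; lra.
have : c * nm u <= c * (G + d) by rewrite ler_wpM2l.
move: cg; rewrite -/G; nra.
Qed.

(** The uniform boundedness principle by a gliding hump.  If v_n in the set has norm
    above 2 (n + 1) 3^n, steps of length 3^-n along +- v_n can be signed so that
    |<x_(n+1), v_n>| >= 3^-n |v_n|; the later steps have total length at most
    3^-n / 2, so the limit of the x_n pairs with v_n to more than n. *)
Lemma weakly_bounded (A : set V) :
  (forall f, exists M : R, forall v, A v -> modc (dotp f v) <= M) ->
  exists M : R, forall v, A v -> nm v <= M.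
Proof.
move=> wb; apply: contrapT => nb.
have ex (n : nat) : exists v, A v /\ 2 * n.+1%:R * 3 ^+ n < nm v.
  apply: contrapT => h; apply: nb; exists (2 * n.+1%:R * 3 ^+ n) => v Av.
  by rewrite leNgt; apply/negP => hv; apply: h; exists v.
have [v hv] := choice ex; clear ex.
have v0 n : 0 < nm (v n).
  by apply: le_lt_trans (hv n).2; rewrite !mulr_ge0 // exprn_ge0.
pose d n : V := rc (3^-1 ^+ n / nm (v n)) *: v n.
have nmd n : nm (d n) = 3^-1 ^+ n.
  rewrite /d nmZ modc_rc ger0_norm ?divfK ?gt_eqF //.
  by rewrite divr_ge0 ?exprn_ge0 ?nm_ge0.
pose nxt n x := if 3^-1 ^+ n * nm (v n) <= modc (dotp (x + d n) (v n))
                then x + d n else x - d n.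
have nxtP n x : 3^-1 ^+ n * nm (v n) <= modc (dotp (nxt n x) (v n)).
  rewrite /nxt; case: ifPn => //; rewrite -ltNge => h1.
  have h : modc (dotp (x + d n) (v n) - dotp (x - d n) (v n))
      = 2 * (3^-1 ^+ n * nm (v n)).
    rewrite -dotBl opprB [x + d n + _]addrC addrA subrK -mulr2n -scaler_nat dotZl.
    rewrite modcM /d dotZl dotvv -rcM modc_rc ger0_norm; last first.
      by rewrite mulr_ge0 ?sqr_ge0 // divr_ge0 ?exprn_ge0 ?nm_ge0.
    have -> : modc (2 : R[i]) = 2 by rewrite /modc normr_nat /re -[2%:R](rmorph_nat (real_complex R)).
    rewrite expr2 [_ / _ * (_ * _)]mulrA divfK // gt_eqF //.
  have := modcD (dotp (x + d n) (v n)) (- dotp (x - d n) (v n)).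
  rewrite h modcN; lra.
have nxtd n x : nm (nxt n x - x) = 3^-1 ^+ n.
  rewrite /nxt; case: ifP => _; last by rewrite addrAC subrr add0r nmN nmd.
  by rewrite addrAC subrr add0r nmd.
pose fix s n := if n is k.+1 then nxt k (s k) else 0.
have sk n k : nm (s (n + k)%N - s n) <= 3 / 2 * (3^-1 ^+ n - 3^-1 ^+ (n + k)).
  elim: k => [|k IH]; first by rewrite addn0 !subrr nm0 mulr0.
  rewrite addnS; apply: le_trans (nm_triangle _ (s (n + k)%N) _) _.
  rewrite /= nxtd exprSr; move: IH; move: (nm _) (_ ^+ n) (_ ^+ (n + k)) => a b c; lra.
have p3 n : 0 < 3^-1 ^+ n :> R by rewrite exprn_gt0 ?invr_gt0.
have sk' n m : (n <= m)%N -> nm (s m - s n) <= 3 / 2 * 3^-1 ^+ n.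
  move=> /subnKC <-; apply: le_trans (sk _ _) _; have := p3 (n + (m - n))%N; lra.
have [l hl] : exists l : V, forall e : R, 0 < e -> exists N, forall n, (N <= n)%N ->
     nm (s n - l) < e.
  apply: hcomplete => e e0.
  have /cvgrPdist_lt/(_ (e / 3)) : (fun n => 3^-1 ^+ n : R) @ \oo --> (0 : R).
    by apply: cvg_expr; rewrite ger0_norm ?invr_ge0 // invf_lt1 // ltr1n.
  case; first by rewrite divr_gt0.
  move=> N _ /(_ N (leqnn _)) /=; rewrite sub0r normrN ger0_norm ?(ltW (p3 _)) // => hN.
  exists N => m n hm hn; apply: le_lt_trans (nm_triangle _ (s N) _) _.
  have := sk' _ _ hm; have := sk' _ _ hn; rewrite (nm_distC (s N)).
  by move: hN (p3 N); move: (_ ^+ N) => q; lra.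
have [M hM] := wb l.
pose n := Num.truncn M.
have hn : M < n.+1%:R by exact: truncnS_gt.
have := hM _ (hv n).1; rewrite leNgt => /negP; apply.
apply: lt_trans hn _.
have h1 : nm (l - s n.+1) <= 3 / 2 * 3^-1 ^+ n.+1.
  by apply: (nm_limit_le hl (N := n.+1)) => m /sk'.
have h2 := nxtP n (s n).
have h3 : modc (dotp (s n.+1) (v n)) <= modc (dotp l (v n)) + nm (l - s n.+1) * nm (v n).
  rewrite -[X in dotp X _](subKr l) dotBl; apply: le_trans (modcD _ _) _.
  by rewrite modcN lerD2l dot_CS.
have h4 : nm (l - s n.+1) * nm (v n) <= 2^-1 * 3^-1 ^+ n * nm (v n).
  rewrite ler_wpM2r ?nm_ge0 //; apply: le_trans h1 _; rewrite exprSr.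
  by move: (_ ^+ n) => q; lra.
have h5 : 2 * n.+1%:R < 3^-1 ^+ n * nm (v n).
  have := (hv n).2; rewrite -ltr_pdivlMr ?exprn_gt0 //.
  by rewrite exprVn [X in _ -> _ < X]mulrC.
move: h2 h3 h4 h5; rewrite /=.
move: (3^-1 ^+ n) (nm (v n)) (nm (l - _)) (modc _) (modc _) (n.+1%:R) => a b c e f g; nra.
Qed.

End Riesz.

(** * Limits of complex sequences *)

Section ComplexLimits.
Variable R : realType.
Local Notation C := (R[i]).
Implicit Types (u v : nat -> C) (l m : C).

(** Convergence with real radii; [tendstoP] relates it to the filter-based one. *)
Definition tendsto u l := forall e : R, 0 < e ->
  exists N, forall n, (N <= n)%N -> modc (u n - l) < e.

Lemma tendstoP u l : tendsto u l <-> u @ \oo --> l.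
Proof.
split=> [h|/cvgrPdist_lt h].
  apply/cvgrPdist_lt => e; rewrite ltcE /= => /andP[/eqP ei er].
  have -> : e = rc (re e) by case: e ei {er} => a b /= ->.
  have [N hN] := h _ er; exists N => // n /hN /=.
  by rewrite normc_modc rc_lt modc_distC.
move=> e e0; have /h[N _ hN] : 0 < rc e by rewrite -rc0 rc_lt.
by exists N => n /hN /=; rewrite normc_modc rc_lt modc_distC.
Qed.

Lemma tendsto_uniq u l m : tendsto u l -> tendsto u m -> l = m.
Proof.
move=> h1 h2; apply: eps_eq => e e0.
have e2 : 0 < e / 2 by rewrite divr_gt0.
have [N1 {}h1] := h1 _ e2; have [N2 {}h2] := h2 _ e2.
have := h1 _ (leq_maxl N1 N2); have := h2 _ (leq_maxr N1 N2).
set n := maxn _ _.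
have -> : l - m = (u n - m) - (u n - l) by ring.
have := modcD (u n - m) (- (u n - l)); rewrite modcN; lra.
Qed.

Lemma tendsto_cst l : tendsto (fun=> l) l.
Proof. by move=> e e0; exists 0%N => n _; rewrite subrr modc0. Qed.

Lemma tendstoD u v l m :
  tendsto u l -> tendsto v m -> tendsto (fun n => u n + v n) (l + m).
Proof.
move=> h1 h2 e e0.
have e2 : 0 < e / 2 by rewrite divr_gt0.
have [N1 {}h1] := h1 _ e2; have [N2 {}h2] := h2 _ e2.
exists (maxn N1 N2) => n; rewrite geq_max => /andP[/h1 a /h2 b].
have -> : u n + v n - (l + m) = (u n - l) + (v n - m) by ring.
by have := modcD (u n - l) (v n - m); lra.
Qed.

Lemma tendstoZ a u l : tendsto u l -> tendsto (fun n => a * u n) (a * l).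
Proof.
move=> h e e0; have a0 : 0 < modc a + 1 by rewrite ltr_wpDl ?modc_ge0.
have [N hN] := h (e / (modc a + 1)) (divr_gt0 e0 a0).
exists N => n /hN; rewrite -mulrBr modcM ltr_pdivlMr //.
have := modc_ge0 a; have := modc_ge0 (u n - l); nra.
Qed.

Lemma tendsto_conj u l : tendsto u l -> tendsto (fun n => (u n)^*) l^*.
Proof.
by move=> h e /h[N hN]; exists N => n /hN; rewrite -rmorphB /= modc_conj.
Qed.

Lemma tendsto_sum (I : Type) (r : seq I) (F : I -> nat -> C) (L : I -> C) :
  (forall i, tendsto (F i) (L i)) ->
  tendsto (fun n => \sum_(i <- r) F i n) (\sum_(i <- r) L i).
Proof.
move=> h; elim: r => [|i r IH].
  by move=> e e0; exists 0%N => n _; rewrite !big_nil subrr modc0.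
have := tendstoD (h i) IH; congr (tendsto _ _); last by rewrite big_cons.
by apply/funext => n; rewrite big_cons.
Qed.

Lemma tendsto_squeeze u l (b : nat -> R) :
  (forall n, modc (u n - l) <= b n) ->
  (forall e : R, 0 < e -> exists N, forall n, (N <= n)%N -> b n < e) ->
  tendsto u l.
Proof.
by move=> h hb e /hb[N hN]; exists N => n /hN; apply: le_lt_trans.
Qed.

Lemma tendsto_re_ge u l (c : R) : tendsto u l -> (forall n, c <= re (u n)) -> c <= re l.
Proof.
move=> h hc; apply/ler_addgt0Pr => e /h[N /(_ N (leqnn _))].
have := re_le_modc (u N - l); rewrite reB; have := hc N; lra.
Qed.

Lemma tendsto_eq u v l N :
  (forall n, (N <= n)%N -> u n = v n) -> tendsto u l -> tendsto v l.
Proof.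
move=> h hu e /hu[M hM]; exists (maxn M N) => n; rewrite geq_max => /andP[a b].
by rewrite -h // hM.
Qed.

End ComplexLimits.

(** * Positive semidefinite kernels and Cholesky factorization *)

Section PositiveKernels.
Variable R : realType.
Local Notation C := (R[i]).

Section OnType.
Variable Y : Type.
Implicit Types (k : Y -> Y -> C) (s : seq (C * Y)).

(** The values of [k] on pairs are conjugated so that for k(x, y) = <K_y, K_x> this is
    the squared norm of the combination of the K_y with coefficients in [s]. *)
Definition qf k s : C :=
  \sum_(p <- s) \sum_(q <- s) p.1 * q.1^* * k q.2 p.2.
Definition psd k := (forall x y, k y x = (k x y)^*) /\ forall s, 0 <= re (qf k s).
Definition lf (h : Y -> C) s : C := \sum_(p <- s) p.1 * h p.2.
(** If [s] stands for a combination u of kernel functions, this is M_f^* u. *)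
Definition scale (f : Y -> C) s : seq (C * Y) := [seq (p.1 * (f p.2)^*, p.2) | p <- s].

Lemma qfD k k' s : qf (fun x y => k x y + k' x y) s = qf k s + qf k' s.
Proof.
rewrite /qf -big_split /=; apply: eq_bigr => p _; rewrite -big_split /=.
by apply: eq_bigr => q _; rewrite mulrDr.
Qed.

Lemma qfZ a k s : qf (fun x y => a * k x y) s = a * qf k s.
Proof.
rewrite /qf mulr_sumr; apply: eq_bigr => p _; rewrite mulr_sumr.
by apply: eq_bigr => q _; rewrite mulrCA.
Qed.

Lemma qfB k k' s : qf (fun x y => k x y - k' x y) s = qf k s - qf k' s.
Proof.
rewrite -[- qf k' s]mulN1r -qfZ -qfD; congr qf.
by apply/funext => x; apply/funext => y; rewrite mulN1r.
Qed.

Lemma qf_scale f k s :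
  qf (fun x y => f x * k x y * (f y)^*) s = qf k (scale f s).
Proof.
rewrite /qf big_map; apply: eq_bigr => p _; rewrite big_map; apply: eq_bigr => q _ /=.
rewrite rmorphM /= conjCK; ring.
Qed.

Lemma qf_rank1 f s : qf (fun x y => f x * (f y)^*) s = rc (modc (lf (fun y => (f y)^*) s) ^+ 2).
Proof.
rewrite -mulcJ /lf /qf rmorph_sum mulr_suml /=; apply: eq_bigr => p _.
rewrite mulr_sumr; apply: eq_bigr => q _; rewrite rmorphM /= conjCK; ring.
Qed.

Lemma psd_herm k : psd k -> forall x y, k y x = (k x y)^*. Proof. by case. Qed.
Lemma psd_ge0 k s : psd k -> 0 <= re (qf k s). Proof. by case. Qed.

Lemma psd_qf_real k s : psd k -> qf k s = rc (re (qf k s)).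
Proof.
case=> hk _; apply: real_re; rewrite /qf rmorph_sum /= exchange_big /=.
apply: eq_bigr => p _; rewrite rmorph_sum; apply: eq_bigr => q _ /=.
rewrite !rmorphM /= conjCK -hk; ring.
Qed.

Lemma psd_diag k x : psd k -> k x x = rc (re (k x x)).
Proof. by case=> hk _; apply: real_re; rewrite -hk. Qed.

Lemma psd_diag_ge0 k x : psd k -> 0 <= re (k x x).
Proof.
by move=> /(psd_ge0 [:: (1, x)]); rewrite /qf !big_seq1 /= rmorph1 !mul1r.
Qed.

Lemma qf_cons k t c s : (forall x y, k y x = (k x y)^*) ->
  qf k ((t, c) :: s) =
  t * t^* * k c c + t * (lf (k c) s)^* + (t * (lf (k c) s)^*)^* + qf k s.
Proof.
move=> hk; rewrite {1}/qf big_cons big_cons /= -!addrA; congr (_ + _); rewrite addrA.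
have -> : \sum_(q <- s) t * q.1^* * k q.2 c = t * (lf (k c) s)^*.
  rewrite /lf rmorph_sum mulr_sumr; apply: eq_bigr => q _.
  by rewrite rmorphM /= -hk mulrA.
rewrite -addrA; congr (_ + _).
rewrite rmorphM /= conjCK /lf mulr_sumr -big_split /=; apply: eq_bigr => p _.
rewrite big_cons /=; congr (_ + _); ring.
Qed.

(** Positivity of the form on u - r L K_c, with u the combination [s] and L = <u, K_c>,
    for all real r. *)
Lemma psd_CS k c s : psd k ->
  modc (lf (k c) s) ^+ 2 <= re (k c c) * re (qf k s).
Proof.
move=> pk; have [hk _] := pk; pose L := lf (k c) s.
pose A := modc L ^+ 2; pose K := re (k c c); pose Q := re (qf k s).
have expand (r : R) : 0 <= r ^+ 2 * A * K - 2 * r * A + Q.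
  pose t := - rc r * L.
  have e1 := qf_cons t c s hk; rewrite -/L in e1.
  have e2 : t * L^* = rc (- r * A) by rewrite /t -mulrA mulcJ -rcN -rcM.
  have e3 : t * t^* = rc (r ^+ 2 * A).
    by rewrite mulcJ /t modcM modcN modc_rc exprMn real_normK ?num_real.
  have := psd_ge0 ((t, c) :: s) pk.
  rewrite e1 !reD re_conj e2 e3 (psd_diag c pk) -rcM !re_rc -/K -/Q; lra.
have K0 : 0 <= K by exact: psd_diag_ge0.
have Q0 : 0 <= Q by exact: psd_ge0.
rewrite -/A -/K -/Q.
have A0 : 0 <= A by exact: sqr_ge0.
have [K1|K1] := eqVneq K 0.
  rewrite K1 mul0r leNgt; apply/negP => A1.
  have := expand ((Q + 1) / (2 * A)); rewrite K1 mulr0 add0r.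
  have -> : 2 * ((Q + 1) / (2 * A)) * A = Q + 1.
    by field; rewrite gt_eqF.
  lra.
have {}K0 : 0 < K by rewrite lt_def K1.
have := expand K^-1.
have -> : K^-1 ^+ 2 * A * K = K^-1 * A by field.
rewrite -(pmulr_rge0 _ K0) mulrDr mulrBr mulrA divff // mul1r => h.
have : K * (2 * K^-1 * A) = 2 * A by field.
lra.
Qed.

Lemma psd_CS2 k c x : psd k -> modc (k c x) ^+ 2 <= re (k c c) * re (k x x).
Proof.
move=> pk; have := psd_CS c [:: (1, x)] pk.
by rewrite /lf /qf !big_seq1 /= rmorph1 !mul1r.
Qed.

Lemma psd_ext k k' : (forall x y, k x y = k' x y) -> psd k -> psd k'.
Proof.
by move=> h; have -> : k' = k by apply/funext => x; apply/funext => y; rewrite h.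
Qed.

Lemma psd_cst1 : psd (fun _ _ : Y => 1).
Proof.
split=> [x y|s]; first by rewrite rmorph1.
have -> : qf (fun _ _ => 1) s = qf (fun x y => 1 * (1 : C)^*) s.
  by congr qf; apply/funext => x; apply/funext => y; rewrite rmorph1 mulr1.
by rewrite (qf_rank1 (fun=> 1)) re_rc sqr_ge0.
Qed.

Lemma psd_rank1 f : psd (fun x y => f x * (f y)^*).
Proof.
split=> [x y|s]; first by rewrite rmorphM /= conjCK mulrC.
by rewrite qf_rank1 re_rc sqr_ge0.
Qed.

Lemma psdD k k' : psd k -> psd k' -> psd (fun x y => k x y + k' x y).
Proof.
move=> [h1 p1] [h2 p2]; split=> [x y|s]; first by rewrite h1 h2 rmorphD.
by rewrite qfD reD addr_ge0.
Qed.

Lemma psdZ (a : R) k : 0 <= a -> psd k -> psd (fun x y => rc a * k x y).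
Proof.
move=> a0 [h1 p1]; split=> [x y|s]; first by rewrite h1 rmorphM /= conj_rc.
by rewrite qfZ reMr mulr_ge0.
Qed.

Lemma psd_scale f k : psd k -> psd (fun x y => f x * k x y * (f y)^*).
Proof.
move=> [h1 p1]; split=> [x y|s]; last by rewrite qf_scale.
rewrite h1 !rmorphM /= conjCK; ring.
Qed.

Lemma psd_sum (I : Type) (r : seq I) (F : I -> Y -> Y -> C) :
  (forall i, psd (F i)) -> psd (fun x y => \sum_(i <- r) F i x y).
Proof.
move=> h; elim: r => [|i r IH].
  have -> : (fun x y : Y => \sum_(i <- [::]) F i x y) = (fun x y => rc 0 * 1).
    by apply/funext => x; apply/funext => y; rewrite big_nil mul0r.
  by apply: psdZ => //; exact: psd_cst1.
apply: (psd_ext _ (psdD (h i) IH)) => x y; by rewrite big_cons.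
Qed.

Lemma psd_limit (F : nat -> Y -> Y -> C) k :
  (forall n, psd (F n)) -> (forall x y, tendsto (fun n => F n x y) (k x y)) -> psd k.
Proof.
move=> pF hF; split=> [x y|s].
  apply: tendsto_uniq (hF y x) _; have := tendsto_conj (hF x y).
  by congr tendsto; apply/funext => n; rewrite (psd_herm (pF n) x y).
apply: (@tendsto_re_ge _ (fun n => qf (F n) s)); last by move=> n; apply: psd_ge0.
by do 2!apply: tendsto_sum => ?; apply: tendstoZ.
Qed.

(** The kernel of the orthogonal complement of K_c.  When [k c c] is 0 the division
    returns 0, which is the right value since then [k c] vanishes. *)
Definition schur k c x y := k x y - k x c * k c y / k c c.

Lemma qf_schur k c s : psd k -> qf (schur k c) s =
  qf k s - rc ((re (k c c))^-1 * modc (lf (k c) s) ^+ 2).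
Proof.
move=> pk; have [hk _] := pk.
rewrite /schur qfB rcM rcV -(psd_diag c pk); congr (_ - _).
have -> : lf (k c) s = lf (fun y => (k y c)^*) s.
  by apply: eq_bigr => p _; rewrite -hk.
rewrite -(qf_rank1 (k^~ c)) -qfZ; congr qf; apply/funext => x; apply/funext => y.
by rewrite -hk mulrC.
Qed.

Lemma psd_schur k c : psd k -> psd (schur k c).
Proof.
move=> pk; have [hk _] := pk; split=> [x y|s].
  rewrite /schur rmorphB /= fmorph_div !rmorphM /= -!hk.
  by rewrite [k y c * _]mulrC.
rewrite qf_schur // reB re_rc subr_ge0.
have := psd_CS c s pk; have := psd_diag_ge0 c pk.
rewrite le_eqVlt => /predU1P[<- _|h]; first by rewrite invr0 mul0r psd_ge0.
by rewrite ler_pdivrMl.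
Qed.

Lemma schur_le k c s : psd k -> re (qf (schur k c) s) <= re (qf k s).
Proof.
move=> pk; rewrite qf_schur // reB re_rc gerBl mulr_ge0 ?sqr_ge0 //.
by rewrite invr_ge0 psd_diag_ge0.
Qed.

(** The Schur complement at [c] does not see multiples of K_c, so it bounds the
    form of [k] from below whatever the coefficient at [c]; [schur_cons_eq] says that
    one coefficient attains the bound. *)
Lemma schur_cons_le k c t s : psd k ->
  re (qf (schur k c) s) <= re (qf k ((t, c) :: s)).
Proof.
move=> pk; apply: le_trans (schur_le c _ pk).
have pc : forall x, schur k c c x = 0.
  move=> x; rewrite /schur; have [k0|k0] := eqVneq (k c c) 0; last first.
    by rewrite mulrAC divff // mul1r subrr.
  rewrite k0 mul0r mul0r subr0; apply: modc_eq0; apply/eqP.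
  rewrite -[_ == 0]sqrf_eq0 eq_le sqr_ge0 andbT.
  by have := psd_CS2 c x pk; rewrite k0 re0 mul0r.
rewrite (qf_cons _ _ _ (psd_herm (psd_schur c pk))) pc.
have -> : lf (schur k c c) s = 0 by rewrite /lf big1 // => p _; rewrite pc mulr0.
by rewrite !mulr0 rmorph0 mulr0 rmorph0 !add0r.
Qed.

Lemma schur_cons_eq k c s : psd k -> k c c != 0 ->
  qf (schur k c) s = qf k ((- lf (k c) s / k c c, c) :: s).
Proof.
move=> pk k0; have hk := psd_herm pk; rewrite (qf_cons _ _ _ hk) qf_schur //.
have kr : (k c c)^* = k c c by rewrite -hk.
rewrite rcM rcV -(psd_diag c pk) -mulcJ; set L := lf (k c) s.
rewrite !(rmorphM, rmorphN, fmorphV) /= !conjCK kr.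
by field.
Qed.

Section Cholesky.
Variables (k : Y -> Y -> C) (y : nat -> Y).
Hypothesis pk : psd k.

(** What remains of [k] after orthogonalizing against the points y 0, ..., y (n - 1). *)
Fixpoint chol_rest n : Y -> Y -> C :=
  if n is m.+1 then schur (chol_rest m) (y m) else k.
Definition pivot n : R := re (chol_rest n (y n) (y n)).
Definition chol n x : C := chol_rest n x (y n) / rc (Num.sqrt (pivot n)).

Lemma psd_chol_rest n : psd (chol_rest n).
Proof. by elim: n => //= n IH; apply: psd_schur. Qed.

Lemma chol_sum N x z :
  \sum_(n < N) chol n x * (chol n z)^* = k x z - chol_rest N x z.
Proof.
elim: N => [|N IH]; first by rewrite big_ord0 subrr.
rewrite big_ord_recr /= {}IH /schur /chol.
have pN := psd_chol_rest N.
have -> : chol_rest N x (y N) / rc (Num.sqrt (pivot N)) *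
   (chol_rest N z (y N) / rc (Num.sqrt (pivot N)))^* =
   chol_rest N x (y N) * chol_rest N (y N) z / chol_rest N (y N) (y N).
  rewrite fmorph_div /= conj_rc -(psd_herm pN) mulrACA -invfM -rcM -expr2.
  by rewrite sqr_sqrtr ?psd_diag_ge0 // /pivot -(psd_diag _ pN).
ring.
Qed.

(** Elimination at a point kills its row for good.  Hence the factorization is exact on
    the points already eliminated. *)
Lemma chol_rest0 N i z : (i < N)%N -> chol_rest N (y i) z = 0.
Proof.
elim: N z => // N IH z; rewrite ltnS leq_eqVlt => /predU1P[->|/IH h] /=; last first.
  by rewrite /schur !h !mul0r subrr.
have pN := psd_chol_rest N; rewrite /schur.
have [p0|p0] := eqVneq (chol_rest N (y N) (y N)) 0; last first.
  by rewrite mulrAC divff // mul1r subrr.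
rewrite p0 mul0r mul0r subr0; apply: modc_eq0; apply/eqP.
rewrite -[_ == 0]sqrf_eq0 eq_le sqr_ge0 andbT.
by have := psd_CS2 (y N) z pN; rewrite p0 re0 mul0r.
Qed.

Lemma chol_rest0r N i z : (i < N)%N -> chol_rest N z (y i) = 0.
Proof.
by move=> h; rewrite (psd_herm (psd_chol_rest N)) chol_rest0 // rmorph0.
Qed.

Lemma chol_rest_le N s : re (qf (chol_rest N) s) <= re (qf k s).
Proof.
by elim: N => // N IH; apply: le_trans IH; apply/schur_le/psd_chol_rest.
Qed.

Lemma chol_diag N x : \sum_(n < N) modc (chol n x) ^+ 2 <= re (k x x).
Proof.
have := chol_sum N x x; have := psd_diag_ge0 x (psd_chol_rest N).
move=> h1 /(congr1 (@re R)); rewrite reB re_sum.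
under eq_bigr do rewrite mulcJ re_rc.
lra.
Qed.

End Cholesky.
End OnType.

Lemma qf_comp (Y Z : Type) (h : Z -> Y) (k : Y -> Y -> C) s :
  qf (fun x y => k (h x) (h y)) s = qf k [seq (p.1, h p.2) | p <- s].
Proof. by rewrite /qf big_map; apply: eq_bigr => p _; rewrite big_map. Qed.

Lemma psd_comp (Y Z : Type) (h : Z -> Y) (k : Y -> Y -> C) :
  psd k -> psd (fun x y => k (h x) (h y)).
Proof. by move=> [hk pk]; split=> [x y|s]; [rewrite hk|rewrite qf_comp]. Qed.

Lemma qf_tnth (Y : Type) (k : Y -> Y -> C) (s : seq (C * Y)) :
  qf k s = qf (fun i j => k (tnth (in_tuple s) i).2 (tnth (in_tuple s) j).2)
    [seq ((tnth (in_tuple s) i).1, i) | i <- enum 'I_(size s)].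
Proof.
rewrite /qf big_tnth big_map big_enum; apply: eq_bigr => i _.
by rewrite big_tnth big_map big_enum.
Qed.

Lemma qf_sum (Y I : Type) (r : seq I) (F : I -> Y -> Y -> C) s :
  qf (fun x y => \sum_(i <- r) F i x y) s = \sum_(i <- r) qf (F i) s.
Proof.
rewrite /qf [RHS]exchange_big; apply: eq_bigr => p _; rewrite [RHS]exchange_big.
by apply: eq_bigr => q _; rewrite mulr_sumr.
Qed.

(** Schur product: on the finitely many points of [s] elimination writes [k] as a sum of
    rank-one kernels, and multiplying [l] by a rank-one kernel only rescales
    coefficients. *)
Lemma psd_mul (Y : Type) (k l : Y -> Y -> C) :
  psd k -> psd l -> psd (fun x y => k x y * l x y).
Proof.
move=> pk pl; have [hk _] := pk; have [hl _] := pl.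
split=> [x y|]; first by rewrite hk hl rmorphM.
case=> [|p0 s']; first by rewrite /qf big_nil re0.
set s := p0 :: s'; pose y n := (nth p0 s n).2.
suff -> : qf (fun x y => k x y * l x y) s =
  qf (fun x z => \sum_(n < size s) chol k y n x * l x z * (chol k y n z)^*) s.
  rewrite qf_sum re_sum sumr_ge0 // => n _; apply: psd_ge0.
  exact: psd_scale.
rewrite [LHS]qf_tnth [RHS]qf_tnth; congr qf; apply/funext => i; apply/funext => j.
rewrite !(tnth_nth p0) /= -/s -/(y i) -/(y j).
have := chol_sum y pk (size s) (y i) (y j).
rewrite chol_rest0 // subr0 => <-; rewrite mulr_suml; apply: eq_bigr => n _.
by rewrite mulrAC.
Qed.

Definition gram (V : hilbert R) (Y : Type) (e : Y -> V) (s : seq (C * Y)) : V :=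
  \sum_(p <- s) p.1 *: e p.2.

Lemma qf_gram (V : hilbert R) (Y : Type) (e : Y -> V) s :
  qf (fun x y => dotp (e y) (e x)) s = rc (nm (gram e s) ^+ 2).
Proof.
rewrite -dotvv /gram /qf dot_suml; apply: eq_bigr => p _.
rewrite dot_sumr; apply: eq_bigr => q _; rewrite dotZl dotZr mulrA //.
Qed.

Lemma psd_gram (V : hilbert R) (Y : Type) (e : Y -> V) :
  psd (fun x y => dotp (e y) (e x)).
Proof.
by split=> [x y|s]; [rewrite dotC|rewrite qf_gram re_rc sqr_ge0].
Qed.

End PositiveKernels.

(** * Completeness from sequences; the complex numbers as a Hilbert space *)

Section CompletenessBySequences.
Variables (R : realType) (T : normedModType R[i]).

(** A Cauchy filter contains balls of radii 1 / (n + 1); their centers form a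
    Cauchy sequence, and the filter converges to its limit. *)
Lemma complete_of_seq :
  (forall s : nat -> T,
    (forall e : R, 0 < e -> exists N, forall m n, (N <= m)%N -> (N <= n)%N ->
       re `|s m - s n| < e) ->
    exists l : T, forall e : R, 0 < e -> exists N, forall n, (N <= n)%N ->
       re `|s n - l| < e) ->
  forall F : set_system T, ProperFilter F -> cauchy F -> cvg F.
Proof.
move=> hs F FF /cauchyP Fc.
have normT (x : T) : `|x| = rc (re `|x|) by apply: ge0_re; rewrite normr_ge0.
have ex (n : nat) : exists x : T, F (ball x (rc n.+1%:R^-1)).
  by apply: Fc; rewrite -rc0 rc_lt invr_gt0.
have [s hsF] := choice ex; clear ex.
have ballE x (a : R) (y : T) : ball x (rc a) y -> re `|x - y| < a.
  by rewrite -ball_normE /= normT rc_lt.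
have ds m n : re `|s m - s n| < m.+1%:R^-1 + n.+1%:R^-1.
  have [y [/ballE hm /ballE hn]] := filter_ex (filterI (hsF m) (hsF n)).
  apply: le_lt_trans (ltrD hm hn); rewrite -rc_le rcD -!normT.
  rewrite (distrC (s n)); have -> : s m - s n = (s m - y) + (y - s n).
    by rewrite addrA subrK.
  exact: ler_normD.
have [l hl] : exists l : T, forall e : R, 0 < e -> exists N, forall n, (N <= n)%N ->
    re `|s n - l| < e.
  apply: hs => e e0; have [N hN] := inv_nat_small (divr_gt0 e0 (ltr0Sn R 1)).
  exists N => m n /hN hm /hN hn; apply: lt_trans (ds m n) _.
  by move: hm hn; move: (m.+1%:R^-1) (n.+1%:R^-1) => a b; lra.
apply/cvg_ex; exists l; apply/cvgrPdist_lt => e.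
rewrite ltcE /= => /andP[/eqP ei er].
have -> : e = rc (re e) by case: e ei {er} => a b /= ->.
have [N1 h1] := hl _ (divr_gt0 er (ltr0Sn R 1)).
have [N2 h2] := inv_nat_small (divr_gt0 er (ltr0Sn R 1)).
pose n := maxn N1 N2.
have {}h1 := h1 n (leq_maxl _ _); have {}h2 := h2 n (leq_maxr _ _).
apply: filterS (hsF n) => y /= /ballE hy.
rewrite normT rc_lt.
have : re `|l - y| <= re `|s n - l| + re `|s n - y|.
  rewrite -rc_le rcD -!normT (distrC (s n) l).
  have -> : l - y = (l - s n) + (s n - y) by rewrite addrA subrK.
  exact: ler_normD.
have : re e = complex.Re e by [].
move: h1 h2 hy; move: (n.+1%:R^-1) => a; lra.
Qed.

End CompletenessBySequences.

Section AbsoluteConvergence.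
Variable R : realType.
Local Notation C := (R[i]).

Lemma bounded_series_cauchy (a : nat -> R) (M : R) :
  (forall n, 0 <= a n) -> (forall N, \sum_(n < N) a n <= M) ->
  forall e : R, 0 < e -> exists N, forall m n, (N <= m)%N -> (m <= n)%N ->
    \sum_(m <= i < n) a i < e.
Proof.
move=> a0 aM e e0; pose E := [set \sum_(n < N) a n | N in setT].
have hE : has_sup E.
  by split; [exists (\sum_(n < 0) a n), 0%N|exists M => _ [N _ <-]].
have [_ [N _ <-] hN] := sup_adherent e0 hE.
exists N => m n hm hn.
have h1 : \sum_(i < n) a i <= sup E by apply: ub_le_sup; [case: hE|exists n].
have h2 : \sum_(i < N) a i <= \sum_(i < m) a i.
  rewrite -!(big_mkord xpredT) (big_cat_nat _ hm) //= lerDl sumr_ge0 //.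
have : \sum_(i < n) a i = \sum_(i < m) a i + \sum_(m <= i < n) a i.
  by rewrite -!(big_mkord xpredT) -big_cat_nat.
lra.
Qed.

Lemma complex_complete_seq (s : nat -> C) :
  (forall e : R, 0 < e -> exists N, forall m n, (N <= m)%N -> (N <= n)%N ->
     modc (s m - s n) < e) ->
  exists l : C, tendsto s l.
Proof.
move=> cs.
have key (f : C -> R) : (forall x y, `|f x - f y| <= modc (x - y)) ->
  exists l, forall e : R, 0 < e -> exists N, forall n, (N <= n)%N -> `|f (s n) - l| < e.
  move=> hf; have : cvgn (f \o s).
    apply/cauchy_cvgP/cauchy_ballP => e e0; have [N hN] := cs _ e0.
    exists ((f \o s) @` [set n | (N <= n)%N], (f \o s) @` [set n | (N <= n)%N]).
      by split; exists N => // n hn; exists n.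
    move=> [_ _] [/= [m hm <-] [n hn <-]]; rewrite -ball_normE /=.
    by apply: le_lt_trans (hf _ _) _; apply: hN.
  move=> /cvg_ex[l /cvgrPdist_lt hl]; exists l => e /hl[N _ hN].
  by exists N => n /hN /=; rewrite distrC.
have hre (x y : C) : `|re x - re y| <= modc (x - y).
  rewrite -reB ler_norml re_le_modc andbT lerNl -reN -modcN; exact: re_le_modc.
have him (x : C) : - complex.Im x = re ('i * x).
  by case: x => a b; rewrite /re -complexiE /=; ring.
have modi : modc ('i : C) = 1 by apply: rc_inj; rewrite -normc_modc normCi.
have [a ha] := key _ hre.
have [b hb] : exists b, forall e : R, 0 < e -> exists N, forall n, (N <= n)%N ->
    `|- complex.Im (s n) - b| < e.
  apply: (key (fun x => - complex.Im x)) => x y; rewrite !him.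
  apply: le_trans (hre _ _) _.
  by rewrite -mulrBr modcM modi mul1r.
exists (a -i* b)%C => e e0.
have [N1 {}ha] := ha _ (divr_gt0 e0 (ltr0Sn R 1)).
have [N2 {}hb] := hb _ (divr_gt0 e0 (ltr0Sn R 1)).
exists (maxn N1 N2) => n; rewrite geq_max => /andP[/ha h1 /hb h2].
have -> : s n - (a -i* b)%C = rc (re (s n) - a) + 'i * rc (- (- complex.Im (s n) - b)).
  by case: (s n) => c d; rewrite /re /rc -complexiE; apply/eqP; rewrite eq_complex /=; apply/andP; split; apply/eqP; ring.
apply: le_lt_trans (modcD _ _) _; rewrite modcM modi mul1r !modc_rc normrN; lra.
Qed.

Lemma abs_series_cvg (c : nat -> C) (a : nat -> R) (M : R) :
  (forall n, modc (c n) <= a n) -> (forall N, \sum_(n < N) a n <= M) ->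
  exists l, tendsto (fun N => \sum_(n < N) c n) l.
Proof.
move=> ca aM; apply: complex_complete_seq => e e0.
have [N hN] : exists N, forall m n, (N <= m)%N -> (m <= n)%N -> \sum_(m <= i < n) a i < e.
  by apply: bounded_series_cauchy e0 => // n; apply: le_trans (ca n); exact: modc_ge0.
have wl m n : (N <= m)%N -> (m <= n)%N ->
    modc (\sum_(i < n) c i - \sum_(i < m) c i) < e.
  move=> hm hn; rewrite -!(big_mkord xpredT) (big_cat_nat _ hn) //= addrAC subrr add0r.
  apply: le_lt_trans (hN _ _ hm hn); apply: le_trans (modc_sum _ _ _) _.
  by apply: ler_sum => i _.
exists N => m n hm hn; case/orP: (leq_total m n) => h; last exact: wl.
by rewrite modc_distC wl.
Qed.

Lemma complex_complete (F : set_system C) : ProperFilter F -> cauchy F -> cvg F.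
Proof. by apply: complete_of_seq => s /complex_complete_seq. Qed.

End AbsoluteConvergence.

HB.instance Definition _ (R : realType) :=
  Uniform_isComplete.Build R[i] (@complex_complete R).

Section ComplexHilbert.
Variable R : realType.
Local Notation C := (R[i]).

Definition cdot (x y : C) : C := x * y^*.

Lemma cdot_bilinear : bilinear_for (GRing.Scale.Law.clone _ _ ( *%R ) _)
  (GRing.Scale.Law.clone _ _ (Num.conj \; *%R) _) cdot.
Proof.
split=> [y a x z|x a y z] /=; first by rewrite /cdot mulrDl -scalerAl.
by rewrite /cdot rmorphD rmorphM /= mulrDr mulrCA.
Qed.
HB.instance Definition _ := bilinear_isBilinear.Build C C C C _ _ cdot cdot_bilinear.
Lemma cdot_herm (x y : C) : cdot x y = (-1) ^+ false * Num.conj (cdot y x).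
Proof. by rewrite expr0 mul1r /cdot rmorphM /= conjCK mulrC. Qed.
HB.instance Definition _ := isHermitianSesquilinear.Build _ _ _ _ cdot cdot_herm.
Lemma cdot_gt0 (x : C) : x != 0 -> 0 < cdot x x.
Proof. by move=> x0; rewrite /cdot -normCK exprn_gt0 // normr_gt0. Qed.
HB.instance Definition _ := isDotProduct.Build _ _ cdot cdot_gt0.

Lemma cdot_normE (x : C) : `|x| ^+ 2 = cdot x x.
Proof. by rewrite normCK. Qed.

Definition complex_hilbert : hilbert R := @Hilbert R R[i] cdot cdot_normE.
End ComplexHilbert.

(** * Square-summable sequences in a Hilbert space *)

Section SquareSummable.
Variables (R : realType) (V : hilbert R) (S : nat -> Prop).
Local Notation C := (R[i]).

(** The support condition removes the coordinates that a
    Cholesky factorization never uses, so that the features are total in the space. *)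
Definition l2_pred : {pred nat -> V} := [pred u : nat -> V |
  `[< (forall n, ~ S n -> u n = 0) /\
      exists M : R, forall N, \sum_(n < N) nm (u n) ^+ 2 <= M >]].

Lemma l2_predP (u : nat -> V) :
  reflect ((forall n, ~ S n -> u n = 0) /\
      exists M : R, forall N, \sum_(n < N) nm (u n) ^+ 2 <= M) (u \in l2_pred).
Proof. exact: asboolP. Qed.

Fact l2_submod : submod_closed l2_pred.
Proof.
split.
  apply/l2_predP; split => //; exists 0 => N.
  by rewrite big1 // => i _; rewrite nm0 expr0n.
move=> a u v /l2_predP[u0 [M hM]] /l2_predP[v0 [M' hM']]; apply/l2_predP; split.
  by move=> n hn; rewrite !fctE u0 // v0 // scaler0 addr0.
exists (2 * modc a ^+ 2 * M + 2 * M') => N.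
apply: (@le_trans _ _ (\sum_(n < N) (2 * modc a ^+ 2 * nm (u n) ^+ 2 + 2 * nm (v n) ^+ 2))).
  apply: ler_sum => n _; rewrite !fctE.
  have := nm_parallelogram (a *: u n) (v n); rewrite nmZ exprMn.
  have := sqr_ge0 (nm (a *: u n - v n)); lra.
rewrite big_split /= -!mulr_sumr.
apply: lerD; apply: ler_wpM2l.
- by rewrite mulr_ge0 // sqr_ge0.
- exact: hM.
- by [].
- exact: hM'.
Qed.

Record l2_seq := L2Seq { l2_val :> nat -> V; l2_valP : l2_val \in l2_pred }.
HB.instance Definition _ := [isSub for l2_val].
HB.instance Definition _ := [Choice of l2_seq by <:].
HB.instance Definition _ := GRing.isSubmodClosed.Build C (nat -> V) l2_pred l2_submod.
HB.instance Definition _ := [SubChoice_isSubLmodule of l2_seq by <:].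

Implicit Types u v w : l2_seq.

Lemma l2D u v n : (u + v) n = u n + v n. Proof. by []. Qed.
Lemma l2N u n : (- u) n = - u n. Proof. by []. Qed.
Lemma l2_ext u v : (forall n, u n = v n) -> u = v.
Proof. by move=> h; apply: val_inj; apply/funext. Qed.
Lemma l2_supp u n : ~ S n -> u n = 0.
Proof. by have /l2_predP[h _] := l2_valP u; apply: h. Qed.

Definition l2_psum u v N : C := \sum_(n < N) dotp (u n) (v n).

Lemma l2_psum_cvg u v : exists l, tendsto (l2_psum u v) l.
Proof.
have /l2_predP[_ [M hM]] := l2_valP u; have /l2_predP[_ [M' hM']] := l2_valP v.
apply: (@abs_series_cvg R (fun n => dotp (u n) (v n)) (fun n => nm (u n) ^+ 2 + nm (v n) ^+ 2) (M + M')) => [n|N].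
  apply: le_trans (dot_CS _ _) _; have := sqr_ge0 (nm (u n) - nm (v n)).
  rewrite sqrrB; have := sqr_ge0 (nm (u n)); have := sqr_ge0 (nm (v n)); nra.
rewrite big_split /=; apply: lerD; [exact: hM|exact: hM'].
Qed.

Definition l2_dot u v : C := xget 0 [set l | tendsto (l2_psum u v) l].

Lemma l2_dotP u v : tendsto (l2_psum u v) (l2_dot u v).
Proof.
rewrite /l2_dot; case: xgetP => [l _ //|h].
by have [l hl] := l2_psum_cvg u v; case: (h l).
Qed.

Lemma l2_dot_eq u v l : tendsto (l2_psum u v) l -> l2_dot u v = l.
Proof. exact: tendsto_uniq (l2_dotP u v). Qed.

Lemma l2_dot_bilinear : bilinear_for (GRing.Scale.Law.clone _ _ ( *%R ) _)
  (GRing.Scale.Law.clone _ _ (Num.conj \; *%R) _) l2_dot.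
Proof.
split=> [v a u w|u a v w] /=; apply: l2_dot_eq.
  have := tendstoD (tendstoZ a (l2_dotP u v)) (l2_dotP w v).
  congr tendsto; apply/funext => N; rewrite /l2_psum mulr_sumr -big_split /=.
  by apply: eq_bigr => n _; rewrite dotDl dotZl.
have := tendstoD (tendstoZ (a^*) (l2_dotP u v)) (l2_dotP u w).
congr tendsto; apply/funext => N; rewrite /l2_psum mulr_sumr -big_split /=.
by apply: eq_bigr => n _; rewrite dotDr dotZr.
Qed.
HB.instance Definition _ :=
  bilinear_isBilinear.Build C l2_seq l2_seq C _ _ l2_dot l2_dot_bilinear.
Lemma l2_dot_herm u v : l2_dot u v = (-1) ^+ false * Num.conj (l2_dot v u).
Proof.
rewrite expr0 mul1r; apply: l2_dot_eq; have := tendsto_conj (l2_dotP v u).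
congr tendsto; apply/funext => N; rewrite /l2_psum rmorph_sum.
by apply: eq_bigr => n _; rewrite [RHS]dotC.
Qed.
HB.instance Definition _ := isHermitianSesquilinear.Build _ _ _ _ l2_dot l2_dot_herm.

Lemma l2_psumvv u N : l2_psum u u N = rc (\sum_(n < N) nm (u n) ^+ 2).
Proof.
rewrite /l2_psum /rc rmorph_sum; apply: eq_bigr => n _; exact: dotvv.
Qed.

Lemma l2_dotvv_real u : l2_dot u u = rc (re (l2_dot u u)).
Proof. by apply: real_re; rewrite {2}l2_dot_herm expr0 mul1r. Qed.

Lemma l2_psum_le u N : \sum_(n < N) nm (u n) ^+ 2 <= re (l2_dot u u).
Proof.
pose s M : C := l2_psum u u (N + M).
have hs : tendsto s (l2_dot u u).
  move=> e e0; have [M hM] := l2_dotP u u e0; exists M => n hn.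
  by apply: hM; rewrite (leq_trans hn) // leq_addl.
apply: (tendsto_re_ge hs) => M; rewrite /s l2_psumvv re_rc.
rewrite -!(big_mkord xpredT (fun n => nm (u n) ^+ 2)).
rewrite (big_cat_nat _ (leq_addr M N)) //= lerDl sumr_ge0 // => i _.
by rewrite sqr_ge0.
Qed.

Lemma l2_coord_le u n : nm (u n) ^+ 2 <= re (l2_dot u u).
Proof.
apply: le_trans (l2_psum_le u n.+1); rewrite big_ord_recr /= lerDr.
by rewrite sumr_ge0 // => i _; rewrite sqr_ge0.
Qed.

Lemma l2_dot_ge0 u : 0 <= re (l2_dot u u).
Proof. by apply: le_trans (l2_coord_le u 0); rewrite sqr_ge0. Qed.

Lemma l2_dot_le u (c : R) : (forall N, \sum_(n < N) nm (u n) ^+ 2 <= c) ->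
  re (l2_dot u u) <= c.
Proof.
move=> h; rewrite -lerN2 -reN.
have := tendstoZ (-1) (l2_dotP u u); rewrite mulN1r => hs.
by apply: (tendsto_re_ge hs) => N; rewrite mulN1r reN lerN2 l2_psumvv re_rc.
Qed.

Lemma l2_dot_eq0 u : re (l2_dot u u) = 0 -> u = 0.
Proof.
move=> h; apply: l2_ext => n; apply: nm_eq0; apply/eqP; rewrite -sqrf_eq0 eq_le sqr_ge0 andbT.
by rewrite -h l2_coord_le.
Qed.

Lemma l2_dot_gt0 u : u != 0 -> 0 < l2_dot u u.
Proof.
move=> u0; rewrite l2_dotvv_real -rc0 rc_lt lt_def l2_dot_ge0 andbT.
by apply: contra_neq u0; apply: l2_dot_eq0.
Qed.
HB.instance Definition _ := isDotProduct.Build _ _ l2_dot l2_dot_gt0.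

Definition l2_norm u : C := rc (Num.sqrt (re (l2_dot u u))).

Lemma l2_dotDl u v w : l2_dot (u + v) w = l2_dot u w + l2_dot v w.
Proof. exact: linearDl. Qed.
Lemma l2_dotZl a u v : l2_dot (a *: u) v = a * l2_dot u v.
Proof. exact: linearZl_LR. Qed.
Lemma l2_dotC u v : l2_dot u v = (l2_dot v u)^*.
Proof. by rewrite l2_dot_herm expr0 mul1r. Qed.
Lemma l2_dotDr u v w : l2_dot u (v + w) = l2_dot u v + l2_dot u w.
Proof. exact: linearDr. Qed.
Lemma l2_dotZr a u v : l2_dot u (a *: v) = a^* * l2_dot u v.
Proof. exact: linearZr_LR. Qed.

Lemma l2_dot0l v : l2_dot 0 v = 0.
Proof. by rewrite -[0](scale0r (0 : l2_seq)) l2_dotZl mul0r. Qed.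
Lemma l2_dot0r v : l2_dot v 0 = 0.
Proof. by rewrite l2_dotC l2_dot0l rmorph0. Qed.

(** [l2_dot] is a positive semidefinite kernel on the space itself, so the kernel form
    of the Cauchy-Schwarz inequality applies before there is a norm. *)
Lemma l2_dot_CS u v : modc (l2_dot u v) ^+ 2 <= re (l2_dot u u) * re (l2_dot v v).
Proof.
suff h : psd (fun x y : l2_seq => l2_dot y x).
  by have := psd_CS2 v u h; rewrite mulrC.
split=> [x y|s]; first by rewrite l2_dotC.
have -> : qf (fun x y : l2_seq => l2_dot y x) s =
    l2_dot (\sum_(p <- s) p.1 *: p.2) (\sum_(p <- s) p.1 *: p.2).
  rewrite [RHS](big_morph (l2_dot^~ _) (fun x y => l2_dotDl x y _) (l2_dot0l _)) /qf.
  apply: eq_bigr => p _.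
  rewrite [RHS](big_morph (l2_dot _) (l2_dotDr _) (l2_dot0r _)); apply: eq_bigr => q _.
  by rewrite l2_dotZl l2_dotZr mulrA.
exact: l2_dot_ge0.
Qed.

Lemma l2_norm_sqr u : l2_norm u ^+ 2 = l2_dot u u.
Proof. by rewrite -rcX sqr_sqrtr ?l2_dot_ge0 // -l2_dotvv_real. Qed.

Lemma l2_normD u v : l2_norm (u + v) <= l2_norm u + l2_norm v.
Proof.
rewrite /l2_norm -rcD rc_le -(@ler_pXn2r _ 2) ?nnegrE ?addr_ge0 ?sqrtr_ge0 //.
rewrite sqrrD !sqr_sqrtr ?l2_dot_ge0 // l2_dotDl !l2_dotDr !reD [l2_dot v u]l2_dotC re_conj.
have : re (l2_dot u v) <= Num.sqrt (re (l2_dot u u)) * Num.sqrt (re (l2_dot v v)).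
  apply: le_trans (re_le_modc _) _; rewrite -sqrtrM ?l2_dot_ge0 //.
  rewrite -[leLHS]ger0_norm ?modc_ge0 // -sqrtr_sqr ler_sqrt ?l2_dot_CS //.
  by rewrite mulr_ge0 // l2_dot_ge0.
rewrite -[_ *+ 2]mulr_natl; lra.
Qed.

Lemma l2_normZ a u : l2_norm (a *: u) = `|a| * l2_norm u.
Proof.
rewrite /l2_norm l2_dotZl l2_dotZr mulrA mulcJ reMr sqrtrM ?sqr_ge0 //.
by rewrite sqrtr_sqr ger0_norm ?modc_ge0 // rcM -normc_modc.
Qed.

Lemma l2_norm_eq0 u : l2_norm u = 0 -> u = 0.
Proof.
move=> h; apply: l2_dot_eq0; have := l2_norm_sqr u.
by rewrite h expr0n => <-.
Qed.

HB.instance Definition _ :=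
  Lmodule_isNormed.Build C l2_seq l2_normD l2_normZ l2_norm_eq0.

Lemma l2_normE u : re `|u| = Num.sqrt (re (l2_dot u u)).
Proof. by []. Qed.

Lemma l2_complete (F : set_system l2_seq) : ProperFilter F -> cauchy F -> cvg F.
Proof.
apply: complete_of_seq => s cs.
have nsq u : (re `|u|) ^+ 2 = re (l2_dot u u) by rewrite l2_normE sqr_sqrtr ?l2_dot_ge0.
have n0 u : 0 <= re `|u| by rewrite l2_normE sqrtr_ge0.
have coord u n : nm (u n) <= re `|u|.
  rewrite -(@ler_pXn2r _ 2) ?nnegrE ?nm_ge0 ?n0 // nsq; exact: l2_coord_le.
have ex n : exists l : V, forall e : R, 0 < e -> exists N, forall m, (N <= m)%N ->
     nm (s m n - l) < e.
  apply: hcomplete => e /cs[N hN]; exists N => m m' hm hm'.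
  by apply: le_lt_trans (hN _ _ hm hm'); exact: (coord (s m - s m') n).
have [l hl] := choice ex; clear ex.
have tail (e : R) (N : nat) : 0 <= e ->
   (forall m n, (N <= m)%N -> (N <= n)%N -> re `|s m - s n| <= e) ->
   forall m, (N <= m)%N -> forall K, \sum_(n < K) nm (s m n - l n) ^+ 2 <= e ^+ 2.
  move=> e0 hN m hm K.
  have lim : tendsto (fun j => rc (\sum_(n < K) nm (s m n - s j n) ^+ 2))
      (rc (\sum_(n < K) nm (s m n - l n) ^+ 2)).
    rewrite /rc rmorph_sum.
    have -> : (fun j => real_complex R (\sum_(n < K) nm (s m n - s j n) ^+ 2)) =
       (fun j => \sum_(n < K) rc (nm (s m n - s j n) ^+ 2)).
      by apply/funext => j; rewrite rmorph_sum.
    apply: tendsto_sum => n d d0.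
    pose B := nm (s m n - l n) ; have B0 : 0 <= B := nm_ge0 _.
    have B1 : 0 < 2 * B + 1 + 1 by lra.
    have D0 : 0 < d / (2 * B + 1 + 1) by rewrite divr_gt0.
    have [N1 h1] := hl n _ D0; have [N2 h2] := hl n _ ltr01.
    exists (maxn N1 N2) => j; rewrite geq_max => /andP[/h1 {}h1 /h2 {}h2].
    rewrite -rcB modc_rc.
    have t1 := nm_triangle (s m n) (s j n) (l n).
    have t2 := nm_triangle (s m n) (l n) (s j n).
    rewrite (nm_distC (l n)) in t2.
    rewrite ltr_pdivlMr // in h1.
    have A0 := nm_ge0 (s m n - s j n); have E0 := nm_ge0 (s j n - l n).
    rewrite -/B in t1 t2 *; set A := nm (s m n - s j n) in t1 t2 A0 *.
    set E := nm (s j n - l n) in h1 h2 t1 t2 E0.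
    rewrite ltr_norml; apply/andP; split; nra.
  rewrite -lerN2 -[leRHS]re_rc rcN.
  have := tendstoZ (-1) lim; rewrite mulN1r => hs.
  apply: (@tendsto_re_ge _ (fun j => -1 * rc (\sum_(n < K) nm (s m n - s (N + j)%N n) ^+ 2))).
    move=> d /hs[N1 h1]; exists N1 => j hj; apply: h1.
    by rewrite (leq_trans hj) // leq_addl.
  move=> j; rewrite mulN1r reN re_rc lerN2.
  apply: le_trans (l2_psum_le (s m - s (N + j)%N) K) _.
  by rewrite -nsq ler_pXn2r ?nnegrE ?n0 // hN // leq_addr.
have lP : l \in l2_pred.
  apply/l2_predP; split.
    move=> n hn; apply: eps_eqV => e /(hl n)[N /(_ N (leqnn _))].
    by rewrite (l2_supp _ hn) nm_distC.
  have [N hN] := cs _ ltr01.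
  have {}hN m n (hm : (N <= m)%N) (hn : (N <= n)%N) := ltW (hN m n hm hn).
  have := tail 1 N ler01 hN N (leqnn _) => ht.
  exists (2 * re (l2_dot (s N) (s N)) + 2 * 1 ^+ 2) => K.
  apply: (@le_trans _ _ (\sum_(n < K) (2 * nm (s N n) ^+ 2 + 2 * nm (s N n - l n) ^+ 2))).
    apply: ler_sum => n _; have := nm_parallelogram (s N n) (s N n - l n).
    rewrite opprB [s N n + (l n - _)]addrC subrK.
    have := sqr_ge0 (nm (s N n + (s N n - l n))); lra.
  rewrite big_split /= -!mulr_sumr; apply: lerD; apply: ler_wpM2l => //.
    exact: l2_psum_le.
  exact: ht.
exists (L2Seq lP) => e e0.
have e2 : 0 < e / 2 by rewrite divr_gt0.
have [N hN] := cs _ e2; exists N => m hm.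
have {}hN i j (hi : (N <= i)%N) (hj : (N <= j)%N) := ltW (hN i j hi hj).
apply: (@le_lt_trans _ _ (e / 2)); last by lra.
rewrite -(@ler_pXn2r _ 2) ?nnegrE ?n0 ?(ltW e2) // nsq.
apply: l2_dot_le => K; exact: (tail _ N (ltW e2) hN m hm K).
Qed.

HB.instance Definition _ := Uniform_isComplete.Build l2_seq l2_complete.

Definition l2 : hilbert R := @Hilbert R l2_seq l2_dot l2_norm_sqr.

End SquareSummable.

(** * Separability and the Moore-Aronszajn theorem *)

Lemma ball_nm (R : realType) (V : hilbert R) (u v : V) (e : R) :
  ball u (rc e) v <-> nm (u - v) < e.
Proof. by rewrite -ball_normE /= norm_nm rc_lt. Qed.

Section SeparableSequences.
Variables (R : realType) (S : nat -> Prop).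
Local Notation C := (R[i]).
Local Notation L := (l2 (complex_hilbert R) S).

Lemma l2_nm_sqr (V : hilbert R) (u : l2 V S) : nm u ^+ 2 = re (l2_dot u u).
Proof. by rewrite nm_sqr. Qed.

Definition rat_complex (p : rat * rat) : C := rc (ratr p.1) + 'i * rc (ratr p.2).

Lemma rat_complex0 : rat_complex (0, 0) = 0.
Proof. by rewrite /rat_complex /= !rmorph0 !rc0 mulr0 addr0. Qed.

Lemma rat_complex_dense (z : C) (d : R) : 0 < d ->
  exists p, modc (z - rat_complex p) < d.
Proof.
move=> d0; have app (a : R) : exists q : rat, `|a - ratr q| < d / 2.
  have [q] := @rat_in_itvoo R (a - d / 2) (a + d / 2) ltac:(lra).
  rewrite in_itv /= => /andP[h1 h2]; exists q.
  by rewrite ltr_norml; apply/andP; split; lra.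
have [q1 h1] := app (re z); have [q2 h2] := app (complex.Im z).
exists (q1, q2).
have -> : z - rat_complex (q1, q2) =
    rc (re z - ratr q1) + 'i * rc (complex.Im z - ratr q2).
  rewrite {1}[z]complexE /rat_complex /= !rcB complexiE /re /rc; ring.
apply: le_lt_trans (modcD _ _) _; rewrite modcM !modc_rc.
have -> : modc ('i : C) = 1 by apply: rc_inj; rewrite -normc_modc normCi.
lra.
Qed.

Lemma fin_seq_subproof (s : seq (rat * rat)) :
  (fun n => if `[< S n >] then rat_complex (nth (0, 0) s n) else 0)
    \in @l2_pred R (complex_hilbert R) S.
Proof.
apply/l2_predP; split=> [n hn|]; first by case: asboolP.
pose F n : R := modc (rat_complex (nth (0, 0) s n)) ^+ 2.
exists (\sum_(n < size s) F n) => N.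
apply: (@le_trans _ _ (\sum_(n < N) F n)).
  apply: ler_sum => n _; case: asboolP => // _.
  by rewrite nm0 expr0n sqr_ge0.
have F0 n : (size s <= n)%N -> F n = 0.
  move=> h; rewrite /F nth_default // rat_complex0.
  by rewrite modc0 expr0n.
rewrite -!(big_mkord xpredT F).
case/orP: (leq_total N (size s)) => h.
  rewrite (big_cat_nat _ h) //= lerDl sumr_ge0 // => i _; exact: sqr_ge0.
rewrite (big_cat_nat _ h) //=.
have -> : \sum_(size s <= i < N) F i = 0; last by rewrite addr0.
by rewrite big_nat_cond big1 // => i /andP[/andP[/F0-> _] _].
Qed.

Definition fin_seq s : L := L2Seq (fin_seq_subproof s).

Lemma l2_separable : exists A : set L, countable A /\ dense A.
Proof.
exists (range fin_seq); split.
  exact: sub_countable (card_image_le _ _) (countableP _).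
move=> O [u Ou] oO.
have /nbhs_ballP[e /= e0 sub] : nbhs u O by exact: open_nbhs_nbhs.
move: e0; rewrite ltcE /= => /andP[/eqP ei er].
have ee : e = rc (re e) by case: e ei {er sub} => a b /= ->.
have E0 : 0 < re e ^+ 2 / 4 by rewrite divr_gt0 // exprn_gt0.
suff [s hs] : exists s, nm (u - fin_seq s) < re e.
  exists (fin_seq s); split; last by exists s.
  by apply: sub; rewrite ee; exact: (proj2 (@ball_nm R L u (fin_seq s) (re e)) hs).
have [N hN] := bounded_series_cauchy (fun n => sqr_ge0 (nm (l2_val u n))) (l2_psum_le u) E0.
pose d := Num.min 1 (re e ^+ 2 / 4 / N.+1%:R).
have d0 : 0 < d by rewrite lt_min ltr01 divr_gt0.
have [q hq] := choice (fun n => rat_complex_dense (l2_val u n) d0).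
pose s := mkseq q N; exists s.
rewrite -(@ltr_pXn2r _ 2) ?nnegrE ?nm_ge0 ?(ltW er) //.
suff : nm (u - fin_seq s) ^+ 2 <= re e ^+ 2 / 4 + re e ^+ 2 / 4 by move: E0; lra.
rewrite l2_nm_sqr; apply: l2_dot_le => K.
have small n : (n < N)%N -> nm ((u - fin_seq s) n) ^+ 2 <= re e ^+ 2 / 4 / N.+1%:R.
  move=> hn; rewrite l2D l2N /= /s nth_mkseq //.
  case: asboolP => [_|/(l2_supp u) ->]; last first.
    by rewrite subrr nm0 expr0n divr_ge0 // ltW.
  have := hq n; rewrite lt_min => /andP[h1 h2].
  apply: le_trans (ltW h2); rewrite -[leRHS]mulr1 expr2.
  by apply: ler_pM; rewrite ?nm_ge0 // ltW.
have big n : (N <= n)%N -> nm ((u - fin_seq s) n) ^+ 2 <= nm (l2_val u n) ^+ 2.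
  move=> hn; rewrite l2D l2N /= /s nth_default ?size_mkseq //.
  by rewrite rat_complex0 if_same subr0.
have pos (n : nat) : 0 <= nm ((u - fin_seq s) n) ^+ 2 by rewrite sqr_ge0.
apply: (@le_trans _ _ (\sum_(n < maxn N K) nm ((u - fin_seq s) n) ^+ 2)).
  rewrite -!(big_mkord xpredT (fun n => nm ((u - fin_seq s) n) ^+ 2)).
  rewrite (big_cat_nat _ (leq_maxr N K)) //= lerDl.
  by apply: sumr_ge0 => n _; rewrite sqr_ge0.
rewrite -(big_mkord xpredT (fun n => nm ((u - fin_seq s) n) ^+ 2)).
rewrite (big_cat_nat _ (leq_maxl N K)) //=; apply: lerD; last first.
  apply: le_trans (ltW (hN N (maxn N K) (leqnn _) (leq_maxl _ _))).
  rewrite big_nat_cond [leRHS]big_nat_cond.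
  by apply: ler_sum => n /andP[/andP[h _] _]; apply: big.
apply: (@le_trans _ _ (\sum_(0 <= n < N) re e ^+ 2 / 4 / N.+1%:R)).
  rewrite big_nat_cond [leRHS]big_nat_cond.
  by apply: ler_sum => n /andP[/andP[_ h] _]; apply: small.
rewrite sumr_const_nat subn0 -[leLHS]mulr_natl mulrCA -[leRHS]mulr1 ler_wpM2l ?(ltW E0) //.
by rewrite ler_pdivrMr // mul1r ler_nat.
Qed.

End SeparableSequences.

(** For each element [a] of a countable dense set and each radius, choose a point whose
    image is that close to [a], if there is one. *)
Lemma dense_points (R : realType) (V : hilbert R) (Y : Type) (e : Y -> V) (y0 : Y) :
  (exists A : set V, countable A /\ dense A) ->
  exists y : nat -> Y, forall z (eps : R), 0 < eps -> exists n, nm (e z - e (y n)) < eps.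
Proof.
move=> [A [/countable_injP[f finj] dA]].
pose P (n : nat) z := exists a, exists k : nat,
  [/\ A a, pickle (f a, k) = n & nm (e z - a) < k.+1%:R^-1].
have ex n : exists w, (exists z, P n z) -> P n w.
  by have [[z hz]|h] := pselect (exists z, P n z); [exists z|exists y0].
have [y hy] := choice ex; exists y => z eps eps0.
have [k hk] := inv_nat_small (divr_gt0 eps0 (ltr0Sn R 1)).
have {}hk := hk k (leqnn _).
have k0 : 0 < k.+1%:R^-1 :> R by rewrite invr_gt0.
have [|a [ha Aa]] := dA (ball (e z) (rc k.+1%:R^-1)) _ (ball_open _ _).
- exists (e z); apply: ballxx; by rewrite -rc0 rc_lt.
have {}ha : nm (e z - a) < k.+1%:R^-1 by apply/ball_nm.
pose n := pickle (f a, k); exists n.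
have [|a' [k' [Aa' /(pcan_inj pickleK)[fa ->] h]]] := hy n; first by exists z, a, k.
have e1 : a' = a by apply: finj; rewrite ?inE.
rewrite e1 in h; have := nm_triangle (e z) a (e (y n)); rewrite (nm_distC a).
by move: hk ha h; move: (k.+1%:R^-1) => q; lra.
Qed.

Section MooreAronszajn.
Variable R : realType.
Local Notation C := (R[i]).

Definition feature_eval (V : hilbert R) (Y : Type) (e : Y -> V) (f : V) : Y -> C :=
  fun x => dotp f (e x).

Lemma feature_eval_linear (V : hilbert R) (Y : Type) (e : Y -> V) :
  linear (feature_eval e).
Proof.
by move=> a u v; apply/funext => x; rewrite /feature_eval dotDl dotZl.
Qed.
HB.instance Definition _ (V : hilbert R) (Y : Type) (e : Y -> V) :=
  GRing.isLinear.Build _ _ _ _ (feature_eval e) (feature_eval_linear e).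

Definition feature_rkhs (V : hilbert R) (Y : Type) (e : Y -> V)
    (sep : exists A : set V, countable A /\ dense A)
    (inj : injective (feature_eval e)) : rkhs R Y :=
  @RKHS R Y V (hil_dot V) (@hil_normE _ V) sep (feature_eval e) inj e (fun f x => erefl).

Variables (Y : Type) (k : Y -> Y -> C) (y : nat -> Y).
Hypothesis pk : psd k.
Hypothesis dense_y : forall z (e : R), 0 < e ->
  exists n, re (qf k [:: (1, z); (-1, y n)]) < e.

Let S n := pivot k y n <> 0.

Lemma chol_supp n x : ~ S n -> chol k y n x = 0.
Proof. by move=> /contrapT h; rewrite /chol h sqrtr0 invr0 mulr0. Qed.

(** The remainder on the diagonal at [z] is at most the squared distance from [z] to any
    of the points already eliminated. *)
Lemma chol_rest_small z (e : R) : 0 < e ->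
  exists N, forall n, (N <= n)%N -> re (chol_rest k y n z z) < e.
Proof.
move=> /(dense_y z)[n hn]; exists n.+1 => N hN; apply: le_lt_trans hn.
apply: le_trans (chol_rest_le y pk N _).
rewrite /qf !(big_cons, big_nil) /= !(chol_rest0, chol_rest0r) // !mulr0 !addr0.
by rewrite rmorph1 !mul1r.
Qed.

Lemma feature_subproof x :
  (fun n => (chol k y n x)^* : complex_hilbert R) \in @l2_pred R (complex_hilbert R) S.
Proof.
apply/l2_predP; split=> [n hn|]; first by rewrite chol_supp // rmorph0.
exists (re (k x x)) => N; apply: le_trans (chol_diag y pk N x).
by apply: ler_sum => n _; rewrite /nm -/(modc _) modc_conj.
Qed.

Definition feature x : l2 (complex_hilbert R) S := L2Seq (feature_subproof x).

Lemma feature_dot x z : dotp (feature z) (feature x) = k x z.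
Proof.
apply: (tendsto_uniq (l2_dotP _ _)).
have -> : l2_psum (feature z) (feature x) = (fun N => k x z - chol_rest k y N x z).
  apply/funext => N; rewrite -(chol_sum y pk) /l2_psum; apply: eq_bigr => n _.
  by rewrite /dotp /= /cdot conjCK mulrC.
apply: (@tendsto_squeeze _ _ _ (fun N => modc (chol_rest k y N x z))) => [N|e e0].
  by rewrite addrAC subrr add0r modcN.
pose B := re (k z z) + 1.
have B0 : 0 < B by rewrite ltr_wpDl // psd_diag_ge0.
have [N hN] := chol_rest_small x (divr_gt0 (exprn_gt0 2 e0) B0).
exists N => n /hN; rewrite ltr_pdivlMr // => h.
rewrite -(@ltr_pXn2r _ 2) ?nnegrE ?modc_ge0 ?(ltW e0) //.
have pN := psd_chol_rest y pk n.
apply: le_lt_trans (psd_CS2 x z pN) _; apply: le_lt_trans h.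
apply: ler_wpM2l; first exact: psd_diag_ge0.
have := chol_rest_le y pk n [:: (1, z)].
rewrite /qf !big_seq1 /= rmorph1 !mul1r /B; lra.
Qed.

(** The matrix [chol k y i (y n)] is triangular, with nonzero diagonal on the support [S]. *)
Lemma feature_total (f : l2 (complex_hilbert R) S) :
  (forall n, dotp f (feature (y n)) = 0) -> f = 0.
Proof.
move=> h; apply: l2_ext => n; elim/ltn_ind: n => n IH.
have [Sn|Sn] := pselect (S n); last by rewrite l2_supp.
(* earlier coordinates of f vanish by induction, later factors at y n by elimination *)
have : tendsto (l2_psum f (feature (y n))) (l2_val f n * chol k y n (y n)).
  apply: (@tendsto_eq _ (fun=> l2_val f n * chol k y n (y n)) _ _ n.+1); last exact: tendsto_cst.
  move=> N hN; rewrite /l2_psum -(big_mkord xpredT (fun i => dotp (l2_val f i) (feature (y n) i))).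
  rewrite (big_cat_nat _ hN) //= big_nat_recr //=.
  have -> : \sum_(0 <= i < n) dotp (l2_val f i) (feature (y n) i) = 0.
    rewrite big_nat_cond big1 // => i /andP[/andP[_ hi] _].
    by rewrite IH // dot0l.
  have -> : \sum_(n.+1 <= i < N) dotp (l2_val f i) (feature (y n) i) = 0.
    rewrite big_nat_cond big1 // => i /andP[/andP[hi _] _].
    by rewrite /feature /= /chol chol_rest0 // mul0r rmorph0 dot0r.
  by rewrite add0r addr0 /dotp /= /cdot conjCK.
move=> /(tendsto_uniq (l2_dotP _ _)); rewrite [LHS](h n) => /esym/eqP.
rewrite mulf_eq0 => /orP[/eqP //|].
have : 0 <= pivot k y n by apply/psd_diag_ge0/psd_chol_rest.
rewrite le_eqVlt => /predU1P[e|p0]; first by case: Sn.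
have s0 : rc (Num.sqrt (pivot k y n)) != 0.
  by rewrite -rc0 (inj_eq (@rc_inj R)) gt_eqF // sqrtr_gt0.
rewrite /chol mulf_eq0 invr_eq0 (negbTE s0) orbF.
by rewrite psd_diag; [rewrite -rc0 (inj_eq (@rc_inj R)) gt_eqF|apply: psd_chol_rest].
Qed.

(** The Cholesky factors along a dense sequence of points are the coordinates of the
    kernel functions in an orthonormal basis, so the space can be taken to be l^2. *)
Theorem moore_aronszajn : exists D : rkhs R Y, forall x z, repkernel D x z = k x z.
Proof.
have inj : injective (feature_eval feature).
  move=> f g /funeqP h; apply/eqP; rewrite -subr_eq0; apply/eqP.
  apply: feature_total => n; rewrite dotBl.
  by have := h (y n); rewrite /feature_eval => ->; rewrite subrr.
exists (feature_rkhs (l2_separable R S) inj) => x z; exact: feature_dot.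
Qed.

End MooreAronszajn.

(** * Drury-Arveson spaces *)

Section KernelConstructions.
Variable R : realType.
Local Notation C := (R[i]).

Lemma psd_exp (Y : Type) (G : Y -> Y -> C) n : psd G -> psd (fun x y => G x y ^+ n).
Proof.
move=> pG; elim: n => [|n IH].
  by apply: psd_ext _ (@psd_cst1 R Y) => x y; rewrite expr0.
by apply: psd_ext _ (psd_mul pG IH) => x y; rewrite exprS.
Qed.

Lemma expr_small (a e : R) : 0 <= a < 1 -> 0 < e ->
  exists N, forall n, (N <= n)%N -> a ^+ n < e.
Proof.
move=> /andP[a0 a1] e0.
have /cvgrPdist_lt/(_ e e0)[N _ hN] : (fun n => a ^+ n : R) @ \oo --> (0 : R).
  by apply: cvg_expr; rewrite ger0_norm.
exists N => n /hN /=; rewrite sub0r normrN ger0_norm // exprn_ge0 //.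
Qed.

Lemma one_sub_neq0 (q : C) : modc q < 1 -> 1 - q != 0.
Proof.
move=> q1; apply/negP; rewrite subr_eq0 => /eqP h.
by move: q1; rewrite -h modc1 ltxx.
Qed.

Lemma geometric_tendsto (q : C) : modc q < 1 ->
  tendsto (fun N => \sum_(n < N) q ^+ n) (1 - q)^-1.
Proof.
move=> q1; have q0 := one_sub_neq0 q1.
have m0 := modc_gt0 q0.
apply: (@tendsto_squeeze _ _ _ (fun N => modc q ^+ N / modc (1 - q))) => [N|e e0].
  have -> : \sum_(n < N) q ^+ n - (1 - q)^-1 = - (q ^+ N / (1 - q)).
    have := subrX1 q N; rewrite -opprB => h.
    have -> : \sum_(n < N) q ^+ n = (1 - q ^+ N) / (1 - q).
      apply: (mulIf q0); rewrite divfK // -[1 - q ^+ N]opprB subrX1 mulrC.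
      by rewrite -mulNr opprB.
    by field.
  by rewrite modcN modcM modcV modcX.
have [|N hN] := @expr_small (modc q) (e * modc (1 - q)) _ (mulr_gt0 e0 m0).
  by rewrite modc_ge0 q1.
by exists N => n /hN; rewrite ltr_pdivrMr.
Qed.

Lemma psd_geometric (Y : Type) (G : Y -> Y -> C) : psd G ->
  (forall x y, modc (G x y) < 1) -> psd (fun x y => (1 - G x y)^-1).
Proof.
move=> pG G1; apply: (@psd_limit _ _ (fun N x y => \sum_(n < N) G x y ^+ n)).
  by move=> N; apply: psd_sum => n; apply: psd_exp.
by move=> x y; apply: geometric_tendsto.
Qed.

Definition cont_at (op : C -> C) (w0 : C) := forall e : R, 0 < e ->
  exists2 d : R, 0 < d & forall w, modc (w - w0) < d -> modc (op w - op w0) < e.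

Lemma inv_cont_at (w0 : C) : w0 != 0 -> cont_at (fun w => w^-1) w0.
Proof.
move=> w00 e e0; have m0 := modc_gt0 w00; set m := modc w0 in m0.
exists (Num.min (m / 2) (e * (m * (m / 2)))).
  by rewrite lt_min !(divr_gt0, mulr_gt0).
move=> w; rewrite lt_min => /andP[h1 h2].
have hw : m / 2 < modc w.
  have := modcD w (w0 - w); rewrite addrC subrK modc_distC -/m; lra.
have w1 : w != 0 by apply: contraTneq hw => ->; rewrite modc0 -leNgt; lra.
have -> : w^-1 - w0^-1 = - (w - w0) / (w * w0) by field; rewrite w00 w1.
have P0 : 0 < modc w * m by rewrite mulr_gt0 // modc_gt0.
rewrite modcM modcN modcV modcM -/m ltr_pdivrMr //.
apply: lt_le_trans h2 _; rewrite ler_pM2l // [modc w * m]mulrC ler_pM2l // ltW //.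
Qed.

(** A kernel that is a continuous function of a Gram kernel inherits a dense sequence of
    points from the feature vectors, whose ambient space is separable. *)
Lemma dense_kernel (V : hilbert R) (Y : Type) (e : Y -> V) (y0 : Y) (op : C -> C) :
  (exists A : set V, countable A /\ dense A) ->
  (forall x, cont_at op (dotp (e x) (e x))) ->
  exists y : nat -> Y, forall z (eps : R), 0 < eps -> exists n,
    re (qf (fun x x' => op (dotp (e x') (e x))) [:: (1, z); (-1, y n)]) < eps.
Proof.
move=> sep cop; have [y hy] := dense_points e y0 sep.
exists y => z eps eps0.
have e4 : 0 < eps / 4 by rewrite divr_gt0.
have [d d0 hd] := cop z _ e4.
pose B := nm (e z); have B0 : 0 <= B := nm_ge0 _.
have B1 : 0 < 2 * B + 2 by lra.
have D0 : 0 < Num.min 1 (d / (2 * B + 2)) by rewrite lt_min ltr01 divr_gt0.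
have [n] := hy z _ D0; rewrite lt_min ltr_pdivlMr // => /andP[h1 h2].
exists n; set w := y n in h1 h2 *; set t := nm (e z - e w) in h1 h2.
have t0 : 0 <= t := nm_ge0 _.
have nw : nm (e w) <= B + t.
  have := nmD (e z) (e w - e z); rewrite addrC subrK nm_distC -/t -/B; lra.
have tB : 0 <= t * B by rewrite mulr_ge0.
have tt : t * t <= t by rewrite ler_piMr // ltW.
have tw : nm (e w) * t <= (B + t) * t by rewrite ler_wpM2r.
have k1 : modc (op (dotp (e w) (e z)) - op (dotp (e z) (e z))) < eps / 4.
  apply: hd; rewrite -dotBl; apply: le_lt_trans (dot_CS _ _) _.
  rewrite nm_distC -/t -/B; lra.
have k2 : modc (op (dotp (e z) (e w)) - op (dotp (e z) (e z))) < eps / 4.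
  apply: hd; rewrite -dotBr; apply: le_lt_trans (dot_CS _ _) _.
  rewrite nm_distC -/t -/B; lra.
have k3 : modc (op (dotp (e w) (e w)) - op (dotp (e z) (e z))) < eps / 4.
  apply: hd.
  have -> : dotp (e w) (e w) - dotp (e z) (e z) =
    dotp (e w) (e w - e z) + dotp (e w - e z) (e z) by rewrite dotBr dotBl; ring.
  apply: le_lt_trans (modcD _ _) _.
  have a1 := dot_CS (e w) (e w - e z); have a2 := dot_CS (e w - e z) (e z).
  rewrite nm_distC -/t in a1; rewrite nm_distC -/t -/B in a2; lra.
rewrite /qf !(big_cons, big_nil) /= !addr0 !(rmorphN, rmorph1) mulrNN !mulr1 !mul1r !mulN1r.
move: k1 k2 k3; set o := op (dotp (e z) (e z)); set a := op _; set b := op _; set c := op _.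
move=> k1 k2 k3.
have := re_le_modc (- (a - o)); have := re_le_modc (- (b - o)); have := re_le_modc (c - o).
rewrite !modcN !(reD, reN); lra.
Qed.

(** The Cholesky factors as coordinates in l^2: the Kolmogorov decomposition of a
    separable kernel. *)
Lemma psd_feature (Y : Type) (k : Y -> Y -> C) (y : nat -> Y) : psd k ->
  (forall z (e : R), 0 < e -> exists n, re (qf k [:: (1, z); (-1, y n)]) < e) ->
  exists b : Y -> nat -> C,
    (forall x N, \sum_(n < N) modc (b x n) ^+ 2 <= re (k x x)) /\
    (forall x z, tendsto (fun N => \sum_(n < N) b x n * (b z n)^*) (k x z)).
Proof.
move=> pk dy; exists (fun x n => chol k y n x); split=> [x N|x z].
  exact: chol_diag.
rewrite -(feature_dot pk dy); have := l2_dotP (feature y pk z) (feature y pk x).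
congr tendsto; apply/funext => N; apply: eq_bigr => n _.
by rewrite /dotp /= /cdot conjCK mulrC.
Qed.

End KernelConstructions.

Section BallCoordinates.
Variable R : realType.
Local Notation C := (R[i]).

(** Coordinates of all balls as sequences, so that finite and infinite dimension are
    treated together. *)
Definition pad (m : option nat) : (Defs.coord m -> C) -> nat -> C :=
  match m return (Defs.coord m -> C) -> nat -> C with
  | Some n => fun u i => if insub i is Some j then u j else 0
  | None => fun u => u
  end.

Definition in_dim (m : option nat) (i : nat) : bool :=
  if m is Some n then (i < n)%N else true.

Lemma pad_inj m (u v : Defs.coord m -> C) : (forall i, pad u i = pad v i) -> u = v.
Proof.
case: m u v => [n|] u v /= h; apply/funext => // i.
by have := h (val i); rewrite !valK.
Qed.

Lemma pad_out m (u : Defs.coord m -> C) i : ~~ in_dim m i -> pad u i = 0.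
Proof. by case: m u => [n|] u //= hi; rewrite insubN. Qed.

Lemma pad_surj m (s : nat -> C) : (forall i, ~~ in_dim m i -> s i = 0) ->
  exists u : Defs.coord m -> C, forall i, pad u i = s i.
Proof.
case: m => [n|] /= h; last by exists s.
exists (fun i : 'I_n => s i) => i; case: insubP => [j _ <- //|/h ->//].
Qed.

Lemma pad_mapE m (u v : Defs.coord m -> C) (f : C -> C -> C) i : f 0 0 = 0 ->
  pad (fun j => f (u j) (v j)) i = f (pad u i) (pad v i).
Proof. by case: m u v => [n|] u v f0 //=; case: insubP. Qed.

Lemma coord_sum_tendsto m (u : Defs.coord m -> C) : coord_summable u ->
  tendsto (fun N => \sum_(i < N) pad u i) (coord_sum u).
Proof.
case: m u => [n|] u /=.
  move=> _; apply: (@tendsto_eq _ (fun=> \sum_(i < n) u i) _ _ n); last exact: tendsto_cst.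
  move=> N hN; rewrite -(big_mkord xpredT (pad (m := Some n) u)) (big_cat_nat _ hN) //=.
  rewrite [X in _ + X]big_nat_cond [X in _ + X]big1; last first.
    by move=> i /andP[/andP[hi _] _]; rewrite insubN // -leqNgt.
  rewrite addr0 big_mkord; apply: eq_bigr => i _.
  by rewrite -[nat_of_ord i]/(val i) valK.
move=> h; apply/tendstoP.
have -> : (fun N => \sum_(i < N) u i) = series u.
  by apply/funext => N; rewrite /series /= big_mkord.
exact: h.
Qed.

Lemma coord_sum_eq m (u : Defs.coord m -> C) l :
  tendsto (fun N => \sum_(i < N) pad u i) l -> coord_summable u /\ coord_sum u = l.
Proof.
move=> h; have hs : coord_summable u.
  case: m u h => [n|] u //= /tendstoP h.
  have e : (fun N => \sum_(i < N) u i) = series u.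
    by apply/funext => N; rewrite /series /= big_mkord.
  by apply: (cvgP l); rewrite -e.
by split=> //; apply: tendsto_uniq (coord_sum_tendsto hs) h.
Qed.

Definition zeta m (z : ball_of R m) : nat -> C := pad (sval z).

Lemma zeta_out m (z : ball_of R m) i : ~~ in_dim m i -> zeta z i = 0.
Proof. exact: pad_out. Qed.

Lemma zeta_inj m (z w : ball_of R m) : (forall i, zeta z i = zeta w i) -> z = w.
Proof.
case: z => u pu; case: w => v pv /pad_inj /= e; subst v.
by congr exist; exact: Prop_irrelevance.
Qed.

Lemma zeta_bound m (z : ball_of R m) :
  exists2 c : R, c < 1 & forall N, \sum_(i < N) modc (zeta z i) ^+ 2 <= c.
Proof.
case: z => u [hu u1]; rewrite /zeta /=.
have := coord_sum_tendsto hu; set l := coord_sum _ in u1 *.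
have -> : (fun N => \sum_(i < N) pad (fun i0 => `|u i0| ^+ 2) i) =
   (fun N => rc (\sum_(i < N) modc (pad u i) ^+ 2)).
  apply/funext => N; rewrite /rc rmorph_sum; apply: eq_bigr => i _.
  rewrite (@pad_mapE m u u (fun x _ => `|x| ^+ 2)) ?normr0 ?expr0n //.
  by rewrite normc_modc -rcX.
move=> hl; exists (re l); first by move: u1; rewrite ltcE /= => /andP[].
move=> N; have hs : tendsto (fun M => rc (\sum_(i < N + M) modc (pad u i) ^+ 2)) l.
  by move=> e /hl[M hM]; exists M => n hn; apply: hM; rewrite (leq_trans hn) // leq_addl.
apply: (tendsto_re_ge hs) => M; rewrite re_rc -!(big_mkord xpredT (fun i => modc (pad u i) ^+ 2)).
rewrite (big_cat_nat _ (leq_addr M N)) //= lerDl sumr_ge0 // => i _.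
exact: sqr_ge0.
Qed.

Lemma zeta_dot m (z w : ball_of R m) :
  tendsto (fun N => \sum_(i < N) zeta z i * (zeta w i)^*) (coord_dot (sval z) (sval w)).
Proof.
have [c _ hc] := zeta_bound z; have [c' _ hc'] := zeta_bound w.
have [l hl] : exists l, tendsto (fun N => \sum_(i < N) zeta z i * (zeta w i)^*) l.
  apply: (@abs_series_cvg R (fun n => zeta z n * (zeta w n)^*) (fun n => modc (zeta z n) ^+ 2 + modc (zeta w n) ^+ 2) (c + c')).
    move=> n; rewrite modcM modc_conj.
    have := modc_ge0 (zeta z n); have := modc_ge0 (zeta w n).
    have := sqr_ge0 (modc (zeta z n) - modc (zeta w n)); rewrite sqrrB; nra.
  move=> N; rewrite big_split /=; apply: lerD; [exact: hc|exact: hc'].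
have h2 : tendsto (fun N => \sum_(i < N) pad (fun i0 => sval z i0 * (sval w i0)^*) i) l.
  move: hl; congr tendsto; apply/funext => N; apply: eq_bigr => i _.
  by rewrite (@pad_mapE m _ _ (fun x y => x * y^*)) // mul0r.
by rewrite /coord_dot (coord_sum_eq h2).2.
Qed.

Lemma ball_of_seq m (s : nat -> C) (c : R) : c < 1 ->
  (forall i, ~~ in_dim m i -> s i = 0) ->
  (forall N, \sum_(i < N) modc (s i) ^+ 2 <= c) ->
  exists z : ball_of R m, forall i, zeta z i = s i.
Proof.
move=> c1 /pad_surj[u hu] hs.
have [l hl] : exists l, tendsto (fun N => \sum_(i < N) rc (modc (s i) ^+ 2)) l.
  apply: (@abs_series_cvg R (fun n => rc (modc (s n) ^+ 2)) (fun n => modc (s n) ^+ 2) c) => // n.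
  by rewrite modc_rc ger0_norm // sqr_ge0.
have e0 : (fun N => \sum_(i < N) pad (fun i0 => `|u i0| ^+ 2) i) =
   (fun N => \sum_(i < N) rc (modc (s i) ^+ 2)).
  apply/funext => N; apply: eq_bigr => i _.
  rewrite (@pad_mapE m u u (fun x _ => `|x| ^+ 2)) ?normr0 ?expr0n //.
  by rewrite hu normc_modc -rcX.
have [sm eqs] := @coord_sum_eq m (fun i => `|u i| ^+ 2) l ltac:(by rewrite e0).
have e1 N : \sum_(i < N) rc (modc (s i) ^+ 2) = rc (\sum_(i < N) modc (s i) ^+ 2).
  by rewrite /rc rmorph_sum.
have lr : l = rc (re l).
  apply: real_re; apply: (tendsto_uniq _ hl); have := tendsto_conj hl.
  by congr tendsto; apply/funext => N; rewrite e1 conj_rc.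
have lc : re l <= c.
  rewrite -lerN2 -reN; have := tendstoZ (-1) hl; rewrite mulN1r => h.
  by apply: (tendsto_re_ge h) => N; rewrite mulN1r reN lerN2 e1 re_rc.
have l1 : coord_sum (fun i => `|u i| ^+ 2) < 1.
  by rewrite eqs lr -rc1 rc_lt (le_lt_trans lc).
by exists (exist _ u (conj sm l1)).
Qed.

Lemma ball_vec_subproof m (z : ball_of R m) :
  (fun n => (zeta z n)^* : complex_hilbert R) \in @l2_pred R (complex_hilbert R) (fun=> True).
Proof.
apply/l2_predP; split=> [n []//|]; have [c _ hc] := zeta_bound z.
exists c => N; apply: le_trans (hc N); apply: ler_sum => n _.
by rewrite /nm -/(modc _) modc_conj.
Qed.

(** Conjugated so that the inner product of [ball_vec w] with [ball_vec z] is <z, w>. *)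
Definition ball_vec m (z : ball_of R m) : l2 (complex_hilbert R) (fun=> True) :=
  L2Seq (ball_vec_subproof z).

Lemma ball_vec_dot m (z w : ball_of R m) :
  dotp (ball_vec w) (ball_vec z) = coord_dot (sval z) (sval w).
Proof.
apply: (tendsto_uniq (l2_dotP _ _)); have := zeta_dot z w.
congr tendsto; apply/funext => N; apply: eq_bigr => n _.
by rewrite /dotp /= /cdot conjCK mulrC.
Qed.

Lemma ball_vec_lt1 m (z : ball_of R m) : nm (ball_vec z) < 1.
Proof.
have [c c1 hc] := zeta_bound z.
rewrite -(@ltr_pXn2r _ 2) ?nnegrE ?nm_ge0 ?ler01 // expr1n l2_nm_sqr.
apply: le_lt_trans c1; apply: l2_dot_le => N; apply: le_trans (hc N).
by apply: ler_sum => n _; rewrite /nm -/(modc _) modc_conj.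
Qed.

Lemma coord_dot_lt1 m (z w : ball_of R m) : modc (coord_dot (sval z) (sval w)) < 1.
Proof.
rewrite -ball_vec_dot; apply: le_lt_trans (dot_CS _ _) _.
have := ball_vec_lt1 z; have := ball_vec_lt1 w.
have := nm_ge0 (ball_vec z); have := nm_ge0 (ball_vec w); nra.
Qed.

Lemma psd_coord_dot m : psd (fun z w : ball_of R m => coord_dot (sval z) (sval w)).
Proof. by apply: (psd_ext _ (psd_gram (@ball_vec m))) => z w; rewrite ball_vec_dot. Qed.

Lemma ball_origin m : inhabited (ball_of R m).
Proof.
have [|||z _] := @ball_of_seq m (fun=> 0) 0 _ => //.
by move=> N; rewrite big1 // => i _; rewrite modc0 expr0n.
Qed.

Lemma psd_drury_arveson m : psd (@drury_arveson_kernel R m).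
Proof. by apply: psd_geometric (psd_coord_dot m) _ => z w; apply: coord_dot_lt1. Qed.

Theorem drury_arveson_exists m : exists D : rkhs R (ball_of R m), is_drury_arveson D.
Proof.
have [z0] := ball_origin m.
have [|y hy] := @dense_kernel R _ _ (@ball_vec m) z0 (fun w => (1 - w)^-1) (l2_separable R _).
  move=> z e e0; have h0 : 1 - dotp (ball_vec z) (ball_vec z) != 0.
    by rewrite ball_vec_dot one_sub_neq0 // coord_dot_lt1.
  have [d d0 hd] := inv_cont_at h0 e0; exists d => // w hw; apply: hd.
  have -> : 1 - w - (1 - dotp (ball_vec z) (ball_vec z)) = - (w - dotp (ball_vec z) (ball_vec z)) by ring.
  by rewrite modcN.
have [|D hD] := @moore_aronszajn R _ _ y (psd_drury_arveson m); last by exists D.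
have -> : @drury_arveson_kernel R m = (fun u v => (1 - dotp (ball_vec v) (ball_vec u))^-1).
  by apply/funext => u; apply/funext => v; rewrite ball_vec_dot.
exact: hy.
Qed.

End BallCoordinates.

(** * Membership and multipliers in reproducing kernel Hilbert spaces *)

Section GramFamilies.
Variables (R : realType) (V : hilbert R) (Y : Type) (e : Y -> V).
Local Notation C := (R[i]).

Lemma dot_gram s f : dotp (gram e s) f = lf (fun y => dotp (e y) f) s.
Proof. by rewrite /gram dot_suml; apply: eq_bigr => p _; rewrite dotZl. Qed.

Lemma gram1 y : gram e [:: (1, y)] = e y.
Proof. by rewrite /gram big_seq1 scale1r. Qed.

Lemma gram_comb a s t : exists r : seq (C * Y),
  gram e r = a *: gram e s + gram e t /\ forall h, lf h r = a * lf h s + lf h t.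
Proof.
exists ([seq (a * p.1, p.2) | p <- s] ++ t); split.
  rewrite /gram big_cat /= big_map scaler_sumr; congr (_ + _).
  by apply: eq_bigr => p _; rewrite scalerA.
move=> h; rewrite /lf big_cat /= big_map mulr_sumr; congr (_ + _).
by apply: eq_bigr => p _; rewrite mulrA.
Qed.

(** [riesz_rel] for the span of a family, with the functional prescribed on the family. *)
Lemma gram_riesz (h : Y -> C) (c : R) : 0 <= c ->
  (forall s, modc (lf h s) <= c * nm (gram e s)) ->
  exists g : V, [/\ forall y, dotp (e y) g = h y, nm g <= c &
    forall eps : R, 0 < eps -> exists s, nm (gram e s - g) < eps].
Proof.
move=> c0 hc.
have [|||g [h1 h2 h3]] := @riesz_rel R V
    (fun u x => exists s, u = gram e s /\ x = lf h s) c c0.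
- by exists [::]; rewrite /gram /lf !big_nil.
- move=> a u v x y [s [-> ->]] [t [-> ->]].
  by have [r [r1 r2]] := gram_comb a s t; exists r; rewrite r1 r2.
- by move=> u x [s [-> ->]].
exists g; split=> // [y|eps /h3[u [x [[s [-> _]] hs]]]]; last by exists s.
rewrite (h1 (e y) (h y)) //; exists [:: (1, y)]; rewrite gram1; split=> //.
by rewrite /lf big_seq1 mul1r.
Qed.

(** Closing the test: as u tends to g, 2 Re <u, g> - |u|^2 tends to |g|^2. *)
Lemma nm_le_approx (g : V) (T : R) (P : V -> Prop) : 
  (forall eps : R, 0 < eps -> exists2 u, P u & nm (u - g) < eps) ->
  (forall u, P u -> 2 * re (dotp u g) <= nm u ^+ 2 + T) ->
  nm g ^+ 2 <= T.
Proof.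
move=> hd hb; apply/ler_addgt0Pr => d d0; set G := nm g.
have G0 : 0 <= G := nm_ge0 _.
have B0 : 0 < 4 * G + 1 by lra.
have [|u Pu] := hd (Num.min 1 (d / (4 * G + 1))).
  by rewrite lt_min ltr01 divr_gt0.
rewrite lt_min ltr_pdivlMr // => /andP[h1 h2]; set t := nm (u - g) in h1 h2.
have t0 : 0 <= t := nm_ge0 _.
have a1 : nm u <= G + t by have := nmD (u - g) g; rewrite subrK -/t -/G; lra.
have a2 : nm u ^+ 2 <= (G + t) ^+ 2.
  by rewrite ler_pXn2r ?nnegrE ?nm_ge0 ?addr_ge0.
have a3 : G ^+ 2 - t * G <= re (dotp u g).
  rewrite -[X in dotp X g](subrK g) dotDl reD -nm_sqr -/G.
  have := re_dot_le (- (u - g)) g; rewrite nmN dotNl reN -/t -/G; lra.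
have a4 : t * t <= t by rewrite ler_piMr // ltW.
have := hb u Pu; have tG : 0 <= t * G by rewrite mulr_ge0.
move: a2; rewrite sqrrD; lra.
Qed.

End GramFamilies.

Section ReproducingKernel.
Variables (R : realType) (X : Type) (H : rkhs R X).
Local Notation C := (R[i]).
Local Notation K := (repkernel H).
Implicit Types (f g : H) (s : seq (C * X)) (phi psi : mult H).

Definition kcomb s : H := gram (rk_kernel H) s.

Lemma dot_kernel f x : dotp f (rk_kernel H x) = rk_fun H f x.
Proof. exact: rk_reproducing. Qed.

Lemma kernelE x y : K x y = dotp (rk_kernel H y) (rk_kernel H x).
Proof. by rewrite dot_kernel. Qed.

Lemma psd_repkernel : psd K.
Proof.
by apply: (psd_ext _ (psd_gram (rk_kernel H))) => x y; rewrite kernelE.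
Qed.

Lemma qf_repkernel s : qf K s = rc (nm (kcomb s) ^+ 2).
Proof.
rewrite -qf_gram; congr qf; apply/funext => x; apply/funext => y; exact: kernelE.
Qed.

Lemma rkhs_ext f g : (forall x, rk_fun H f x = rk_fun H g x) -> f = g.
Proof. by move=> h; apply: (@rk_fun_inj _ _ H); apply/funext. Qed.

Lemma dot_kcomb s f : dotp (kcomb s) f = lf (fun x => (rk_fun H f x)^*) s.
Proof.
rewrite /kcomb dot_gram; apply: eq_bigr => p _; congr (_ * _).
by rewrite dotC dot_kernel.
Qed.

Lemma rk_funD f g x : rk_fun H (f + g) x = rk_fun H f x + rk_fun H g x.
Proof. by rewrite linearD. Qed.
Lemma rk_funB f g x : rk_fun H (f - g) x = rk_fun H f x - rk_fun H g x.
Proof. by rewrite linearB. Qed.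
Lemma rk_funZ a f x : rk_fun H (a *: f) x = a * rk_fun H f x.
Proof. by rewrite linearZ. Qed.
Lemma rk_fun0 x : rk_fun H 0 x = 0.
Proof. by rewrite linear0. Qed.
Lemma rk_fun_sum (I : Type) (r : seq I) (P : pred I) (F : I -> H) x :
  rk_fun H (\sum_(i <- r | P i) F i) x = \sum_(i <- r | P i) rk_fun H (F i) x.
Proof.
by apply: (big_morph (fun f => rk_fun H f x) (fun f g => rk_funD f g x) (rk_fun0 x)).
Qed.

(** The functional defined by [h] on the span of the kernel functions is represented in H,
    and the values of the representative are read off at the kernel functions. *)
Lemma membership (h : X -> C) (c : R) : 0 <= c ->
  (forall s, modc (lf (fun x => (h x)^*) s) <= c * nm (kcomb s)) ->
  exists f, (forall x, rk_fun H f x = h x) /\ nm f <= c.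
Proof.
move=> c0 /(gram_riesz c0)[g [h1 h2 _]]; exists g; split=> // x.
by rewrite -dot_kernel dotC h1 conjCK.
Qed.

Lemma kcomb_dense f (eps : R) : 0 < eps -> exists s, nm (kcomb s - f) < eps.
Proof.
move=> e0; have [|g [h1 _ h3]] :=
    @gram_riesz R _ X (rk_kernel H) (fun x => (rk_fun H f x)^*) (nm f) (nm_ge0 _).
  by move=> s; rewrite -dot_kcomb mulrC dot_CS.
have -> : f = g.
  by apply: rkhs_ext => x; rewrite -[RHS]dot_kernel dotC h1 conjCK.
exact: h3.
Qed.

(** A kernel dominated by K has its kernel functions in H: by [psd_CS] they are
    functionals bounded by the form of [L], hence by the norm of H. *)
Lemma kernel_minorant (L : X -> X -> C) y : psd L ->
  (forall s, re (qf L s) <= re (qf K s)) ->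
  exists f, (forall x, rk_fun H f x = L x y) /\ nm f ^+ 2 <= re (L y y).
Proof.
move=> pL hL; have L0 := psd_diag_ge0 y pL.
have [|f [h1 h2]] := @membership (fun x => L x y) (Num.sqrt (re (L y y))) (sqrtr_ge0 _).
  move=> s; have := psd_CS y s pL.
  have -> : lf (fun x => (L x y)^*) s = lf (L y) s.
    by apply: eq_bigr => p _; rewrite -(psd_herm pL).
  move=> h; rewrite -(@ler_pXn2r _ 2) ?nnegrE ?modc_ge0 ?mulr_ge0 ?sqrtr_ge0 ?nm_ge0 //.
  rewrite exprMn sqr_sqrtr //; apply: le_trans h _; rewrite ler_wpM2l //.
  by have := hL s; rewrite qf_repkernel re_rc.
exists f; split=> //; rewrite -[leRHS]sqr_sqrtr //.
by rewrite ler_pXn2r ?nnegrE ?nm_ge0 ?sqrtr_ge0.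
Qed.

Lemma mulop_linear phi a f g : mulop phi (a *: f + g) = a *: mulop phi f + mulop phi g.
Proof.
by apply: rkhs_ext => x; rewrite mulopE !rk_funD !rk_funZ !mulopE; ring.
Qed.
Lemma mulop0 phi : mulop phi 0 = 0.
Proof. by apply: rkhs_ext => x; rewrite mulopE !rk_fun0 mulr0. Qed.
Lemma mulopZ phi a f : mulop phi (a *: f) = a *: mulop phi f.
Proof. by have := mulop_linear phi a f 0; rewrite mulop0 !addr0. Qed.
Lemma mulop_mul phi psi f : mulop (phi * psi) f = mulop phi (mulop psi f).
Proof. by apply: rkhs_ext => x; rewrite !mulopE mulrA. Qed.
Lemma mulop_comm phi psi f : mulop phi (mulop psi f) = mulop psi (mulop phi f).
Proof. by apply: rkhs_ext => x; rewrite !mulopE mulrCA. Qed.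
Lemma mulop_comb phi psi a f : mulop (a *: phi + psi) f = a *: mulop phi f + mulop psi f.
Proof.
apply: rkhs_ext => x; rewrite rk_funD rk_funZ !mulopE mulrA -mulrDl; congr (_ * _).
Qed.
Lemma mulop1 f : mulop 1 f = f.
Proof. by apply: rkhs_ext => x; rewrite mulopE mul1r. Qed.

Lemma dot_kcomb_mulop s phi f :
  dotp (kcomb s) (mulop phi f) = dotp (kcomb (scale phi s)) f.
Proof.
rewrite !dot_kcomb /lf /scale big_map; apply: eq_bigr => p _ /=.
by rewrite mulopE rmorphM mulrA.
Qed.

(** It is enough to bound the adjoint on the span of the kernel functions, where it
    multiplies coefficients. *)
Lemma multiplier_criterion (u : X -> C) (c : R) : 0 <= c ->
  (forall s, nm (kcomb (scale u s)) <= c * nm (kcomb s)) ->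
  exists phi : mult H, (forall x, phi x = u x) /\ forall f, nm (mulop phi f) <= c * nm f.
Proof.
move=> c0 hc.
have key f : exists g, (forall x, rk_fun H g x = u x * rk_fun H f x) /\ nm g <= c * nm f.
  apply: membership => [|s]; first by rewrite mulr_ge0 ?nm_ge0.
  have -> : lf (fun x => (u x * rk_fun H f x)^*) s = dotp (kcomb (scale u s)) f.
    rewrite dot_kcomb /lf /scale big_map; apply: eq_bigr => p _ /=.
    by rewrite rmorphM mulrA.
  apply: le_trans (dot_CS _ _) _; rewrite mulrAC ler_wpM2r ?nm_ge0 //.
have um : u \in multiplier H.
  apply/multiplierP => f; have [g [hg _]] := key f; exists g.
  by apply/funext => x; rewrite hg.
exists (Mult um); split=> // f; have [g [hg h]] := key f.
suff -> : mulop (Mult um) f = g by [].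
by apply: rkhs_ext => x; rewrite mulopE hg.
Qed.

(** Every multiplier is a bounded operator.  The vectors M_phi^* u, for u in the unit
    ball of the span of the kernels, are weakly bounded since <f, M_phi^* u> = <phi f, u>. *)
Lemma mult_bounded phi : exists2 c : R, 0 <= c & forall f, nm (mulop phi f) <= c * nm f.
Proof.
have [|M hM] := @weakly_bounded R (rkhs_hilbert H)
    [set v | exists2 s, v = kcomb (scale phi s) & nm (kcomb s) <= 1].
  move=> f; exists (nm (mulop phi f)) => _ [s -> hs].
  rewrite dotC modc_conj -dot_kcomb_mulop; apply: le_trans (dot_CS _ _) _.
  by rewrite ler_piMl ?nm_ge0.
have M0 : 0 <= M.
  apply: le_trans (nm_ge0 _) (hM _ (ex_intro2 _ _ [::] erefl _)).
  by rewrite /kcomb /gram big_nil nm0.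
exists (4 * M) => [|f]; first by rewrite mulr_ge0.
set g := mulop phi f; pose G := nm g.
have [g0|g0] := eqVneq G 0; first by rewrite -/G g0 mulr_ge0 ?nm_ge0 // mulr_ge0.
have G0 : 0 < G by rewrite lt_def g0 nm_ge0.
pose w : H := rc (2 * G)^-1 *: g.
have nw : nm w = 2^-1.
  rewrite nmZ modc_rc ger0_norm ?invr_ge0 ?mulr_ge0 ?(ltW G0) // -/G.
  by field.
have [|s hs] := @kcomb_dense w (4^-1); first by rewrite invr_gt0.
have n1 : nm (kcomb s) <= 1.
  have := nmD (kcomb s - w) w; rewrite subrK nw; lra.
have h1 : modc (dotp (kcomb s) g) <= M * nm f.
  rewrite /g dot_kcomb_mulop; apply: le_trans (dot_CS _ _) _.
  by rewrite ler_wpM2r ?nm_ge0 // hM //; exists s.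
have h2 : G / 2 - G / 4 <= modc (dotp (kcomb s) g).
  have e1 : re (dotp w g) = G / 2.
    by rewrite dotZl reMr -nm_sqr -/G; field.
  have e2 := re_dot_le (w - kcomb s) g.
  have e3 : nm (w - kcomb s) * nm g <= 4^-1 * G.
    by rewrite ler_wpM2r ?nm_ge0 // nm_distC ltW.
  have e4 := re_le_modc (dotp (kcomb s) g).
  rewrite dotBl reB e1 in e2; lra.
rewrite -/G; lra.
Qed.

Lemma dot_eq_dense f g : (forall x, dotp (rk_kernel H x) f = dotp (rk_kernel H x) g) -> f = g.
Proof.
by move=> h; apply: rkhs_ext => x; rewrite -!dot_kernel dotC h -dotC.
Qed.

(** The hypothesis says that the column of adjoints, extended by u |-> <u, one>, is a
    contraction on the span of the kernels; the conclusion is the dual statement for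
    the row.  Pairing with u and using 2 ab <= a^2 + b^2 termwise avoids square roots. *)
Lemma row_bound (N : nat) (b : nat -> mult H) (one : H) (f : nat -> H) (d : C) :
  (forall s, \sum_(i < N) nm (kcomb (scale (b i) s)) ^+ 2 +
     modc (dotp (kcomb s) one) ^+ 2 <= nm (kcomb s) ^+ 2) ->
  nm (\sum_(i < N) mulop (b i) (f i) + d *: one) ^+ 2 <=
    \sum_(i < N) nm (f i) ^+ 2 + modc d ^+ 2.
Proof.
move=> hrow; set g := (X in nm X).
apply: (@nm_le_approx _ _ g _ (fun u => exists s, u = kcomb s)).
  by move=> eps /(kcomb_dense g)[s hs]; exists (kcomb s) => //; exists s.
move=> _ [s ->]; have hs := hrow s.
rewrite /g dotDr dot_sumr dotZr reD re_sum.
have a1 : 2 * re (d^* * dotp (kcomb s) one) <= modc d ^+ 2 + modc (dotp (kcomb s) one) ^+ 2.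
  have := re_le_modc (d^* * dotp (kcomb s) one); rewrite modcM modc_conj.
  have := sqr_ge0 (modc d - modc (dotp (kcomb s) one)); rewrite sqrrB; lra.
have a2 : 2 * \sum_(i < N) re (dotp (kcomb s) (mulop (b i) (f i))) <=
   \sum_(i < N) nm (kcomb (scale (b i) s)) ^+ 2 + \sum_(i < N) nm (f i) ^+ 2.
  rewrite mulr_sumr -big_split /=; apply: ler_sum => i _.
  rewrite dot_kcomb_mulop; have := re_dot_le (kcomb (scale (b i) s)) (f i).
  have := sqr_ge0 (nm (kcomb (scale (b i) s)) - nm (f i)); rewrite sqrrB; lra.
lra.
Qed.

End ReproducingKernel.

(** * The McCullough-Quiggin theorem *)

(** Used with w_i = M_(b_i)^* u and T = sum_i b_i w_i: a row contraction has a
    contractive column of adjoints. *)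
Lemma row_dual_vec (R : realType) (V : hilbert R) (N : nat) (u T : V) (w : 'I_N -> V) :
  re (dotp u T) = \sum_i nm (w i) ^+ 2 -> nm T ^+ 2 <= \sum_i nm (w i) ^+ 2 ->
  \sum_i nm (w i) ^+ 2 <= nm u ^+ 2.
Proof.
set W := \sum_i _ => e1 h2.
have W0 : 0 <= W by apply: sumr_ge0 => i _; rewrite sqr_ge0.
have h1 := re_dot_le u T; rewrite e1 in h1.
have u0 := nm_ge0 u; have v0 := nm_ge0 T.
have h3 : W ^+ 2 <= nm u ^+ 2 * W.
  apply: (@le_trans _ _ ((nm u * nm T) ^+ 2)).
    by rewrite ler_pXn2r ?nnegrE // mulr_ge0.
  by rewrite exprMn ler_wpM2l // sqr_ge0.
have [->|W1] := eqVneq W 0; first by rewrite sqr_ge0.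
have {}W1 : 0 < W by rewrite lt_def W1.
by move: h3; rewrite expr2 ler_pM2r.
Qed.

Section McCulloughQuiggin.
Variables (R : realType) (X : Type) (H : rkhs R X).
Local Notation C := (R[i]).
Local Notation K := (repkernel H).

Lemma row_dual (N : nat) (b : 'I_N -> mult H) s :
  (forall f : 'I_N -> H, nm (\sum_i mulop (b i) (f i)) ^+ 2 <= \sum_i nm (f i) ^+ 2) ->
  \sum_i nm (kcomb H (scale (b i) s)) ^+ 2 <= nm (kcomb H s) ^+ 2.
Proof.
move=> hb; apply: row_dual_vec (hb _).
rewrite dot_sumr re_sum; apply: eq_bigr => i _.
by rewrite dot_kcomb_mulop -nm_sqr.
Qed.

(** Compress a row contraction to the orthogonal complement of K_y.  The adjoints preserve
    the line of K_y, so the adjoints of the compressions still multiply coefficients,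
    now of the vectors whose Gram kernel is the Schur complement. *)
Lemma row_schur_psd (N : nat) (b : 'I_N -> mult H) (y : X) : K y y != 0 ->
  (forall f : 'I_N -> H, nm (\sum_i mulop (b i) (f i)) ^+ 2 <= \sum_i nm (f i) ^+ 2) ->
  psd (fun x x' => schur K y x x' * (1 - \sum_i b i x * (b i x')^*)).
Proof.
move=> k0 hb; have pK := psd_repkernel H; have pS := psd_schur y pK.
split=> [x x'|s].
  rewrite (psd_herm pS x) rmorphM /=; congr (_ * _).
  rewrite rmorphB /= conjC1 rmorph_sum /=; congr (_ - _); apply: eq_bigr => i _.
  by rewrite rmorphM /= conjCK mulrC.
have -> : qf (fun x x' => schur K y x x' * (1 - \sum_i b i x * (b i x')^*)) s =
   qf (schur K y) s - \sum_i qf (schur K y) (scale (b i) s).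
  under [X in _ - X]eq_bigr do rewrite -qf_scale.
  rewrite -qf_sum -qfB; congr qf; apply/funext => x; apply/funext => x'.
  rewrite mulrBr mulr1 mulr_sumr; congr (_ - _); apply: eq_bigr => i _; ring.
rewrite reB re_sum subr_ge0.
(* the component of s orthogonal to the kernel at y *)
pose s' := (- lf (K y) s / K y y, y) :: s.
apply: (@le_trans _ _ (\sum_i nm (kcomb H (scale (b i) s')) ^+ 2)).
  apply: ler_sum => i _.
  apply: le_trans (schur_cons_le y (- lf (K y) s / K y y * (b i y)^*) _ pK) _.
  by rewrite qf_repkernel re_rc.
apply: le_trans (row_dual _ hb) _.
by rewrite schur_cons_eq // qf_repkernel re_rc.
Qed.

(** 1 - 1/K after normalizing K at the point [y]. *)
Definition base_kernel (y x x' : X) : C := 1 - K x y * K y x' / (K y y * K x x').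

Hypothesis K0 : forall x y, K x y != 0.

Lemma schur_base y x x' : schur K y x x' = K x x' * base_kernel y x x'.
Proof.
rewrite /schur /base_kernel; field.
by rewrite !K0.
Qed.

Definition below (n : nat) (i : nat) : C := (i < n)%:R.

Lemma conj_below n i : (below n i)^* = below n i.
Proof. by rewrite /below rmorph_nat. Qed.

(** The Pick matrix of target matrices whose only nonzero row is the first one: it is [l]
    in the first coordinate and [k] in the others. *)
Lemma psd_block_indicator (r : nat) (Y : Type) (k l : Y -> Y -> C) : psd k -> psd l ->
  psd (fun a b : Y * 'I_r.+1 => k a.1 b.1 * (a.2 == b.2)%:R
     - (a.2 == ord0)%:R * (b.2 == ord0)%:R * (k a.1 b.1 - l a.1 b.1)).
Proof.
move=> pk pl.
have p1 : psd (fun a b : Y * 'I_r.+1 => k a.1 b.1 *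
    \sum_(t < r.+1) (a.2 == t)%:R * (t != ord0)%:R * ((b.2 == t)%:R * (t != ord0)%:R)^*).
  apply: psd_mul; first exact: (psd_comp fst pk).
  by apply: psd_sum => t; apply: (psd_rank1 (fun a : Y * 'I_r.+1 => (a.2 == t)%:R * (t != ord0)%:R)).
have p2 : psd (fun a b : Y * 'I_r.+1 =>
     (a.2 == ord0)%:R * l a.1 b.1 * ((b.2 == ord0)%:R)^*).
  exact: (psd_scale (fun a : Y * 'I_r.+1 => (a.2 == ord0)%:R) (psd_comp fst pl)).
apply: (psd_ext _ (psdD p1 p2)) => -[x p] [x' q] /=.
have -> : \sum_(t < r.+1) ((p == t)%:R * (t != ord0)%:R *
   ((q == t)%:R * (t != ord0)%:R)^*) = (p == q)%:R * (p != ord0)%:R :> C.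
  rewrite (bigD1 p) //= eqxx mul1r big1 ?addr0.
    rewrite rmorphM /= !rmorph_nat (eq_sym q).
    by case: (p == q); case: (p == ord0) => /=; ring.
  by move=> t tp; rewrite eq_sym (negbTE tp) !mul0r.
rewrite rmorph_nat; case: (eqVneq p q) => [->|pq].
  by case: (q == ord0) => /=; ring.
case: (eqVneq p ord0) => [p0|p0] /=; case: (eqVneq q ord0) => [q0|q0] /=; try ring.
by rewrite p0 q0 eqxx in pq.
Qed.

Hypothesis pick : complete_pick H.

(** A row-valued Pick problem, solved by matrices that vanish outside their first row;
    the first row of a contractive matrix of multipliers is a row contraction. *)
Lemma pick_row (n : nat) (z : 'I_n.+1 -> X) (G : 'I_n.+1 -> 'I_n.+1 -> C)
    (ph : 'I_n.+1 -> 'I_n.+1 -> C) :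
  (forall i j, G i j = \sum_t ph t i * (ph t j)^*) ->
  psd (fun i j => K (z i) (z j) * (1 - G i j)) ->
  exists b : 'I_n.+1 -> mult H,
    (forall f : 'I_n.+1 -> H, nm (\sum_i mulop (b i) (f i)) ^+ 2 <= \sum_i nm (f i) ^+ 2)
    /\ forall t i, b t (z i) = ph t i.
Proof.
move=> hG pG.
pose L (i : 'I_n.+1) : 'M[C]_n.+1 := \matrix_(p, q) (if p == ord0 then ph q i else 0).
have LL i j : L i *m ((L j) ^t*)%sesqui =
   \matrix_(p, q) ((p == ord0)%:R * (q == ord0)%:R * G i j).
  apply/matrixP => p q; rewrite !mxE hG.
  rewrite mulr_sumr; apply: eq_bigr => t _; rewrite !mxE.
  by case: (p == ord0); case: (q == ord0); rewrite /= ?rmorph0 ?mulr0 ?mul0r ?mulr1 ?mul1r.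
have [|Phi [cPhi vPhi]] := @pick n.+1 n.+1 isT isT z L.
  move=> v.
  have pk := psd_block_indicator n (psd_comp z (psd_repkernel H)) pG.
  set k := (fun a b : 'I_n.+1 * 'I_n.+1 => _) in pk.
  set A := \mxblock_(i, j) _.
  pose s := [seq (v l 0, (tagnat.sig1 l, tagnat.sig2 l)) | l <- enum 'I_(\sum_(i < n.+1) n.+1)].
  suff -> : (v ^t* *m A *m v)%sesqui 0 0 = qf k s.
    by rewrite psd_qf_real // -rc0 rc_le psd_ge0.
  rewrite /qf big_map big_enum mxE; apply: eq_bigr => l _.
  rewrite big_map big_enum mxE mulr_suml; apply: eq_bigr => m _ /=.
  rewrite /A [(\mxblock_(_, _) _) _ _]mxE LL !mxE /k /=; ring.
exists (fun t => Phi ord0 t); split=> [f|t i].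
  have := cPhi f; rewrite big_ord_recl => h.
  have {}h : `|\sum_j mulop (Phi ord0 j) (f j)| ^+ 2 <= \sum_j `|f j| ^+ 2.
    apply: le_trans h; rewrite lerDl; apply: sumr_ge0 => i _.
    exact: exprn_ge0.
  move: h; have -> : \sum_j `|f j| ^+ 2 = rc (\sum_j nm (f j : rkhs_hilbert H) ^+ 2).
    rewrite /rc rmorph_sum; apply: eq_bigr => j _.
    by rewrite (norm_nm (f j : rkhs_hilbert H)) -rcX.
  by rewrite (norm_nm (_ : rkhs_hilbert H)) -rcX rc_le.
by have /matrixP/(_ ord0 t) := vPhi i; rewrite !mxE eqxx.
Qed.

(** Induction on the number of points, with the base point free.  Let x1 be the last
    point.  By induction the kernel G normalized at x1 is positive semidefinite on the
    other points, and its row at x1 is zero, so G(i, j) = L_i L_j^* for row vectors L_i.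
    The Pick kernel K (1 - G) = K(., x1) K(x1, .) / K(x1, x1) has rank one, so there
    is a row contraction with values L_i.  Compressing it away from K_y
    ([row_schur_psd]) leaves (base kernel at y) * K(., x1) K(x1, .) / K(x1, x1), and
    the rank-one factor can be scaled away. *)
Lemma base_kernel_points (n : nat) (z : nat -> X) (y : X) :
  psd (fun i j : nat => below n i * base_kernel y (z i) (z j) * (below n j)^*).
Proof.
elim: n y => [|n IH] y.
  apply: (psd_ext _ (psd_rank1 (fun=> 0))) => i j.
  by rewrite /below !ltn0 !mul0r.
pose x1 := z n.
pose G i j : C := below n i * base_kernel x1 (z i) (z j) * (below n j)^*.
have pG : psd G by exact: IH.
have bz j : base_kernel x1 x1 (z j) = 0.
  by rewrite /base_kernel divff ?subrr // mulf_neq0.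
have bz' i : base_kernel x1 (z i) x1 = 0.
  by rewrite /base_kernel [K x1 x1 * _]mulrC divff ?subrr // mulf_neq0.
have GE i j : (i < n.+1)%N -> (j < n.+1)%N -> G i j = base_kernel x1 (z i) (z j).
  rewrite /G conj_below /below !ltnS => hi hj.
  have [ni|ni] := ltnP i n; last first.
    have -> : i = n by apply/eqP; rewrite eqn_leq hi ni.
    by rewrite -/x1 bz mulr0 mul0r.
  have [nj|nj] := ltnP j n; first by rewrite mulr1 mul1r.
  have -> : j = n by apply/eqP; rewrite eqn_leq hj nj.
  by rewrite -/x1 bz' mulr0.
pose ph (t i : 'I_n.+1) := chol G id t i.
have [||b [hb bv]] := @pick_row n z (fun i j => G i j) ph.
- move=> i j; rewrite /ph.
  by have := chol_sum id pG n.+1 i j; rewrite chol_rest0 // subr0.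
- have := psd_scale (fun i : 'I_n.+1 => K (z i) x1 / rc (Num.sqrt (re (K x1 x1))))
     (@psd_cst1 R 'I_n.+1).
  apply: psd_ext => i j; rewrite GE // /base_kernel fmorph_div /= conj_rc.
  have pK := psd_repkernel H; rewrite -(psd_herm pK) mulr1 mulrACA -invfM -rcM -expr2.
  rewrite sqr_sqrtr ?psd_diag_ge0 // -psd_diag //; field.
  by rewrite !K0.
have := psd_comp z (row_schur_psd (K0 y y) hb).
(* divides out the rank-one factor left by the Pick kernel *)
move=> /(psd_scale (fun i => below n.+1 i * rc (Num.sqrt (re (K x1 x1))) / K (z i) x1)).
apply: psd_ext => i j.
have [ni|ni] := ltnP i n.+1; last by rewrite /below ltnNge ni /= !mul0r.
have [nj|nj] := ltnP j n.+1; last first.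
  by rewrite [below n.+1 j]/below ltnNge nj /= !mul0r rmorph0 !mulr0.
have -> : \sum_t b t (z i) * (b t (z j))^* = base_kernel x1 (z i) (z j).
  have e := chol_sum id pG n.+1 i j; rewrite chol_rest0 // subr0 in e.
  rewrite -GE // -e.
  apply: eq_bigr => t _.
  by rewrite -[z i]/(z (Ordinal ni)) -[z j]/(z (Ordinal nj)) !bv.
rewrite schur_base fmorph_div /= rmorphM /= conj_rc !conj_below /below ni nj !mul1r mulr1.
have pK := psd_repkernel H; rewrite -(psd_herm pK).
set q := rc _.
have qq : q * q = K x1 x1.
  by rewrite /q -rcM -expr2 sqr_sqrtr ?psd_diag_ge0 // -psd_diag.
have -> : 1 - base_kernel x1 (z i) (z j) = K (z i) x1 * K x1 (z j) / (q * q * K (z i) (z j)).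
  by rewrite /base_kernel qq; ring.
have q0 : q != 0 by apply: contra_neq (K0 x1 x1) => q0; rewrite -qq q0 mul0r.
by field; rewrite !K0 q0.
Qed.

Theorem psd_base_kernel (y : X) : psd (base_kernel y).
Proof.
have pK := psd_repkernel H; split=> [x x'|].
  rewrite /base_kernel rmorphB /= conjC1 fmorph_div /= !rmorphM /= -!(psd_herm pK).
  by rewrite [K y x * _]mulrC.
case=> [|p0 s']; first by rewrite /qf big_nil re0.
set s := p0 :: s'; pose z n := (nth p0 s n).2.
have := psd_ge0 [seq ((nth p0 s n).1, n) | n <- iota 0 (size s)]
   (base_kernel_points (size s) z y).
congr (0 <= re _); rewrite /qf big_map [RHS](big_nth p0) /index_iota subn0.
rewrite big_seq [RHS]big_seq; apply: eq_bigr => m; rewrite mem_iota add0n => /andP[_ hm].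
rewrite big_map [RHS](big_nth p0) /index_iota subn0.
rewrite big_seq [RHS]big_seq; apply: eq_bigr => l; rewrite mem_iota add0n => /andP[_ hl].
by rewrite /= conj_below /below hm hl mul1r mulr1.
Qed.

End McCulloughQuiggin.

(** * Coordinate multipliers and joint eigenvectors *)

(** The Cauchy-Schwarz inequality for the form of [k] as positivity of a kernel, ready
    for Schur products. *)
Lemma psd_CS_kernel (R : realType) (Y : Type) (k : Y -> Y -> R[i]) c : psd k ->
  psd (fun x y => rc (re (k c c)) * k x y - k x c * (k y c)^*).
Proof.
move=> pk; have hk := psd_herm pk; split=> [x y|s].
  by rewrite rmorphB !rmorphM /= conjCK conj_rc -(hk x y) [k y c * _]mulrC.
rewrite qfB qfZ reB reMr (qf_rank1 (k^~ c)) re_rc subr_ge0.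
have -> : lf (fun y => (k y c)^*) s = lf (k c) s.
  by apply: eq_bigr => p _; rewrite -hk.
exact: psd_CS.
Qed.

Section BallCoordinateMultipliers.
Variables (R : realType) (X : Type) (H : rkhs R X).
Local Notation C := (R[i]).
Local Notation K := (repkernel H).
Variables (beta : X -> nat -> C) (F : X -> X -> C) (one : H).
Hypothesis F_series : forall x y,
  tendsto (fun N => \sum_(i < N) beta x i * (beta y i)^*) (F x y).
Hypothesis K_F : forall x y, K x y * (1 - F x y) = 1.
Hypothesis one1 : forall x, rk_fun H one x = 1.

Lemma K_subr1 x y : F x y * K x y = K x y - 1.
Proof. by rewrite -[X in _ = _ - X](K_F x y); ring. Qed.

Definition tail N x y := F x y - \sum_(i < N) beta x i * (beta y i)^*.

Lemma psd_tail N : psd (tail N).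
Proof.
apply: (@psd_limit _ _ (fun M x y => \sum_(N <= i < N + M) beta x i * (beta y i)^*)).
  by move=> M; apply: psd_sum => i; apply: (psd_rank1 (beta^~ i)).
move=> x y e e0; have [M hM] := F_series x y e0; exists M => n hn.
have -> : \sum_(N <= i < N + n) beta x i * (beta y i)^* - tail N x y =
   \sum_(i < N + n) beta x i * (beta y i)^* - F x y.
  rewrite /tail -!(big_mkord xpredT (fun i => beta x i * (beta y i)^*)).
  rewrite [in RHS](big_cat_nat _ (leq_addr n N)) //=; ring.
by apply: hM; rewrite (leq_trans hn) // leq_addl.
Qed.

Lemma psd_F : psd F.
Proof. by apply: (psd_ext _ (psd_tail 0)) => x y; rewrite /tail big_ord0 subr0. Qed.

Lemma dot_one s : dotp (kcomb H s) one = lf (fun=> 1) s.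
Proof.
by rewrite dot_kcomb; apply: eq_bigr => p _; rewrite one1 rmorph1.
Qed.

(** The identity sum_i M_(b_i) M_(b_i)^* = 1 - <., 1> 1 at stage [N], as an identity of
    quadratic forms with its remainder. *)
Lemma row_defect N s : \sum_(i < N) nm (kcomb H (scale (beta^~ i) s)) ^+ 2 +
   modc (dotp (kcomb H s) one) ^+ 2 + re (qf (fun x y => tail N x y * K x y) s)
   = nm (kcomb H s) ^+ 2.
Proof.
rewrite -[RHS]re_rc -qf_repkernel.
have -> : qf K s = \sum_(i < N) qf (fun x y => beta x i * K x y * (beta y i)^*) s +
    qf (fun x y => 1 * (1 : C)^*) s + qf (fun x y => tail N x y * K x y) s.
  rewrite -qf_sum -!qfD; congr qf; apply/funext => x; apply/funext => y.
  rewrite /tail mulrBl K_subr1 mulr_suml rmorph1 mulr1.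
  under eq_bigr do rewrite mulrAC.
  ring.
rewrite !reD (qf_rank1 (fun=> 1)) re_rc dot_one; congr (_ + modc _ ^+ 2 + _).
  by rewrite re_sum; apply: eq_bigr => i _; rewrite qf_scale qf_repkernel re_rc.
by apply: eq_bigr => p _; rewrite rmorph1.
Qed.

Lemma coord_row N s : \sum_(i < N) nm (kcomb H (scale (beta^~ i) s)) ^+ 2 +
   modc (dotp (kcomb H s) one) ^+ 2 <= nm (kcomb H s) ^+ 2.
Proof.
rewrite -(row_defect N s) lerDl; apply: psd_ge0; apply: psd_mul (psd_tail N) _.
exact: psd_repkernel.
Qed.

Lemma coord_mult_exists : exists B : nat -> mult H,
  (forall i x, B i x = beta x i) /\ forall i f, nm (mulop (B i) f) <= nm f.
Proof.
have ex i : exists b : mult H, (forall x, b x = beta x i) /\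
    forall f, nm (mulop b f) <= 1 * nm f.
  apply: multiplier_criterion => // s; rewrite mul1r.
  rewrite -(@ler_pXn2r _ 2) ?nnegrE ?nm_ge0 //; have := coord_row i.+1 s.
  rewrite big_ord_recr /=.
  have : 0 <= \sum_(j < i) nm (kcomb H (scale (beta^~ j) s)) ^+ 2.
    by apply: sumr_ge0 => j _; rewrite sqr_ge0.
  by have := sqr_ge0 (modc (dotp (kcomb H s) one)); lra.
have [B hB] := choice ex; exists B; split=> i x; first by case: (hB i).
by case: (hB i) => _ /(_ x); rewrite mul1r.
Qed.

Lemma K_diag_gt0 y : 0 < re (K y y).
Proof.
have pK := psd_repkernel H; rewrite lt_def psd_diag_ge0 // andbT.
apply/negP => /eqP h; have := K_F y y; rewrite (psd_diag y pK) h mul0r => /eqP.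
by rewrite eq_sym oner_eq0.
Qed.

Lemma F_diag_lt1 y : re (F y y) < 1.
Proof.
have pK := psd_repkernel H; have := K_F y y.
rewrite (psd_diag y pK) (psd_diag y psd_F) -rc1 -rcB -rcM => /(@rc_inj R) h.
have := K_diag_gt0 y; move: h; move: (re (K y y)) (re (F y y)) => a b h a0.
rewrite -subr_gt0 -(pmulr_rgt0 _ a0) h //.
Qed.

Definition F_norm y : R := Num.sqrt (re (F y y)).

Lemma F_norm_lt1 y : 0 <= F_norm y < 1.
Proof.
rewrite sqrtr_ge0 /= -(@ltr_pXn2r _ 2) ?nnegrE ?sqrtr_ge0 ?ler01 // expr1n.
by rewrite sqr_sqrtr ?F_diag_lt1 // psd_diag_ge0 //; exact: psd_F.
Qed.

(** F(., y) is a multiplier of norm at most |j y|: multiply the positive kernel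
    F(y, y) F(x, x') - F(x, y) F(y, x') by K, and use F K = K - 1. *)
Lemma F_scale_bound y s : nm (kcomb H (scale (F^~ y) s)) <= F_norm y * nm (kcomb H s).
Proof.
have /andP[r0 _] := F_norm_lt1 y.
rewrite -(@ler_pXn2r _ 2) ?nnegrE ?mulr_ge0 ?nm_ge0 // exprMn.
rewrite sqr_sqrtr; last by apply: psd_diag_ge0; exact: psd_F.
have := psd_ge0 s (psd_mul (psd_CS_kernel y psd_F) (psd_repkernel H)).
have -> : qf (fun x x' => (rc (re (F y y)) * F x x' - F x y * (F x' y)^*) * K x x') s =
   rc (re (F y y)) * qf (fun x x' => F x x' * K x x') s -
   qf (fun x x' => F x y * K x x' * (F x' y)^*) s.
  rewrite -qfZ -qfB; congr qf; apply/funext => x; apply/funext => x'; ring.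
rewrite (qf_scale (F^~ y)) qf_repkernel reB reMr re_rc.
have h0 := psd_diag_ge0 y psd_F.
have h1 : re (qf (fun x x' => F x x' * K x x') s) <= nm (kcomb H s) ^+ 2.
  rewrite -(row_defect 0 s) big_ord0 add0r; set a := modc _ ^+ 2.
  have -> : (fun x y0 => tail 0 x y0 * K x y0) = (fun x y0 => F x y0 * K x y0).
    by apply/funext => x; apply/funext => x'; rewrite /tail big_ord0 subr0.
  by rewrite lerDr sqr_ge0.
have := ler_wpM2l h0 h1; lra.
Qed.

Lemma F_mult y : exists2 psi : mult H, (forall x, psi x = F x y) &
  forall f, nm (mulop psi f) <= F_norm y * nm f.
Proof.
have /andP[r0 _] := F_norm_lt1 y.
by have [psi [h1 h2]] := multiplier_criterion r0 (F_scale_bound y); exists psi.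
Qed.

(** K_y inverts 1 - F(., y), which is bounded below because F(., y) is a strict
    contraction. *)
Lemma kernel_mult y : exists kap : mult H, forall x, kap x = K x y.
Proof.
have /andP[r0 r1] := F_norm_lt1 y.
have r2 : 0 < 1 - F_norm y by rewrite subr_gt0.
have [||kap [h _]] := @multiplier_criterion R X H (K^~ y) (1 - F_norm y)^-1.
- by rewrite invr_ge0 ltW.
- move=> s; set s' := scale (K^~ y) s.
  rewrite mulrC ler_pdivlMr //.
  (* s is s' scaled by 1 - F(., y), since this function times K(., y) is 1 *)
  have -> : kcomb H s = kcomb H s' - kcomb H (scale (F^~ y) s').
    rewrite /kcomb /gram /s' /scale !big_map -sumrB; apply: eq_bigr => p _ /=.
    rewrite -scalerBl; congr (_ *: _).
    rewrite -{1}[p.1]mulr1 -{1}(rmorph1 Num.conj) -(K_F p.2 y) rmorphM rmorphB /= rmorph1.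
    ring.
  have := nmD (kcomb H s' - kcomb H (scale (F^~ y) s')) (kcomb H (scale (F^~ y) s')).
  by rewrite subrK; have := F_scale_bound y s'; lra.
by exists kap.
Qed.

Section WithCoordinates.
Variable B : nat -> mult H.
Hypothesis B_beta : forall i x, B i x = beta x i.
Implicit Types (f g h : H).
Local Notation ker := (rk_kernel H).

(** K_y - 1 = sum_i conj(b_i(y)) b_i K_y, in norm.  The remainder is the kernel function
    at y of a kernel below K ([kernel_minorant]), so its norm is controlled by the
    diagonal. *)
Lemma kernel_expansion y (e : R) : 0 < e -> exists N0, forall N, (N0 <= N)%N ->
  nm (ker y - one - \sum_(i < N) (beta y i)^* *: mulop (B i) (ker y)) < e.
Proof.
move=> e0; have k0 := K_diag_gt0 y; have pK := psd_repkernel H.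
have [N0 hN] := F_series y y (divr_gt0 (exprn_gt0 2 e0) k0).
exists N0 => N /hN h.
have pL := psd_mul (psd_tail N) pK.
have [|f [fE fn]] := @kernel_minorant R X H _ y pL.
  move=> s; rewrite qf_repkernel re_rc -(row_defect N s) lerDr addr_ge0 ?sqr_ge0 //.
  by apply: sumr_ge0 => i _; rewrite sqr_ge0.
have -> : ker y - one - \sum_(i < N) (beta y i)^* *: mulop (B i) (ker y) = f.
  apply: rkhs_ext => x; rewrite fE !rk_funB one1 rk_fun_sum.
  have -> : rk_fun H (ker y) x = K x y by [].
  rewrite /tail mulrBl K_subr1; congr (_ - _); rewrite mulr_suml.
  apply: eq_bigr => i _; by rewrite rk_funZ mulopE B_beta [LHS]mulrCA [LHS]mulrA.
rewrite -(@ltr_pXn2r _ 2) ?nnegrE ?nm_ge0 ?(ltW e0) //; apply: le_lt_trans fn _.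
have h2 : re (tail N y y) < e ^+ 2 / re (K y y).
  apply: le_lt_trans h; apply: le_trans (re_le_modc _) _.
  by rewrite /tail modc_distC.
rewrite (psd_diag y pK) mulrC reMr mulrC -ltr_pdivlMr //.
Qed.

Lemma eigen_kernel (l : nat -> C) g y :
  (forall i, dotp (mulop (B i) (ker y)) g = l i * dotp (ker y) g) ->
  tendsto (fun N => (\sum_(i < N) l i * (beta y i)^*) * dotp (ker y) g)
     (dotp (ker y) g - dotp one g).
Proof.
move=> hl e e0; have n1 : 0 < nm g + 1 by rewrite ltr_wpDl ?nm_ge0.
have [N0 hN] := kernel_expansion y (divr_gt0 e0 n1); exists N0 => N /hN.
rewrite ltr_pdivlMr // => h.
set v := ker y - one - _ in h.
have -> : (\sum_(i < N) l i * (beta y i)^*) * dotp (ker y) g -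
  (dotp (ker y) g - dotp one g) = - dotp v g.
  rewrite /v !dotBl dot_suml mulr_suml [RHS]opprB; congr (_ - _).
  by apply: eq_bigr => i _; rewrite dotZl hl mulrAC mulrC.
rewrite modcN; apply: le_lt_trans (dot_CS _ _) _; apply: le_lt_trans h.
by rewrite ler_wpM2l ?nm_ge0 // lerDl.
Qed.

(** By [eigen_kernel], conj(g(y)) (1 - sum_i l_i conj(b_i(y))) = <1, g>.  As <1, g> = 1
    for one eigenvector, the factor in parentheses is not 0, and the values of every
    other eigenvector are fixed up to one common constant. *)
Lemma eigen_one_dim (l : nat -> C) g g' : dotp one g = 1 ->
  (forall i y, dotp (mulop (B i) (ker y)) g = l i * dotp (ker y) g) ->
  (forall i y, dotp (mulop (B i) (ker y)) g' = l i * dotp (ker y) g') ->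
  forall h, dotp h g' = dotp one g' * dotp h g.
Proof.
move=> g1 hg hg'.
suff e : g' = (dotp one g')^* *: g by move=> h; rewrite {1}e dotZr conjCK.
apply: dot_eq_dense => y; rewrite dotZr conjCK.
have t := eigen_kernel (fun i => hg i y); have t' := eigen_kernel (fun i => hg' i y).
set G := dotp (ker y) g in t *; set G' := dotp (ker y) g' in t' *.
have G0 : G != 0.
  apply/negP => /eqP G0; rewrite G0 g1 in t.
  have : tendsto (fun N => (\sum_(i < N) l i * (beta y i)^*) * 0) (0 : C).
    by have := tendsto_cst (0 : C); congr tendsto; apply/funext => N; rewrite mulr0.
  by move=> /(tendsto_uniq t)/eqP; rewrite sub0r oppr_eq0 oner_eq0.
have := tendstoZ (G' / G) t.
have -> : (fun N => G' / G * ((\sum_(i < N) l i * (beta y i)^*) * G)) =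
   (fun N => (\sum_(i < N) l i * (beta y i)^*) * G').
  by apply/funext => N; field.
move=> /(tendsto_uniq t'); rewrite g1 => h.
have {}h : G' - dotp one g' = G' - G' / G by rewrite h; field.
have h3 : dotp one g' = G' / G by apply: oppr_inj; apply: (addrI G').
by rewrite h3 divfK.
Qed.

Lemma mult_adjoint (phi : mult H) g : exists g', forall h, dotp h g' = dotp (mulop phi h) g.
Proof.
have [c c0 hc] := mult_bounded phi.
have [||||g' [h1 _ _]] := @riesz_rel R (rkhs_hilbert H)
    (fun h x => x = dotp (mulop phi h) g) (c * nm g).
- by rewrite mulr_ge0 ?nm_ge0.
- by rewrite mulop0 dot0l.
- by move=> a u v x y -> ->; rewrite mulop_linear dotDl dotZl.
- move=> u x ->; apply: le_trans (dot_CS _ _) _.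
  by rewrite mulrAC ler_wpM2r ?nm_ge0.
by exists g' => h; apply: h1.
Qed.

(** Multipliers commute with the coordinate multipliers, so their adjoints
    preserve the joint eigenspace, which is one-dimensional. *)
Lemma eigen_pm (l : nat -> C) g : dotp one g = 1 ->
  (forall i h, dotp (mulop (B i) h) g = l i * dotp h g) ->
  forall phi h, dotp (mulop phi h) g = dotp (mulop phi one) g * dotp h g.
Proof.
move=> g1 hg phi h; have [g' hg'] := mult_adjoint phi g.
rewrite -!hg'; apply: (@eigen_one_dim l) => // i y.
by rewrite !hg' mulop_comm hg.
Qed.

(** The row inequality for f_i = conj(l_i) g and the constant 1, paired with g. *)
Lemma pm_eigen_bound g : dotp one g = 1 ->
  (forall phi h, dotp (mulop phi h) g = dotp (mulop phi one) g * dotp h g) ->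
  forall N, (\sum_(i < N) modc (dotp (mulop (B i) one) g) ^+ 2) * nm g ^+ 2 <= nm g ^+ 2 - 1.
Proof.
move=> g1 hg N; pose l i := dotp (mulop (B i) one) g.
set s := \sum_(i < N) _.
have s0 : 0 <= s by apply: sumr_ge0 => i _; rewrite sqr_ge0.
have := @row_bound R X H N B one (fun i => (l i)^* *: g) 1.
set v := (X in nm X); move=> hv.
have {}hv : nm v ^+ 2 <= s * nm g ^+ 2 + 1.
  have e : s * nm g ^+ 2 = \sum_(i < N) nm ((l i)^* *: g) ^+ 2.
    by rewrite /s mulr_suml; apply: eq_bigr => i _; rewrite nmZ modc_conj exprMn.
  rewrite e; move: hv; rewrite modc1 expr1n; apply => u.
  have := coord_row N u; congr (_ + _ <= _); apply: eq_bigr => i _.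
  by do 4!f_equal; apply/funext => x; rewrite B_beta.
have e2 : re (dotp v g) = s * nm g ^+ 2 + 1.
  rewrite /v dotDl dot_suml reD re_sum dotZl g1 mulr1 re1; congr (_ + _).
  rewrite /s mulr_suml; apply: eq_bigr => i _.
  by rewrite mulopZ dotZl hg -/(l i) mulrA [_^* * _]mulrC mulcJ reMr nm_sqr.
have h := re_dot_le v g; rewrite e2 in h.
set T := s * nm g ^+ 2 + 1 in hv h *.
have T0 : 0 < T by rewrite /T ltr_wpDl // mulr_ge0 // sqr_ge0.
have : T ^+ 2 <= T * nm g ^+ 2.
  apply: (@le_trans _ _ ((nm v * nm g) ^+ 2)).
    by rewrite ler_pXn2r ?nnegrE ?(ltW T0) // mulr_ge0 ?nm_ge0.
  by rewrite exprMn ler_wpM2r ?sqr_ge0.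
by rewrite expr2 ler_pM2l // /T; lra.
Qed.

End WithCoordinates.
End BallCoordinateMultipliers.

(** * Embeddings, varieties and algebraic consistency *)

Section Embeddings.
Variable R : realType.
Local Notation C := (R[i]).

Lemma drury_arveson_inv m (z w : ball_of R m) :
  drury_arveson_kernel z w * (1 - coord_dot (sval z) (sval w)) = 1.
Proof. by rewrite mulVf // one_sub_neq0 // coord_dot_lt1. Qed.

Lemma drury_arveson_inj m (z w z' w' : ball_of R m) :
  drury_arveson_kernel z w = drury_arveson_kernel z' w' ->
  coord_dot (sval z) (sval w) = coord_dot (sval z') (sval w').
Proof. by move=> /invr_inj/addrI/oppr_inj. Qed.

Lemma ball_eq_dot m (z w : ball_of R m) :
  coord_dot (sval z) (sval z) = coord_dot (sval w) (sval z) ->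
  coord_dot (sval z) (sval w) = coord_dot (sval w) (sval w) -> z = w.
Proof.
move=> h1 h2.
have : ball_vec z - ball_vec w = 0.
  apply: nm_eq0; apply/eqP; rewrite -sqrf_eq0; apply/eqP.
  rewrite nm_sqr dotBl !dotBr !ball_vec_dot h1 h2.
  by rewrite !subrr.
move=> /subr0_eq h; apply: zeta_inj => i.
have : l2_val (ball_vec z) i = l2_val (ball_vec w) i by rewrite h.
by move=> /= /(can_inj (@conjCK _)).
Qed.

Section OneSpace.
Variables (X : Type) (H : rkhs R X) (m : option nat) (j : X -> ball_of R m).
Hypothesis jH : embedding H j.
Local Notation K := (repkernel H).

Definition emb_F x y : C := coord_dot (sval (j x)) (sval (j y)).
Definition emb_beta x i : C := zeta (j x) i.

Lemma emb_F_series x y :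
  tendsto (fun N => \sum_(i < N) emb_beta x i * (emb_beta y i)^*) (emb_F x y).
Proof. exact: zeta_dot. Qed.

Lemma emb_K_F x y : K x y * (1 - emb_F x y) = 1.
Proof. by rewrite (jH.2 x y) drury_arveson_inv. Qed.

Lemma emb_coords (one : H) : (forall x, rk_fun H one x = 1) ->
  exists B : nat -> mult H, forall i x, B i x = emb_beta x i.
Proof.
move=> one1.
by have [B [hB _]] := coord_mult_exists emb_F_series emb_K_F one1; exists B.
Qed.

Lemma elt_mulop (one : H) (phi : mult H) : (forall x, rk_fun H one x = 1) ->
  elt H phi = mulop phi one.
Proof.
move=> one1; rewrite -[RHS]rk_funK; congr elt.
by apply/funext => x; rewrite mulopE one1 mulr1.
Qed.

(** The Riesz representatives of partially multiplicative functionals. *)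
Definition pm_vector (one g : H) := dotp one g = 1 /\
  forall phi h, dotp (mulop phi h) g = dotp (mulop phi one) g * dotp h g.

Lemma pm_riesz (one : H) (rho : H -> C) : (forall x, rk_fun H one x = 1) ->
  linear rho -> (exists M : C, forall f, `|rho f| <= M * `|f|) ->
  (exists f, rho f != 0) -> partially_multiplicative rho ->
  exists g, pm_vector one g /\ forall f, rho f = dotp f g.
Proof.
move=> one1 lrho [M hM] [f0 f00] pm.
have [||||g [h1 _ _]] := @riesz_rel R (rkhs_hilbert H) (fun h x => x = rho h) (modc M).
- exact: modc_ge0.
- by have := lrho (-1) 0 0; rewrite scaleN1r oppr0 addr0 scaleN1r addNr => ->.
- by move=> a u v x y -> ->; rewrite lrho.
- move=> u x ->; rewrite -rc_le rcM -!normc_modc -norm_nm.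
  have h := hM u; apply: le_trans h _; rewrite -[X in _ <= _ * X]normr_id -normrM.
  by apply: real_ler_norm; apply: ger0_real; apply: le_trans (hM u).
have {}h1 f : rho f = dotp f g by rewrite (h1 f _ erefl).
exists g; split=> //; split.
  have := pm 1 f0; rewrite mulop1 (elt_mulop _ one1) mulop1 -h1 => h.
  by apply: (mulIf f00); rewrite mul1r -h.
by move=> phi h; rewrite -!h1 pm (elt_mulop _ one1).
Qed.

(** The lower bound on |g| is what places k_z in the closed span of the kernels over
    j(X): it excludes a component of k_z orthogonal to this span. *)
Lemma pm_point (one g : H) (B : nat -> mult H) : (forall x, rk_fun H one x = 1) ->
  (forall i x, B i x = emb_beta x i) -> pm_vector one g ->
  exists z : ball_of R m, [/\ forall y, rk_fun H g y = drury_arveson_kernel (j y) z,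
    re (drury_arveson_kernel z z) <= nm g ^+ 2 &
    forall i, zeta z i = dotp (mulop (B i) one) g].
Proof.
move=> one1 hB [g1 pm]; pose l i := dotp (mulop (B i) one) g.
have bd := pm_eigen_bound emb_F_series emb_K_F one1 hB g1 pm.
pose G := nm g ^+ 2.
have G1 : 1 <= G by have := bd 0; rewrite big_ord0 mul0r subr_ge0.
have G0 : 0 < G by apply: lt_le_trans G1.
pose c := (G - 1) / G.
have bd' N : \sum_(i < N) modc (l i) ^+ 2 <= c by rewrite /c ler_pdivlMr //; exact: bd.
have c1 : c < 1 by rewrite ltr_pdivrMr // mul1r; lra.
have [|z hz] := ball_of_seq (m := m) c1 _ bd'.
  move=> i hi; rewrite /l; have -> : mulop (B i) one = 0; last by rewrite dot0l.
  by apply: rkhs_ext => x; rewrite mulopE hB /emb_beta zeta_out // mul0r rk_fun0.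
exists z; split=> [y||//].
  pose a := dotp (rk_kernel H y) g.
  have t : tendsto (fun N => (\sum_(i < N) l i * (emb_beta y i)^*) * a) (a - 1).
    rewrite -g1; apply: (eigen_kernel emb_F_series emb_K_F one1 hB) => i.
    by rewrite pm.
  have t' : tendsto (fun N => (\sum_(i < N) l i * (emb_beta y i)^*) * a)
      (a * coord_dot (sval z) (sval (j y))).
    have := tendstoZ a (zeta_dot z (j y)); congr tendsto; apply/funext => N.
    by rewrite mulrC; congr (_ * _); apply: eq_bigr => i _; rewrite hz.
  have e := tendsto_uniq t' t.
  have e2 : a = drury_arveson_kernel z (j y).
    apply: (mulIf (one_sub_neq0 (coord_dot_lt1 z (j y)))).
    by rewrite drury_arveson_inv mulrBr mulr1 e; ring.
  by rewrite -dot_kernel dotC -/a e2 -(psd_herm (psd_drury_arveson R m)).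
have pd := psd_drury_arveson R m; have pc := psd_coord_dot R m.
have dr := drury_arveson_inv z z; rewrite (psd_diag z pd) (psd_diag z pc) in dr.
set k := re (drury_arveson_kernel z z) in dr *; set q := re _ in dr.
have {}dr : k * (1 - q) = 1 by apply: (@rc_inj R); rewrite rcM rcB rc1.
have k0 : 0 <= k by apply: psd_diag_ge0.
have qc : q <= c.
  rewrite /q -lerN2 -reN; have := tendstoZ (-1) (zeta_dot z z); rewrite mulN1r => h.
  apply: (tendsto_re_ge h) => N; rewrite mulN1r reN lerN2 re_sum.
  apply: le_trans (bd' N); apply: ler_sum => i _.
  by rewrite mulcJ re_rc hz.
have Gq : 1 <= G * (1 - q).
  have : G * (1 - c) = 1 by rewrite /c; field; rewrite gt_eqF.
  have := ler_wpM2l (ltW G0) qc; lra.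
rewrite -/G leNgt; apply/negP => kG.
have q0 : 0 < 1 - q by have := c1; lra.
by have := ltr_pM2r q0 G k; rewrite kG dr => h; move: Gq; rewrite leNgt h.
Qed.

End OneSpace.

Lemma drury_arveson_one m (D : rkhs R (ball_of R m)) : is_drury_arveson D ->
  exists one : D, forall z, rk_fun D one z = 1.
Proof.
move=> hD; have [|||z0 hz0] := @ball_of_seq R m (fun=> 0) 0 => //.
  by move=> N; rewrite big1 // => i _; rewrite modc0 expr0n.
exists (rk_kernel D z0) => z; rewrite -/(repkernel D z z0) hD.
suff e : coord_dot (sval z) (sval z0) = 0.
  by have := drury_arveson_inv z z0; rewrite e subr0 mulr1.
apply: (tendsto_uniq (zeta_dot z z0)).
have -> : (fun N => \sum_(i < N) zeta z i * (zeta z0 i)^*) = (fun=> 0).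
  by apply/funext => N; rewrite big1 // => i _; rewrite hz0 rmorph0 mulr0.
exact: tendsto_cst.
Qed.

Section Restriction.
Variables (X : Type) (H : rkhs R X) (m : option nat) (j : X -> ball_of R m).
Hypothesis jH : embedding H j.
Variable D : rkhs R (ball_of R m).
Hypothesis hD : is_drury_arveson D.
Local Notation k := (@drury_arveson_kernel R m).
Let ej (x : X) : D := rk_kernel D (j x).

Lemma gram_pull s : nm (gram ej s) = nm (kcomb H s).
Proof.
apply/eqP; rewrite -(@eqrXn2 _ 2) ?nm_ge0 //; apply/eqP/(@rc_inj R).
rewrite -qf_gram -qf_repkernel; congr qf; apply/funext => x; apply/funext => y.
by rewrite /ej -kernelE hD (jH.2 x y).
Qed.

Lemma dot_gram_pull s (f : D) :
  dotp (gram ej s) f = lf (fun x => (rk_fun D f (j x))^*) s.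
Proof.
by rewrite dot_gram; apply: eq_bigr => p _; rewrite dotC dot_kernel.
Qed.

(** Composition with [j] is a contraction from the Drury-Arveson space to H;
    with [extension] it is onto. *)
Lemma restriction (f : D) :
  exists h : H, (forall x, rk_fun H h x = rk_fun D f (j x)) /\ nm h <= nm f.
Proof.
apply: membership => [|s]; first exact: nm_ge0.
by rewrite -dot_gram_pull -gram_pull mulrC dot_CS.
Qed.

Lemma extension (h : H) : exists f : D, forall x, rk_fun D f (j x) = rk_fun H h x.
Proof.
have [|f [hf _ _]] := @gram_riesz R D X ej (fun x => (rk_fun H h x)^*) (nm h) (nm_ge0 _).
  by move=> s; rewrite -dot_kcomb gram_pull mulrC dot_CS.
by exists f => x; rewrite -dot_kernel dotC hf conjCK.
Qed.

Definition in_closed_span (z : ball_of R m) := forall e : R, 0 < e ->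
  exists s, nm (gram ej s - rk_kernel D z) < e.

Lemma in_closed_span_vanish z (f : D) : in_closed_span z ->
  (forall x, rk_fun D f (j x) = 0) -> rk_fun D f z = 0.
Proof.
move=> hz f0; rewrite -dot_kernel dotC; suff -> : dotp (rk_kernel D z) f = 0 by rewrite rmorph0.
apply: eps_eq => e e0; have n1 : 0 < nm f + 1 by rewrite ltr_wpDl ?nm_ge0.
have [s] := hz _ (divr_gt0 e0 n1); rewrite ltr_pdivlMr // => hs.
have -> : dotp (rk_kernel D z) f - 0 = - dotp (gram ej s - rk_kernel D z) f.
  rewrite dotBl dot_gram_pull /lf big1 ?sub0r ?opprK ?subr0 // => p _.
  by rewrite f0 rmorph0 mulr0.
rewrite modcN; apply: le_lt_trans (dot_CS _ _) _; apply: le_lt_trans hs.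
by rewrite ler_wpM2l ?nm_ge0 // lerDl.
Qed.

Lemma vanish_in_closed_span z :
  (forall f : D, (forall x, rk_fun D f (j x) = 0) -> rk_fun D f z = 0) -> in_closed_span z.
Proof.
move=> hz.
have [|g [hg _ cl]] := @gram_riesz R D X ej (fun x => dotp (ej x) (rk_kernel D z))
    (nm (rk_kernel D z)) (nm_ge0 _).
  by move=> s; rewrite -dot_gram mulrC dot_CS.
pose v := rk_kernel D z - g.
have v0 x : rk_fun D v (j x) = 0.
  by rewrite -dot_kernel dotC dotBr hg subrr rmorph0.
have o1 : dotp v (rk_kernel D z) = 0 by rewrite dot_kernel hz.
have o2 : dotp v g = 0.
  apply: eps_eq => e e0; have n1 : 0 < nm v + 1 by rewrite ltr_wpDl ?nm_ge0.
  have [s] := cl _ (divr_gt0 e0 n1); rewrite ltr_pdivlMr // => hs.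
  have -> : dotp v g - 0 = - dotp v (gram ej s - g).
    rewrite dotBr opprB subr0 [dotp v (gram ej s)]dotC dot_gram_pull /lf big1 ?rmorph0 ?subr0 //.
    by move=> p _; rewrite v0 rmorph0 mulr0.
  rewrite modcN; apply: le_lt_trans (dot_CS _ _) _; apply: le_lt_trans hs.
  by rewrite mulrC ler_wpM2l ?nm_ge0 // lerDl.
have : v = 0 by apply: nm_eq0; apply/eqP; rewrite -sqrf_eq0 nm_sqr {2}/v dotBr o1 o2 subrr.
by move=> /subr0_eq e eps /cl[s hs]; exists s; rewrite e.
Qed.

(** If k_z lies in the closed span of the k_(j x), evaluation at z descends from the
    Drury-Arveson space to H. *)
Lemma dot_restriction z (g h : H) (f : D) : in_closed_span z ->
  (forall x, rk_fun H g x = k (j x) z) -> (forall x, rk_fun H h x = rk_fun D f (j x)) ->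
  dotp h g = rk_fun D f z.
Proof.
move=> hz hg hh; rewrite -dot_kernel dotC [RHS]dotC; congr (_^*).
apply: eps_eq => e e0; have n1 : 0 < nm h + nm f + 1 by rewrite ltr_wpDl ?addr_ge0 ?nm_ge0.
have [s] := hz _ (divr_gt0 e0 n1); rewrite ltr_pdivlMr // => hs.
have e1 : dotp (kcomb H s) h = dotp (gram ej s) f.
  by rewrite dot_kcomb dot_gram_pull; apply: eq_bigr => p _; rewrite hh.
have [w [hw nw]] := restriction (gram ej s - rk_kernel D z).
have ew : w = kcomb H s - g.
  apply: rkhs_ext => x; rewrite hw !rk_funB hg; congr (_ - _); last by rewrite -hD.
  rewrite /gram /kcomb /gram !rk_fun_sum; apply: eq_bigr => p _.
  rewrite !rk_funZ; congr (_ * _); rewrite -/(repkernel H _ _) (jH.2 _ _) -hD //.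
have -> : dotp g h - dotp (rk_kernel D z) f =
   - dotp w h + dotp (gram ej s - rk_kernel D z) f.
  by rewrite ew !dotBl e1; ring.
apply: le_lt_trans (modcD _ _) _; rewrite modcN.
have := dot_CS w h; have := dot_CS (gram ej s - rk_kernel D z) f.
have := ler_wpM2r (nm_ge0 h) nw; have := nm_ge0 (gram ej s - rk_kernel D z).
move: hs; rewrite !mulrDr mulr1; lra.
Qed.

End Restriction.

Section Varieties.
Variables (X : Type) (H : rkhs R X) (one : H).
Hypothesis one1 : forall x, rk_fun H one x = 1.

Lemma pm_at_point m (j : X -> ball_of R m) (g : H) x : embedding H j ->
  (forall y, rk_fun H g y = drury_arveson_kernel (j y) (j x)) ->
  forall f, dotp f g = rk_fun H f x.
Proof.
move=> jH hg f; rewrite -dot_kernel; congr dotp.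
by apply: rkhs_ext => y; rewrite hg -(jH.2 y x).
Qed.

Theorem consistent_of_variety m (j : X -> ball_of R m) :
  embedding H j -> variety (range j) -> algebraically_consistent H.
Proof.
move=> jH [D hD [S rS]] rho l b n0 pm.
have [g [pg hrho]] := pm_riesz one1 l b n0 pm.
have [B hB] := emb_coords jH one1.
have [z [gz kz _]] := pm_point jH one1 hB pg.
have cs : in_closed_span j D z.
  move=> e e0; have [s hs] := kcomb_dense g e0; exists s; apply: le_lt_trans hs.
  rewrite -(@ler_pXn2r _ 2) ?nnegrE ?nm_ge0 // !nmB_sqr (gram_pull jH hD).
  have -> : dotp (gram (fun x => rk_kernel D (j x)) s) (rk_kernel D z) = dotp (kcomb H s) g.
    rewrite dot_kcomb dot_gram_pull; apply: eq_bigr => p _; rewrite gz -hD //.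
  rewrite lerD2r lerD2l nm_sqr -kernelE hD //.
have [x _ jx] : range j z.
  rewrite rS /= => f Sf; apply: (in_closed_span_vanish cs) => x.
  have : range j (j x) by exists x.
  by rewrite rS => /(_ f Sf).
exists x => f; rewrite hrho; apply: (pm_at_point jH) => y; by rewrite jx.
Qed.

Theorem variety_of_consistent m (j : X -> ball_of R m) :
  embedding H j -> algebraically_consistent H -> variety (range j).
Proof.
move=> jH cons; have [D hD] := drury_arveson_exists R m.
exists D => //; exists [set f | forall x, rk_fun D f (j x) = 0].
apply/seteqP; split=> [_ [x _ <-] f /(_ x)//|z /= hz].
have cs := vanish_in_closed_span hz.
have [g [hg _]] := restriction jH hD (rk_kernel D z).
have {}hg x : rk_fun H g x = drury_arveson_kernel (j x) z by rewrite hg -hD.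
have dr h f := dot_restriction jH hD (h := h) (f := f) cs hg.
have [oneD oneD1] := drury_arveson_one hD.
have jD : embedding D id by split=> // u v; exact: hD.
have [BD hBD] := emb_coords jD oneD1.
have [B hB] := emb_coords jH one1.
have g1 : dotp one g = 1 by rewrite (dr _ oneD) // => x; rewrite one1 oneD1.
have eig i h : dotp (mulop (B i) h) g = zeta z i * dotp h g.
  have [f hf] := extension jH hD h.
  rewrite (dr h f) // (dr (mulop (B i) h) (mulop (BD i) f)); first by rewrite mulopE hBD.
  by move=> x; rewrite !mulopE hB hBD hf.
have pm := eigen_pm (emb_F_series j) (emb_K_F jH) one1 hB g1 eig.
have [||||x hx] := cons (fun f => dotp f g).
- by move=> a u v; rewrite dotDl dotZl.
- exists (rc (nm g)) => f.
  by rewrite normc_modc (norm_nm (f : rkhs_hilbert H)) -rcM rc_le mulrC dot_CS.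
- by exists one; rewrite g1 oner_eq0.
- by move=> phi f; rewrite pm (elt_mulop _ one1).
exists x => //; apply/esym.
have ev f : rk_fun D f z = rk_fun D f (j x).
  have [h [hh _]] := restriction jH hD f.
  by rewrite -(dr h) // hx hh.
have kev w : drury_arveson_kernel z w = drury_arveson_kernel (j x) w.
  by rewrite -!hD; exact: ev.
by apply: ball_eq_dot; apply: drury_arveson_inj.
Qed.

End Varieties.

(** With K(., x0) = 1 the base kernel at x0 is 1 - 1/K; its coordinates in l^2 have squared
    norm 1 - 1/K(x, x) < 1. *)
Theorem embedding_exists (X : Type) (H : rkhs R X) : normalized H ->
  irreducible_space H -> complete_pick H ->
  exists j : X -> ball_of R None, embedding H j.
Proof.
move=> [x0 hx0] [K0 ind] cp.
have pF := psd_base_kernel K0 cp x0.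
have FE x y : base_kernel H x0 x y = 1 - (repkernel H x y)^-1.
  have pK := psd_repkernel H.
  by rewrite /base_kernel (psd_herm pK y x0) !hx0 rmorph1 !mul1r.
have [|y hy] := @dense_kernel R (rkhs_hilbert H) X (rk_kernel H) x0 (fun w => 1 - w^-1)
   (@rk_separable _ _ H).
  move=> x e e0; have h0 : dotp (rk_kernel H x) (rk_kernel H x) != 0 by rewrite -kernelE.
  have [d d0 hd] := inv_cont_at h0 e0; exists d => // w /hd /=.
  set u := w^-1; set v := (dotp _ _)^-1 => h.
  have -> : 1 - u - (1 - v) = - (u - v) by ring.
  by rewrite modcN.
have [|b [hb hs]] := @psd_feature R X _ y pF.
  have -> : base_kernel H x0 = (fun u v => 1 - (dotp (rk_kernel H v) (rk_kernel H u))^-1).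
    by apply/funext => u; apply/funext => v; rewrite FE kernelE.
  exact: hy.
have ex x : exists z : ball_of R None, forall i, zeta z i = b x i.
  apply: (@ball_of_seq R None (b x) (re (base_kernel H x0 x x))) => //.
  have pK := psd_repkernel H.
  rewrite FE (psd_diag x pK) -rcV -rc1 -rcB re_rc gtrBl invr_gt0.
  rewrite lt_def psd_diag_ge0 // andbT.
  by apply/negP => /eqP h; have := K0 x x; rewrite (psd_diag x pK) h eqxx.
have [j hj] := choice ex; exists j.
have jK x z : repkernel H x z = drury_arveson_kernel (j x) (j z).
  rewrite /drury_arveson_kernel.
  have -> : coord_dot (sval (j x)) (sval (j z)) = base_kernel H x0 x z.
    apply: (tendsto_uniq (zeta_dot (j x) (j z))); have := hs x z.
    by congr tendsto; apply/funext => N; apply: eq_bigr => i _; rewrite !hj.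
  by rewrite FE opprB addrC subrK invrK.
split=> // x z jxz; apply: contrapT => xz.
have [|/eqP] := ind x z xz 1 (-1).
  by move=> w; rewrite !jK jxz mul1r mulN1r subrr.
by rewrite oner_eq0.
Qed.

End Embeddings.

(** * Hilbert modules over the multiplier algebra *)

(** A Hilbert space of vector-valued functions on X on which multipliers act pointwise.
    A point over x is a coordinate at x.  The axioms are those that pass from H to
    Hilbert sums; the algebraic laws follow from totality of the evaluations. *)
Record hmod (R : realType) (X : Type) (H : rkhs R X) := HMod {
  md_space :> hilbert R;
  md_point : Type;
  md_base : md_point -> X;
  md_eval : md_point -> md_space;
  md_act : mult H -> md_space -> md_space;
  md_act_eval : forall phi e p,
    dotp (md_act phi e) (md_eval p) = phi (md_base p) * dotp e (md_eval p);
  md_eval_total : forall e, (forall p, dotp e (md_eval p) = 0) -> e = 0;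
  md_bound : forall phi (c : R), 0 <= c -> (forall f : H, nm (mulop phi f) <= c * nm f) ->
    forall e, nm (md_act phi e) <= c * nm e;
  md_row : forall (N : nat) (b : 'I_N -> mult H),
    (forall f : 'I_N -> H, nm (\sum_i mulop (b i) (f i)) ^+ 2 <= \sum_i nm (f i) ^+ 2) ->
    forall e : 'I_N -> md_space,
      nm (\sum_i md_act (b i) (e i)) ^+ 2 <= \sum_i nm (e i) ^+ 2 }.

Section ModuleTheory.
Variables (R : realType) (X : Type) (H : rkhs R X) (V : hmod H).
Local Notation C := (R[i]).
Implicit Types (phi psi : mult H) (e f : V).

Lemma md_ext e f : (forall p, dotp e (md_eval p) = dotp f (md_eval p)) -> e = f.
Proof.
move=> h; apply/eqP; rewrite -subr_eq0; apply/eqP; apply: md_eval_total => p.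
by rewrite dotBl h subrr.
Qed.

Lemma md_act_linear phi a e f : md_act phi (a *: e + f) = a *: md_act phi e + md_act phi f.
Proof. by apply: md_ext => p; rewrite md_act_eval !dotDl !dotZl !md_act_eval; ring. Qed.
Lemma md_act0 phi : md_act phi (0 : V) = 0.
Proof. by apply: md_ext => p; rewrite md_act_eval !dot0l mulr0. Qed.
Lemma md_act0l e : md_act (0 : mult H) e = 0.
Proof.
apply: md_ext => p; rewrite md_act_eval dot0l.
by rewrite -[(0 : mult H) _]/(0 : C) mul0r.
Qed.
Lemma md_actB phi e f : md_act phi (e - f) = md_act phi e - md_act phi f.
Proof. by apply: md_ext => p; rewrite md_act_eval !dotBl !md_act_eval; ring. Qed.
Lemma md_act_comb phi psi a e : md_act (a *: phi + psi) e = a *: md_act phi e + md_act psi e.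
Proof.
apply: md_ext => p; rewrite dotDl dotZl !md_act_eval mulrA -mulrDl; congr (_ * _).
Qed.
Lemma md_act_mul phi psi e : md_act (phi * psi) e = md_act phi (md_act psi e).
Proof. by apply: md_ext => p; rewrite !md_act_eval mulrA. Qed.
End ModuleTheory.

Section RegularModule.
Variables (R : realType) (X : Type) (H : rkhs R X).

Definition regular_module : hmod H.
Proof.
refine (@HMod R X H (rkhs_hilbert H) X id (rk_kernel H) (@mulop _ _ H) _ _ _ _).
- by move=> phi e p; rewrite !dot_kernel mulopE.
- by move=> e he; apply: rkhs_ext => x; rewrite -dot_kernel he rk_fun0.
- by move=> phi c _ hc e; exact: hc.
- by move=> N b hb e; exact: hb.
Defined.

End RegularModule.

Section SumModule.
Variables (R : realType) (X : Type) (H : rkhs R X) (V : hmod H).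
Local Notation C := (R[i]).
Local Notation L := (l2 V (fun=> True)).

Lemma l2_nm_le (u : L) (c : R) : (forall N, \sum_(n < N) nm (l2_val u n) ^+ 2 <= c) ->
  nm u ^+ 2 <= c.
Proof. by move=> h; rewrite l2_nm_sqr; apply: l2_dot_le. Qed.

Lemma l2_nm_ge (u : L) N : \sum_(n < N) nm (l2_val u n) ^+ 2 <= nm u ^+ 2.
Proof. by rewrite l2_nm_sqr; apply: l2_psum_le. Qed.

Lemma sum_act_subproof (phi : mult H) (u : L) :
  (fun n => md_act phi (l2_val u n)) \in @l2_pred R V (fun=> True).
Proof.
apply/l2_predP; split=> [n []//|]; have [c c0 hc] := mult_bounded phi.
exists (c ^+ 2 * nm u ^+ 2) => N.
apply: (@le_trans _ _ (\sum_(n < N) c ^+ 2 * nm (l2_val u n) ^+ 2)).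
  apply: ler_sum => n _; rewrite -exprMn ler_pXn2r ?nnegrE ?mulr_ge0 ?nm_ge0 //.
  exact: md_bound.
by rewrite -mulr_sumr ler_wpM2l ?sqr_ge0 // l2_nm_ge.
Qed.
Definition sum_act phi u : L := L2Seq (sum_act_subproof phi u).

Lemma single_subproof (m : nat) (v : V) :
  (fun n => if n == m then v else 0) \in @l2_pred R V (fun=> True).
Proof.
apply/l2_predP; split=> [n []//|]; exists (nm v ^+ 2) => N.
have z n : n != m -> nm (if n == m then v else 0) ^+ 2 = 0.
  by move=> /negbTE ->; rewrite nm0 expr0n.
have [hm|hm] := ltnP m N.
  rewrite (bigD1 (Ordinal hm)) //= eqxx big1 ?addr0 // => i hi; apply: z.
  by apply: contra_neq hi => hi; apply: val_inj.
rewrite big1 ?sqr_ge0 // => i _; apply: z.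
by rewrite neq_ltn (leq_trans (ltn_ord i) hm).
Qed.
Definition single m v : L := L2Seq (single_subproof m v).

Lemma dot_single (u : L) m v : dotp u (single m v) = dotp (l2_val u m) v.
Proof.
apply: (tendsto_uniq (l2_dotP u (single m v))).
apply: (@tendsto_eq _ (fun=> dotp (l2_val u m) v) _ _ m.+1); last exact: tendsto_cst.
move=> N hN; rewrite /l2_psum (bigD1 (Ordinal hN)) //= eqxx big1 ?addr0 // => i hi.
case: eqP => [e|_]; last exact: dot0r.
by case/eqP: hi; apply: val_inj.
Qed.

Lemma l2_sum_val (I : Type) (r : seq I) (F : I -> L) n :
  l2_val (\sum_(i <- r) F i) n = \sum_(i <- r) l2_val (F i) n.
Proof. by apply: (big_morph (fun u : L => l2_val u n)). Qed.

Definition sum_module : hmod H.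
Proof.
refine (@HMod R X H L (nat * md_point V)%type (fun p => md_base p.2)
   (fun p => single p.1 (md_eval p.2)) sum_act _ _ _ _).
- by move=> phi e [n p] /=; rewrite !dot_single md_act_eval.
- move=> e he; apply: l2_ext => n; apply: md_eval_total => p.
  by rewrite -(he (n, p)) dot_single.
- move=> phi c c0 hc e.
  rewrite -(@ler_pXn2r _ 2) ?nnegrE ?mulr_ge0 ?nm_ge0 // exprMn.
  apply: l2_nm_le => N.
  apply: (@le_trans _ _ (\sum_(n < N) c ^+ 2 * nm (l2_val e n) ^+ 2)).
    apply: ler_sum => n _; rewrite -exprMn ler_pXn2r ?nnegrE ?mulr_ge0 ?nm_ge0 //.
    exact: md_bound.
  by rewrite -mulr_sumr ler_wpM2l ?sqr_ge0 // l2_nm_ge.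
- move=> N b hb e; apply: l2_nm_le => M.
  apply: (@le_trans _ _ (\sum_(n < M) \sum_i nm (l2_val (e i) n) ^+ 2)).
    apply: ler_sum => n _; rewrite l2_sum_val; exact: (md_row hb).
  by rewrite exchange_big /=; apply: ler_sum => i _; exact: l2_nm_ge.
Defined.

End SumModule.

(** * Characters bounded on a cyclic module *)

Section CharacterExtension.
Variables (R : realType) (X : Type) (H : rkhs R X).
Local Notation C := (R[i]).
Local Notation K := (repkernel H).
Variables (beta : X -> nat -> C) (F : X -> X -> C) (one : H).
Hypothesis F_series : forall x y,
  tendsto (fun N => \sum_(i < N) beta x i * (beta y i)^*) (F x y).
Hypothesis K_F : forall x y, K x y * (1 - F x y) = 1.
Hypothesis one1 : forall x, rk_fun H one x = 1.

Variable chi : mult H -> C.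
Hypothesis chi_char : character chi.

Lemma chi_linear a phi psi : chi (a *: phi + psi) = a * chi phi + chi psi.
Proof. by case: chi_char => _ h _; rewrite h. Qed.
Lemma chiM phi psi : chi (phi * psi) = chi phi * chi psi.
Proof. by case: chi_char => _ _ h; rewrite h. Qed.
Lemma chi0 : chi 0 = 0.
Proof. by have := chi_linear (-1) 0 0; rewrite scaleN1r oppr0 addr0 mulN1r addNr. Qed.
Lemma chi1 : chi 1 = 1.
Proof.
have [[phi h] _ _] := chi_char; apply: (mulfI h).
by rewrite -chiM !mulr1.
Qed.

(** 1 - F(., y) is invertible in Mult(H), with inverse K_y. *)
Lemma chi_F_neq1 y (psi : mult H) : (forall x, psi x = F x y) -> chi psi != 1.
Proof.
move=> hpsi; have [kap hk] := kernel_mult F_series K_F one1 y.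
have e : (-1 *: psi + 1) * kap = 1.
  apply: val_inj; apply/funext => x.
  rewrite -[LHS]/((-1 * psi x + 1) * kap x) -[RHS]/(1 : C).
  by rewrite hpsi hk -[RHS](K_F x y); ring.
have := congr1 chi e; rewrite chiM chi_linear chi1 => h.
by apply/eqP => c; move: h; rewrite c mulN1r addNr mul0r => /eqP; rewrite eq_sym oner_eq0.
Qed.

Section InModule.
Variables (V : hmod H) (Phi : V) (c0 : R).
Hypothesis c0_ge0 : 0 <= c0.
Hypothesis chi_bd : forall phi, modc (chi phi) <= c0 * nm (md_act phi Phi).

(** The closed submodule generated by [Phi]. *)
Definition cyc (e : V) := forall eps : R, 0 < eps -> exists phi, nm (md_act phi Phi - e) < eps.

Lemma cyc_act phi : cyc (md_act phi Phi).
Proof. by move=> eps h; exists phi; rewrite subrr nm0. Qed.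

Lemma cyc_comb a e f : cyc e -> cyc f -> cyc (a *: e + f).
Proof.
move=> he hf eps eps0.
have a1 : 0 < modc a + 1 by rewrite ltr_wpDl ?modc_ge0.
have e2 : 0 < eps / 2 by rewrite divr_gt0.
have [phi] := he _ (divr_gt0 e2 a1); rewrite ltr_pdivlMr // => h1.
have [psi h2] := hf _ e2; exists (a *: phi + psi).
have -> : md_act (a *: phi + psi) Phi - (a *: e + f) =
    a *: (md_act phi Phi - e) + (md_act psi Phi - f).
  by rewrite md_act_comb scalerBr opprD addrACA.
have := nmD (a *: (md_act phi Phi - e)) (md_act psi Phi - f); rewrite nmZ.
have := nm_ge0 (md_act phi Phi - e); move: h1; rewrite mulrDr mulr1 [_ * modc a]mulrC; lra.
Qed.

Lemma cyc_sum (I : Type) (r : seq I) (f : I -> V) : (forall i, cyc (f i)) ->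
  cyc (\sum_(i <- r) f i).
Proof.
move=> hf; apply: big_ind => //.
  by move=> eps h; exists 0; rewrite md_act0l subrr nm0.
by move=> x y hx hy; rewrite -[x]scale1r; apply: cyc_comb.
Qed.

Lemma cyc_md_act psi e : cyc e -> cyc (md_act psi e).
Proof.
move=> he eps eps0; have [c cc hc] := mult_bounded psi.
have c1 : 0 < c + 1 by rewrite ltr_wpDl.
have [phi] := he _ (divr_gt0 eps0 c1); rewrite ltr_pdivlMr // => h.
exists (psi * phi); rewrite md_act_mul -md_actB.
apply: le_lt_trans (md_bound cc hc _) _; apply: le_lt_trans h.
by rewrite mulrC ler_wpM2l ?nm_ge0 // lerDl.
Qed.

Lemma cyc_eq (e f g : V) (a : C) : cyc e ->
  (forall phi, dotp (md_act phi Phi) f = a * dotp (md_act phi Phi) g) ->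
  dotp e f = a * dotp e g.
Proof.
move=> he h; apply: eps_eq => eps eps0.
pose B := nm f + modc a * nm g.
have B0 : 0 <= B by rewrite addr_ge0 ?mulr_ge0 ?nm_ge0 ?modc_ge0.
have B1 : 0 < B + 1 by rewrite ltr_wpDl.
have [phi] := he _ (divr_gt0 eps0 B1); rewrite ltr_pdivlMr // => h1.
set d := md_act phi Phi - e in h1.
have -> : dotp e f - a * dotp e g = - dotp d f + a * dotp d g.
  by rewrite /d !dotBl h; ring.
have := modcD (- dotp d f) (a * dotp d g); rewrite modcN modcM.
have := dot_CS d f; have := ler_wpM2l (modc_ge0 a) (dot_CS d g).
have := nm_ge0 d; move: h1; rewrite /B !mulrDr mulr1 [nm d * (modc a * _)]mulrCA; lra.
Qed.

(** The projection onto the closed submodule generated by [Phi]. *)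
Lemma cyc_riesz (f : V) : exists g, cyc g /\ forall e, cyc e -> dotp e g = dotp e f.
Proof.
have [|||g [h1 _ h3]] := @riesz_rel R V
   (fun u x => exists2 phi, u = md_act phi Phi & x = dotp u f) (nm f) (nm_ge0 _).
- by exists 0; rewrite ?md_act0l ?dot0l.
- move=> a u v x y [phi -> ->] [psi -> ->]; exists (a *: phi + psi).
    by rewrite md_act_comb.
  by rewrite dotDl dotZl.
- by move=> u x [phi _ ->]; rewrite mulrC dot_CS.
exists g; split.
  by move=> eps /h3[u [x [[phi -> _] h]]]; exists phi.
move=> e he; rewrite -[RHS]mul1r; apply: cyc_eq => // phi; rewrite mul1r.
by apply: h1; exists phi.
Qed.

Lemma chi_vector : exists2 G, cyc G & forall phi, dotp (md_act phi Phi) G = chi phi.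
Proof.
have [|||G [h1 _ h3]] := @riesz_rel R V
   (fun u x => exists2 phi, u = md_act phi Phi & x = chi phi) c0 c0_ge0.
- by exists 0; rewrite ?md_act0l ?chi0.
- move=> a u v x y [phi -> ->] [psi -> ->]; exists (a *: phi + psi).
    by rewrite md_act_comb.
  by rewrite chi_linear.
- by move=> u x [phi -> ->].
exists G; first by move=> eps /h3[u [x [[phi -> _] h]]]; exists phi.
by move=> phi; apply: h1; exists phi.
Qed.

(** Write E for the closed submodule generated by [Phi] and k_E for its kernel, whose
    kernel functions are the projections [kap] of the evaluations.  On E the character is
    represented by an eigenvector [G] of the adjoints ([GE]).  The function v below is
    in E, and phi |-> phi v is bounded from the norm of H, since (1 - F) k_E dominates
    a multiple of v v^* and hence k_E = K (1 - F) k_E dominates a multiple of K v v^*.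
    Finally <phi v, G> = chi(phi) <v, G>, where <v, G> is not 0 for a suitable q because
    chi never takes the value 1 at F(., y). *)
Theorem character_bound : exists2 c1 : R, 0 <= c1 &
  forall phi, modc (chi phi) <= c1 * nm (mulop phi one).
Proof.
have [G cG hG] := chi_vector.
have GE psi e : cyc e -> dotp (md_act psi e) G = chi psi * dotp e G.
  move=> ce; have [G' [_ hG']] := cyc_riesz G.
  have [a [_ ha]] : exists a, True /\ forall e', cyc e' -> dotp (md_act psi e') G = dotp e' a.
    have [c cc hc] := mult_bounded psi.
    have [||||a [h1 _ _]] := @riesz_rel R V (fun u x => x = dotp (md_act psi u) G) (c * nm G).
    - by rewrite mulr_ge0 ?nm_ge0.
    - by rewrite md_act0 dot0l.
    - by move=> b u v x y -> ->; rewrite md_act_linear dotDl dotZl.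
    - move=> u x ->; apply: le_trans (dot_CS _ _) _; rewrite mulrAC ler_wpM2r ?nm_ge0 //.
      exact: md_bound.
    by exists a; split=> // e' _; rewrite (h1 e' _ erefl).
  rewrite ha //; apply: cyc_eq => // phi.
  rewrite -ha; last exact: cyc_act.
  by rewrite -md_act_mul !hG chiM.
have [kap hkap] := choice (fun p => cyc_riesz (md_eval p)).
have ck p : cyc (kap p) by case: (hkap p).
have kE p e : cyc e -> dotp e (kap p) = dotp e (md_eval p) by case: (hkap p) => _; apply.
have actE phi e p : cyc e -> dotp (md_act phi e) (kap p) = phi (md_base p) * dotp e (kap p).
  by move=> ce; rewrite kE ?kE ?md_act_eval //; apply: cyc_md_act.
have cyc0 e : cyc e -> (forall p, dotp (kap p) e = 0) -> e = 0.
  by move=> ce h; apply: md_eval_total => p; rewrite -kE // dotC h rmorph0.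
have cgram s : cyc (gram kap s).
  apply: cyc_sum => p; rewrite -[_ *: _]addr0; apply: cyc_comb => //.
  by have := cyc_sum [::] (fun q : C * md_point V => ck q.2); rewrite big_nil.
have [B [hB _]] := coord_mult_exists F_series K_F one1.
have rowB N (f : 'I_N -> H) : nm (\sum_(i < N) mulop (B i) (f i)) ^+ 2 <= \sum_(i < N) nm (f i) ^+ 2.
  case: N f => [|N] f; first by rewrite !big_ord0 nm0 expr0n.
  pose g i := f (inord i).
  have -> : \sum_(i < N.+1) mulop (B i) (f i) =
      \sum_(i < N.+1) mulop (B i) (g i) + 0 *: one.
    by rewrite scale0r addr0; apply: eq_bigr => i _; rewrite /g inord_val.
  have -> : \sum_(i < N.+1) nm (f i) ^+ 2 = \sum_(i < N.+1) nm (g i) ^+ 2 + modc 0 ^+ 2.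
    by rewrite modc0 expr0n addr0; apply: eq_bigr => i _; rewrite /g inord_val.
  apply: row_bound => s; have := coord_row F_series K_F one1 N.+1 s.
  congr (_ + _ <= _); apply: eq_bigr => i _.
  by do 4!f_equal; apply/funext => x; rewrite hB.
pose kk p q := dotp (kap q) (kap p).
pose bs := @md_base R X H V.
have pA : psd (fun p q => (1 - F (bs p) (bs q)) * kk p q).
  apply: (@psd_limit _ _ (fun N p q => kk p q -
     \sum_(i < N) beta (bs p) i * kk p q * (beta (bs q) i)^*)) => [N|p q].
    split=> [p q|s].
      rewrite rmorphB rmorph_sum /= /kk -dotC; congr (_ - _); apply: eq_bigr => i _.
      by rewrite !rmorphM /= conjCK -dotC; ring.
    rewrite qfB qf_sum qf_gram reB re_sum re_rc subr_ge0.
    under eq_bigr do rewrite (qf_scale (fun p => beta (bs p) _)) qf_gram re_rc.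
    pose w (i : 'I_N) := gram kap (scale (fun p => beta (bs p) i) s).
    apply: (@row_dual_vec R V N (gram kap s) (\sum_(i < N) md_act (B i) (w i)) w).
      rewrite dot_sumr re_sum; apply: eq_bigr => i _; rewrite nm_sqr; congr re.
      have cw : cyc (w i) by exact: cgram.
      rewrite {2}/w !dot_gram /lf /scale big_map; apply: eq_bigr => p _ /=.
      by rewrite dotC actE // hB rmorphM /= -dotC mulrA.
    by apply: md_row => f; exact: rowB.
  have := tendstoD (tendsto_cst (kk p q)) (tendstoZ (- kk p q) (F_series (bs p) (bs q))).
  have -> : kk p q + - kk p q * F (bs p) (bs q) = (1 - F (bs p) (bs q)) * kk p q by ring.
  congr tendsto; apply/funext => N; rewrite mulNr mulr_sumr; congr (_ - _).
  by apply: eq_bigr => i _; ring.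
have [q hq] : exists q, dotp (kap q) G != 0.
  apply: contrapT => nq; have G0 : G = 0.
    by apply: cyc0 => // p; apply/eqP/negPn/negP => h; apply: nq; exists p.
  by have := hG 1; rewrite G0 dot0r chi1 => /eqP; rewrite eq_sym oner_eq0.
have [psi hpsi _] := F_mult F_series K_F one1 (bs q).
(* v is the column (1 - F(., y)) k_E(., q) of the kernel (1 - F) k_E, with y under q *)
pose v := kap q - md_act psi (kap q).
have cv : cyc v.
  rewrite /v -scaleN1r addrC; apply: cyc_comb => //; exact: cyc_md_act.
pose A p := (1 - F (bs p) (bs q)) * kk p q.
have vE p : dotp v (kap p) = A p.
  by rewrite /v dotBl actE // hpsi /A /kk; ring.
have vG : dotp v G != 0.
  rewrite /v dotBl GE // -{1}[dotp _ G]mul1r -mulrBl mulf_neq0 // subr_eq0 eq_sym.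
  exact: (chi_F_neq1 hpsi).
pose a := re (A q).
have a0 : 0 <= a by apply: (psd_diag_ge0 q pA).
(* Cauchy-Schwarz for (1 - F) k_E at q, multiplied by K = 1 / (1 - F) *)
have key s : nm (kcomb H [seq (p.1, bs p.2) | p <- scale A s]) ^+ 2 <=
    a * nm (gram kap s) ^+ 2.
  have := psd_ge0 s (psd_mul (psd_CS_kernel q pA) (psd_comp bs (psd_repkernel H))).
  have -> : qf (fun p p' : md_point V => (rc (re ((1 - F (bs q) (bs q)) * kk q q)) *
       ((1 - F (bs p) (bs p')) * kk p p') - (1 - F (bs p) (bs q)) * kk p q *
       ((1 - F (bs p') (bs q)) * kk p' q)^*) * K (bs p) (bs p')) s =
     rc a * qf kk s - qf (fun p p' => A p * K (bs p) (bs p') * (A p')^*) s.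
    rewrite -qfZ -qfB; congr qf; apply/funext => p; apply/funext => p'.
    have e : (1 - F (bs p) (bs p')) * kk p p' * K (bs p) (bs p') = kk p p'.
      by rewrite -[RHS]mul1r -[X in _ = X * _](K_F (bs p) (bs p')); ring.
    rewrite -/(A q) -/a -/(A p) -/(A p') -[in RHS]e.
    move: (A p) ((A p')^*) (kk p p') (rc a) => x y z t; ring.
  rewrite (qf_scale A) (qf_comp bs) qf_repkernel (qf_gram kap) reB reMr !re_rc; lra.
(* phi v is found again as the vector representing the functional that [key] bounds *)
have bound phi : nm (md_act phi v) <= Num.sqrt a * nm (mulop phi one).
  have cu := cyc_md_act phi cv.
  have [||g [hg ng gcl]] := @gram_riesz R V (md_point V) kap
      (fun p => dotp (kap p) (md_act phi v)) (Num.sqrt a * nm (mulop phi one)).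
  - by rewrite mulr_ge0 ?sqrtr_ge0 ?nm_ge0.
  - move=> s.
    have -> : lf (fun p => dotp (kap p) (md_act phi v)) s =
       dotp (kcomb H [seq (p.1, bs p.2) | p <- scale A s]) (mulop phi one).
      rewrite dot_kcomb /lf /scale !big_map; apply: eq_bigr => p _ /=.
      rewrite dotC actE // vE mulopE one1 mulr1 rmorphM /=; ring.
    apply: le_trans (dot_CS _ _) _; rewrite mulrAC ler_wpM2r ?nm_ge0 //.
    rewrite -(@ler_pXn2r _ 2) ?nnegrE ?mulr_ge0 ?sqrtr_ge0 ?nm_ge0 // exprMn sqr_sqrtr //.
  have cg : cyc g.
    move=> eps eps0; have e2 : 0 < eps / 2 by rewrite divr_gt0.
    have [s hs] := gcl _ e2; have [ph hph] := cgram s _ e2.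
    exists ph; have := nm_triangle (md_act ph Phi) (gram kap s) g; lra.
  suff -> : md_act phi v = g by [].
  apply/eqP; rewrite -subr_eq0; apply/eqP; apply: cyc0.
    by rewrite -scaleN1r addrC; apply: cyc_comb.
  by move=> p; rewrite dotBr hg subrr.
have vG0 := modc_gt0 vG.
exists (Num.sqrt a * nm G / modc (dotp v G)) => [|phi].
  by rewrite divr_ge0 ?mulr_ge0 ?sqrtr_ge0 ?nm_ge0 // ltW.
rewrite mulrAC ler_pdivlMr // -modcM -GE //.
apply: le_trans (dot_CS _ _) _; rewrite [leRHS]mulrAC ler_wpM2r ?nm_ge0 //.
Qed.

End InModule.

(** A character bounded by the norm of H extends to a partially multiplicative
    functional, because the kernel functions are multipliers and span a dense
    subspace. *)
Theorem character_pm_vector (c1 : R) : 0 <= c1 ->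
  (forall phi, modc (chi phi) <= c1 * nm (mulop phi one)) ->
  exists g, pm_vector one g /\ forall phi, chi phi = dotp (mulop phi one) g.
Proof.
move=> c1_0 hc.
have [|||g [h1 _ _]] := @riesz_rel R (rkhs_hilbert H)
   (fun u x => exists2 phi, u = mulop phi one & x = chi phi) c1 c1_0.
- exists 0; last by rewrite chi0.
  apply: rkhs_ext => x; rewrite mulopE rk_fun0.
  have -> : (0 : mult H) x = 0 by [].
  by rewrite mul0r.
- move=> a u v x y [phi -> ->] [psi -> ->]; exists (a *: phi + psi).
    by rewrite mulop_comb.
  by rewrite chi_linear.
- by move=> u x [phi -> ->].
have {}h1 phi : dotp (mulop phi one) g = chi phi by apply: h1; exists phi.
exists g; split=> //; split; first by rewrite -(mulop1 one) h1 chi1.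
move=> phi h; rewrite h1.
have [g' hg'] := mult_adjoint phi g; rewrite -hg'.
suff -> : g' = (chi phi)^* *: g by rewrite dotZr conjCK.
apply: dot_eq_dense => y; rewrite hg' dotZr conjCK.
have [kap hk] := kernel_mult F_series K_F one1 y.
have -> : rk_kernel H y = mulop kap one.
  by apply: rkhs_ext => x; rewrite mulopE one1 mulr1 hk.
by rewrite -mulop_mul !h1 chiM.
Qed.

End CharacterExtension.

(** * The weak* topology on multipliers *)

Lemma lim_tendsto (R : realType) (u : nat -> R[i]) (l : R[i]) : tendsto u l -> limn u = l.
Proof. by move=> /tendstoP h; apply: cvg_lim => //; exact: norm_hausdorff. Qed.

Lemma seriesE (R : realType) (u : nat -> R[i]) : series u = (fun N => \sum_(i < N) u i).
Proof. by apply/funext => N; rewrite /series /= big_mkord. Qed.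

Lemma finite_l2 (R : realType) (V : hilbert R) (s : seq V) :
  (fun k => nth 0 s k) \in @l2_pred R V (fun=> True).
Proof.
apply/l2_predP; split=> [n []//|]; pose F n : R := nm (nth 0 s n) ^+ 2.
exists (\sum_(n < size s) F n) => N.
rewrite -/(\sum_(n < N) F n) -!(big_mkord xpredT F).
case/orP: (leq_total N (size s)) => h.
  by rewrite (big_cat_nat _ h) //= lerDl sumr_ge0 // => i _; exact: sqr_ge0.
rewrite (big_cat_nat _ h) //=.
have -> : \sum_(size s <= i < N) F i = 0; last by rewrite addr0.
rewrite big_nat_cond big1 // => i /andP[/andP[hi _] _].
by rewrite /F nth_default // nm0 expr0n.
Qed.

Section WeakStar.
Variables (R : realType) (X : Type) (H : rkhs R X).
Local Notation C := (R[i]).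
Local Notation H1 := (sum_module (regular_module H)).
Local Notation H2 := (sum_module H1).

Lemma square_summable_l2 (f : nat -> H) : square_summable f ->
  (f : nat -> regular_module H) \in @l2_pred R (regular_module H) (fun=> True).
Proof.
move=> /cvg_ex[l]; rewrite seriesE => /tendstoP hl; apply/l2_predP; split=> [n []//|].
exists (re l) => N.
have e M : \sum_(i < M) `|f i| ^+ 2 = rc (\sum_(i < M) nm (f i : regular_module H) ^+ 2).
  rewrite /rc rmorph_sum; apply: eq_bigr => i _.
  by rewrite (norm_nm (f i : rkhs_hilbert H)) -rcX.
have hs : tendsto (fun M => rc (\sum_(i < N + M) nm (f i : regular_module H) ^+ 2)) l.
  move=> d /hl[M hM]; exists M => n hn; rewrite -e; apply: hM.
  by rewrite (leq_trans hn) // leq_addl.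
apply: (tendsto_re_ge hs) => M; rewrite re_rc.
rewrite -!(big_mkord xpredT (fun i => nm (f i : regular_module H) ^+ 2)).
by rewrite (big_cat_nat _ (leq_addr M N)) //= lerDl sumr_ge0 // => i _; rewrite sqr_ge0.
Qed.

Definition trace_left (p : trace_index H) : H1 :=
  L2Seq (square_summable_l2 (proj1 (svalP p))).
Definition trace_right (p : trace_index H) : H1 :=
  L2Seq (square_summable_l2 (proj2 (svalP p))).

Lemma trace_pairingE p (phi : mult H) :
  trace_pairing p (mulop phi) = dotp (md_act phi (trace_left p)) (trace_right p).
Proof.
apply: lim_tendsto; rewrite seriesE.
exact: (l2_dotP (sum_act phi (trace_left p)) (trace_right p)).
Qed.

Let trace_map (phi : mult H) : prod_topology (fun _ : trace_index H => C) :=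
  fun p => trace_pairing p (mulop phi).

Lemma trace_pairing_continuous p :
  continuous ((fun phi : mult H => trace_pairing p (mulop phi)) : mult_weakstar H -> C).
Proof.
move=> phi.
have h1 : (trace_map : mult_weakstar H -> _) @ (phi : mult_weakstar H) --> trace_map phi.
  exact: (@initial_continuous (mult H) _ trace_map).
have h2 : (fun f : prod_topology (fun _ : trace_index H => C) => f p)
    @ (trace_map phi) --> trace_map phi p.
  have /cvg_sup/(_ p) h : trace_map phi --> trace_map phi by apply: cvg_id.
  apply: cvg_trans (@initial_continuous _ _ (fun f : forall _ : trace_index H, C => f p)
     (trace_map phi)).
  exact: cvg_app h.
by move=> A hA; exact: (h1 _ (h2 _ hA)).
Qed.

(** Basic neighborhoods of 0 in the weak* topology.  The sets that contain one form a
    filter, which converges to 0 in every coordinate, hence in the product. *)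
Lemma weakstar_nbhs0 (A : set (mult H)) : nbhs (0 : mult_weakstar H) A ->
  exists (ps : seq (trace_index H)) (d : R), 0 < d /\ forall phi,
    (forall p, List.In p ps -> modc (trace_pairing p (mulop phi)) < d) -> A phi.
Proof.
move=> nA.
pose G : set_system (mult H) := [set B | exists (ps : seq (trace_index H)) (d : R),
  0 < d /\ forall phi, (forall p, List.In p ps ->
     modc (trace_pairing p (mulop phi)) < d) -> B phi].
have GF : Filter G.
  split.
  - by exists [::], 1; split.
  - move=> B B' [ps [d [d0 h]]] [ps' [d' [d0' h']]].
    exists (ps ++ ps'), (Num.min d d'); split; first by rewrite lt_min d0 d0'.
    move=> phi hphi; split; [apply: h|apply: h'] => p hp.
      have := hphi p (List.in_or_app _ _ _ (or_introl hp)).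
      by rewrite lt_min => /andP[].
    have := hphi p (List.in_or_app _ _ _ (or_intror hp)).
    by rewrite lt_min => /andP[].
  - by move=> B B' sB [ps [d [d0 h]]]; exists ps, d; split=> // phi /h /sB.
have z p : trace_map 0 p = 0 by rewrite /trace_map trace_pairingE md_act0l dot0l.
have lim : trace_map @ G --> trace_map 0.
  apply/cvg_sup => p B /=.
  rewrite (@nbhsE (initial_topology (fun f : (forall _ : trace_index H, C) => f p))) => -[_ [[U oU <-] Up] sB].
  have : nbhs (trace_map 0 p) U by exact: open_nbhs_nbhs.
  move=> /nbhs_ballP[e /= e0 hU].
  move: e0; rewrite ltcE /= => /andP[/eqP ei er].
  have ee : e = rc (re e) by case: e ei {er hU} => a b /= ->.
  exists [:: p], (re e); split=> // phi /(_ p (or_introl erefl)) h.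
  apply: sB; apply: hU; rewrite -ball_normE /= z sub0r normrN normc_modc ee rc_lt.
  exact: h.
move: nA; rewrite nbhsE => -[_ [[U oU <-] U0] sA].
have nU : nbhs (trace_map 0) U by exact: open_nbhs_nbhs.
have [ps [d [d0 h]]] := lim U nU.
by exists ps, d; split=> // phi /h /sA.
Qed.

(** A continuous linear functional is bounded by finitely many trace pairings.  Each of
    them is at most the norm of phi times a square-summable sequence, and the finitely
    many sequences are placed side by side in a second Hilbert sum. *)
Lemma weakstar_bounded (chi : mult H -> C) : character chi -> weakstar_continuous chi ->
  exists (Phi : H2) (c0 : R), 0 <= c0 /\ forall phi, modc (chi phi) <= c0 * nm (md_act phi Phi).
Proof.
move=> chi_char cchi.
have n1 : nbhs (0 : mult_weakstar H) [set phi | modc (chi phi) < 1].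
  have /cvgrPdist_lt/(_ 1 ltr01) := cchi (0 : mult_weakstar H).
  apply: filterS => phi /=; rewrite (chi0 chi_char) sub0r normrN normc_modc.
  by rewrite -rc1 rc_lt.
have [ps [d [d0 hps]]] := weakstar_nbhs0 n1.
pose B := \sum_(p <- ps) nm (trace_right p).
have B0 : 0 <= B by apply: sumr_ge0 => p _; exact: nm_ge0.
pose Phi : H2 := L2Seq (finite_l2 [seq trace_left p | p <- ps]).
have hB p : List.In p ps -> nm (trace_right p) <= B.
  rewrite /B; elim: (ps) => // q r IH [->|/IH h]; rewrite big_cons.
    by rewrite lerDl sumr_ge0 // => i _; exact: nm_ge0.
  by apply: le_trans h _; rewrite lerDr nm_ge0.
have hPhi p phi : List.In p ps -> nm (md_act phi (trace_left p)) <= nm (md_act phi Phi).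
  move=> hp; have [k hk] : exists k, nth 0 [seq trace_left p | p <- ps] k = trace_left p.
    elim: (ps) hp => // q r IH [->|/IH[k hk]]; first by exists 0%N.
    by exists k.+1.
  rewrite -hk -(@ler_pXn2r _ 2) ?nnegrE ?nm_ge0 //.
  apply: le_trans (l2_nm_ge (md_act phi Phi) k.+1).
  rewrite big_ord_recr /= lerDr sumr_ge0 // => i _; exact: sqr_ge0.
exists Phi, ((B + 1) / d); split; first by rewrite divr_ge0 ?ltW // ltr_wpDl.
move=> phi; rewrite leNgt; apply/negP => h.
set t := nm (md_act phi Phi) in h; set a := modc (chi phi) in h.
have t0 : 0 <= t := nm_ge0 _.
have a0 : 0 < a.
  by apply: le_lt_trans h; rewrite mulr_ge0 // divr_ge0 ?(ltW d0) // addr_ge0.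
(* phi rescaled so that chi takes a value of modulus 1 falls in the neighborhood *)
have : modc (chi (rc a^-1 *: phi)) < 1.
  apply: hps => p hp; rewrite trace_pairingE.
  apply: le_lt_trans (dot_CS _ _) _.
  have -> : md_act (rc a^-1 *: phi) (trace_left p) = rc a^-1 *: md_act phi (trace_left p).
    by rewrite -[_ *: phi]addr0 md_act_comb md_act0l addr0.
  rewrite nmZ modc_rc ger0_norm ?invr_ge0 ?(ltW a0) // -mulrA mulrC ltr_pdivrMr //.
  have h1 := hPhi p phi hp; have h2 := hB p hp; rewrite -/t in h1.
  have h3 : nm (md_act phi (trace_left p)) * nm (trace_right p) <= t * B.
    by apply: ler_pM; rewrite ?nm_ge0.
  move: h; rewrite mulrAC ltr_pdivrMr // mulrDl mul1r [B * t]mulrC; lra.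
have -> : chi (rc a^-1 *: phi) = rc a^-1 * chi phi.
  by rewrite -[_ *: phi]addr0 (chi_linear chi_char) (chi0 chi_char) addr0.
by rewrite modcM modc_rc ger0_norm ?invr_ge0 ?(ltW a0) // -/a mulVf ?gt_eqF // ltxx.
Qed.

Lemma rank_one_continuous (f g : H) :
  weakstar_continuous (fun phi : mult H => dotp (mulop phi f) g).
Proof.
have ss (h : H) : square_summable (fun n => if n == 0%N then h else 0).
  apply: (cvgP (`|h| ^+ 2)); rewrite seriesE; apply/tendstoP.
  apply: (@tendsto_eq _ (fun=> `|h| ^+ 2) _ _ 1%N); last exact: tendsto_cst.
  move=> [//|N] _; rewrite big_ord_recl /= big1 ?addr0 // => i _.
  by rewrite normr0 expr0n.
pose p : trace_index H := exist _ (_, _) (conj (ss f) (ss g)).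
suff -> : (fun phi : mult H => dotp (mulop phi f) g) =
    (fun phi => trace_pairing p (mulop phi)) by exact: trace_pairing_continuous.
apply/funext => phi; apply/esym/lim_tendsto; rewrite seriesE.
apply: (@tendsto_eq _ (fun=> dotp (mulop phi f) g) _ _ 1%N); last exact: tendsto_cst.
move=> [//|N] _; rewrite big_ord_recl /= big1 ?addr0 // => i _.
exact: (dot0r (mulop phi 0 : rkhs_hilbert H)).
Qed.

End WeakStar.

Section Characters.
Variables (R : realType) (X : Type) (H : rkhs R X) (one : H).
Hypothesis one1 : forall x, rk_fun H one x = 1.
Local Notation C := (R[i]).

Theorem characters_of_consistent m (j : X -> ball_of R m) : embedding H j ->
  algebraically_consistent H ->
  forall chi : mult H -> C, character chi -> weakstar_continuous chi ->
     exists x : X, forall phi : mult H, chi phi = phi x.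
Proof.
move=> jH cons chi hc wc.
have [Phi [c0 [c00 hb]]] := weakstar_bounded hc wc.
have [c1 c10 hb1] := character_bound (emb_F_series j) (emb_K_F jH) one1 hc c00 hb.
have [g [[g1 gm] hg]] :=
  character_pm_vector (emb_F_series j) (emb_K_F jH) one1 hc c10 hb1.
have [||||x hx] := cons (fun f => dotp f g).
- by move=> a u v; rewrite dotDl dotZl.
- exists (rc (nm g)) => f.
  by rewrite normc_modc (norm_nm (f : rkhs_hilbert H)) -rcM rc_le mulrC dot_CS.
- by exists one; rewrite g1 oner_eq0.
- by move=> phi f; rewrite gm (elt_mulop _ one1).
by exists x => phi; rewrite hg hx mulopE one1 mulr1.
Qed.

(** A partially multiplicative functional is determined by its values l_i at the
    coordinate multipliers, and evaluation at x gives the coordinates of j x. *)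
Theorem consistent_of_characters m (j : X -> ball_of R m) : embedding H j ->
  (forall chi : mult H -> C, character chi -> weakstar_continuous chi ->
     exists x : X, forall phi : mult H, chi phi = phi x) ->
  algebraically_consistent H.
Proof.
move=> jH hchi rho l b n0 pm.
have [g [pg hrho]] := pm_riesz one1 l b n0 pm.
have [B hB] := emb_coords jH one1.
have [z [gz _ zB]] := pm_point jH one1 hB pg.
have [g1 gm] := pg.
have [||x hx] := hchi (fun phi => dotp (mulop phi one) g).
- split.
  + by exists 1; rewrite mulop1 g1 oner_eq0.
  + by move=> a u v; rewrite mulop_comb dotDl dotZl.
  + by move=> u v; rewrite mulop_mul gm.
- exact: rank_one_continuous.
exists x => f; rewrite hrho; apply: (pm_at_point jH) => y.
rewrite gz; congr drury_arveson_kernel; apply: zeta_inj => i.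
by rewrite zB hx hB.
Qed.

End Characters.

(** * The equivalence *)

Theorem proposition5p6 (R : realType) (X : Type) (H : rkhs R X) :
  normalized H -> irreducible_space H -> complete_pick H ->
  [<-> algebraically_consistent H;
       exists (m : option nat) (j : X -> ball_of R m),
         embedding H j /\ variety (range j);
       forall (m : option nat) (j : X -> ball_of R m),
         embedding H j -> variety (range j);
       forall chi : mult H -> R[i],
         character chi -> weakstar_continuous chi ->
         exists x : X, forall phi : mult H, chi phi = phi x].
Proof.
move=> nH iH cH; have [j0 j0H] := embedding_exists nH iH cH.
have [x0 hx0] := nH; pose one := rk_kernel H x0.
have one1 x : rk_fun H one x = 1 by exact: hx0.
split; last split; last split.
- by move=> cons; exists None, j0; split=> //; apply: (variety_of_consistent one1).
- move=> [m [j [jH vj]]] m' j' j'H; apply: (variety_of_consistent one1) => //.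
  exact: (consistent_of_variety one1 jH vj).
- move=> hv; apply: (characters_of_consistent one1 j0H).
  exact: (consistent_of_variety one1 j0H (hv _ _ j0H)).
- exact: (consistent_of_characters one1 j0H).
Qed.
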